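(* Let $\nu$ be a measure on $\mathbb{R}^n$ such that $f=\log\frac{d\nu}{d\gamma}$ for some twice-differentiable function $f$. Then $$\mathcal{I}(\nu)-2\mathrm{D}_{\mathrm{KL}}(\nu\Vert\gamma)\le 2\mathcal{D}(\nu)^{2/3}\mathcal{I}(\nu)^{1/3}+\max\left(-\inf_{x\in\mathbb{R}^n}\Delta f(x),0\right).$$
   Context: $\gamma$ is the standard Gaussian measure on $\mathbb{R}^n$. For $d\nu=e^f d\gamma$: $\mathrm{D}_{\mathrm{KL}}(\nu\Vert\gamma)=\int f\,d\nu$ and $\mathcal{I}(\nu)=\int|\nabla f|^2d\nu$ (Fisher information). The Gaussian width of $K\subset\mathbb{R}^n$ is $\mathbf{GW}(K)=\mathbb{E}\sup_{x\in K}\langle x,\Gamma\rangle$ with $\Gamma\sim N(0,\mathrm{Id}_n)$, and $\mathcal{D}(\nu)=\mathcal{D}(f)=\mathbf{GW}(\{\nabla f(x):x\in\mathbb{R}^n\})$.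
   Formalization: The measure ν is taken to be a probability measure; for a general measure the inequality fails, e.g. for f equal to a negative constant c the left side is −2c·e^c > 0 while the right side is 0. *)

(* Defs.v *)
From HB Require Import structures.
From mathcomp Require Import all_boot all_order all_algebra.
From mathcomp Require Import all_classical all_reals all_analysis.
Set Implicit Arguments. Unset Strict Implicit. Unset Printing Implicit Defensive.
Import Order.TTheory GRing.Theory Num.Theory.
Import numFieldNormedType.Exports.
Local Open Scope classical_set_scope.
Local Open Scope ring_scope.

(** R^n is modelled as row vectors ['rV[R]_n] with the product (= matrix)
    topology; its Borel sigma-algebra is the one generated by open sets. *)
Definition borelRn (R : realType) (n : nat) :=
  g_sigma_algebraType (@open 'rV[R]_n).

Definition dotRn (R : realType) (n : nat) (x y : 'rV[R]_n) : R :=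
  \sum_(i < n) x ord0 i * y ord0 i.

Definition sqnormRn (R : realType) (n : nat) (x : 'rV[R]_n) : R := dotRn x x.

Definition eRn (R : realType) (n : nat) (i : 'I_n) : 'rV[R]_n := delta_mx ord0 i.

Definition gradRn (R : realType) (n : nat) (f : 'rV[R]_n -> R) (x : 'rV[R]_n)
  : 'rV[R]_n := \row_(i < n) ('D_(eRn R i) f x).

Definition laplacianRn (R : realType) (n : nat) (f : 'rV[R]_n -> R)
  (x : 'rV[R]_n) : R :=
  \sum_(i < n) 'D_(eRn R i) (fun y => 'D_(eRn R i) f y) x.

(** f is twice differentiable: f is (Frechet) differentiable everywhere and so
    is its derivative, i.e. each of its partial derivatives. *)
Definition twice_differentiable (R : realType) (n : nat) (f : 'rV[R]_n -> R) :=
  (forall x, differentiable f x) /\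
  (forall (i : 'I_n) x, differentiable (fun y => 'D_(eRn R i) f y) x).

Definition is_std_gaussian (R : realType) (n : nat)
  (gamma : probability (borelRn R n) R) : Prop :=
  forall A : 'I_n -> set R, (forall i, measurable (A i)) ->
    gamma [set x : borelRn R n | forall i, A i (x ord0 i)] =
    (\prod_(i < n) normal_prob 0 1 (A i))%E.

Local Open Scope ereal_scope.

Definition gaussian_width (R : realType) (n : nat)
  (gamma : probability (borelRn R n) R) (K : set 'rV[R]_n) : \bar R :=
  \int[gamma]_(z in setT) ereal_sup [set (dotRn x z)%:E | x in K].

Definition gradient_width (R : realType) (n : nat)
  (gamma : probability (borelRn R n) R) (f : 'rV[R]_n -> R) : \bar R :=
  gaussian_width gamma (range (gradRn f)).

Definition KL (R : realType) (n : nat) (nu : probability (borelRn R n) R)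
  (f : 'rV[R]_n -> R) : \bar R :=
  \int[nu]_(x in setT) (f x)%:E.

Definition fisher (R : realType) (n : nat) (nu : probability (borelRn R n) R)
  (f : 'rV[R]_n -> R) : \bar R :=
  \int[nu]_(x in setT) (sqnormRn (gradRn f x))%:E.

(* Main.v *)
(** It suffices to show, with [GW] the Gaussian width of the gradients and
    [M = max (- inf (Laplacian f), 0)], that [GW < oo] implies
    [I <= M + GW + 2 KL]: if [GW >= I] then [I <= GW^(2/3) I^(1/3)], and
    otherwise [GW <= GW^(2/3) I^(1/3)].

    Finite width bounds the gradient of [f]. Let [h(z)] be the supremum over [y]
    of [<grad f(y), z>], so that [f(a + r z) <= f(a) + r h(z)] for [r >= 0].
    For [0 < s < 1], a heat flow argument on the line, tensorised over the
    coordinates, shows that [f(s y + (1-s) z) <= s^2 g(y) + k(z)] for all [y, z]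
    implies [ln E e^f <= s^2 ln E e^g + E k]. Taking [g(y) = s^-2 f(s y)] and
    [k = (1-s) h] yields
    [E ((f(x) - f(s x)) e^f(x)) <= (1-s^2) KL + (1-s) GW + O((1-s)^2)].

    If [x, z] are independent standard Gaussians and [x' = s x + c z] with
    [s^2 + c^2 = 1], then [(x, x')] is exchangeable, so that
    [E ((f(x') - f(x)) (e^f(x') - e^f(x))) = - 2 E ((f(x') - f(x)) e^f(x))].
    As the Laplacian of [f] is at least [- M], averaging over [z] gives
    [E_z f(s x + c z) >= f(s x) - M c^2 / 2], and the right-hand side is at most
    [M c^2 + 2 E ((f(x) - f(s x)) e^f(x))]. Dividing by [c^2] and letting [s]
    tend to [1], Fatou's lemma bounds the left-hand side below by [I]. *)
Require Import Defs.
From HB Require Import structures.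
From mathcomp Require Import all_boot all_order all_algebra.
From mathcomp Require Import all_classical all_reals all_analysis.
From mathcomp Require Import measurable_realfun ring lra.
Import Order.TTheory GRing.Theory Num.Theory.
Import numFieldNormedType.Exports.
Local Open Scope classical_set_scope.
Local Open Scope ring_scope.

Set Implicit Arguments. Unset Strict Implicit. Unset Printing Implicit Defensive.

(** * The Gaussian measure on the line *)

(** To first order in [1 - s], the scaling inequality bounds the mean under [nu] of x . grad f(x) by
    2 KL + GW. Gaussian integration by parts would turn that mean into I plus the mean of the
    Laplacian, and the Laplacian is at least - M. The obstacle is that second derivatives exist
    everywhere but may be discontinuous and unbounded. So an exchangeable pair replaces the
    integration by parts, and a maximum principle for the heat flow uses the Laplacian only at
    single points.

    The weight s^2 has its origin in the variational formula for ln E e^f: the supremum over drifts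
    v of the mean of f at the drifted Brownian motion minus half the squared drift. Scaling by s
    means that g needs the drift v / s, whose cost is s^-2 times larger, and the weight restores the
    balance. No stochastic calculus is used: constant drifts over steps of length h, each with an
    error of order h^2, replace the optimal drift.

    Finite width makes f Lipschitz, so all functions met afterwards grow at most exponentially and
    every integral is finite. *)

Section density.
Local Open Scope ereal_scope.
Context d (T : measurableType d) (R : realType).
Variables (mu nu : {measure set T -> \bar R}) (phi : T -> R).
Hypothesis mphi : measurable_fun setT phi.
Hypothesis phi0 : forall x, (0 <= phi x)%R.
Hypothesis nuE : forall A, measurable A -> nu A = \int[mu]_(x in A) (phi x)%:E.

Import HBNNSimple.

(** Monotone convergence along simple functions reduces both sides to level sets, where [nuE]
    applies. It serves the normal law against Lebesgue measure and [nu] against [gamma]. *)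
Lemma ge0_integral_density (f : T -> \bar R) : measurable_fun setT f ->
  (forall x, 0 <= f x) ->
  \int[nu]_x f x = \int[mu]_x (f x * (phi x)%:E).
Proof.
move=> mf f0; set g := EFin \o phi.
have g0 x : 0 <= g x by rewrite lee_fin.
have mg : measurable_fun setT g by exact/measurable_EFinP.
pose h := nnsfun_approx measurableT mf.
have -> : \int[nu]_x f x = lim (\int[nu]_x (EFin \o h n) x @[n --> \oo]).
  have fE x : f x = lim ((EFin \o h n) x @[n --> \oo]).
    by apply/esym/cvg_lim => //; exact: cvg_nnsfun_approx.
  under eq_integral => x _ do rewrite fE.
  apply: monotone_convergence => //.
  - by move=> n; apply/measurable_EFinP; exact/measurable_funP.
  - by move=> n x Ex //=; rewrite lee_fin.
  - by move=> x Ex a b ab; rewrite lee_fin; exact/lefP/nd_nnsfun_approx.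
have -> : \int[mu]_x (f \* g) x =
    lim (\int[mu]_x ((EFin \o h n) \* g) x @[n --> \oo]).
  have fg x : f x * g x = lim (((EFin \o h n) \* g) x @[n --> \oo]).
    by apply/esym/cvg_lim => //; apply: cvgeZr => //; exact: cvg_nnsfun_approx.
  under eq_integral => x _ do rewrite /= fg.
  apply: monotone_convergence => [//| | |].
  - by move=> n; apply/emeasurable_funM => //; exact/measurable_EFinP.
  - by move=> n x Ex /=; rewrite mule_ge0 ?lee_fin.
  - by move=> x Ex a b ab/=; rewrite lee_wpmul2r ?lee_fin//; exact/lefP/nd_nnsfun_approx.
suff suf n : \int[nu]_x (EFin \o h n) x = \int[mu]_x ((EFin \o h n) x * g x).
  by under eq_fun do rewrite suf.
transitivity (\int[nu]_x
   (\sum_(y \in range (h n)) (y * \1_(h n @^-1` [set y]) x)%:E)).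
  by apply: eq_integral => t tE; rewrite /= fimfunE -fsumEFin.
have indich m r : measurable_fun setT (fun x => (r * \1_(h m @^-1` [set r]) x)%:E).
  by apply: (measurable_comp measurableT) => //; exact: measurable_funM.
rewrite ge0_integral_fsum//; last by move=> m y Ey; exact: nnfun_muleindic_ge0.
transitivity (\int[mu]_x (\sum_(y \in range (h n))
    (y * \1_(h n @^-1` [set y]) x)%:E * g x)); last first.
  under eq_integral => x xE.
    rewrite -ge0_mule_fsuml => [|y]; last exact: nnfun_muleindic_ge0.
    rewrite fsumEFin // -(fimfunE _ x); over.
  by [].
rewrite [RHS]ge0_integral_fsum//; last 2 first.
  - by move=> y; apply: emeasurable_funM.
  - by move=> m y Ey; rewrite mule_ge0 // nnfun_muleindic_ge0.
apply: eq_fsbigr => r rhn.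
under [LHS]eq_integral do rewrite EFinM.
rewrite integralZl_indic_nnsfun => //.
under [RHS]eq_integral do rewrite EFinM -muleA.
rewrite [RHS]ge0_integralZl//.
- rewrite integral_indic// setIT.
  under [in RHS]eq_integral do rewrite muleC.
  rewrite [in RHS](eq_integral (g \_ (h n @^-1` [set r]))); last first.
    by move=> x xE; rewrite epatch_indic.
  by rewrite -integral_mkcond -nuE.
- by apply: emeasurable_funM => //; exact/measurable_EFinP.
- by move=> t Et; rewrite mule_ge0.
- by move: rhn; rewrite inE => -[t _ <-]; rewrite lee_fin.
Qed.

End density.

Section lebesgue_affine.
Context {R : realType}.
Local Notation mu := (@lebesgue_measure R).
Local Open Scope ereal_scope.

(** Lebesgue measure is determined by half-open intervals, and on these the rescaled image measure
    has the right value. *)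
Lemma lebesgue_measure_affine (a b : R) (A : set (measurableTypeR R)) : (0 < a)%R ->
  measurable A ->
  mu A = a%:E * pushforward mu (fun x : measurableTypeR R => (a * x + b)%R : measurableTypeR R) A.
Proof.
move=> a0 mA.
have mf : measurable_fun setT (fun x : measurableTypeR R => (a * x + b)%R : measurableTypeR R).
  by apply: measurable_funD => //; apply: measurable_funM.
pose a' := NngNum (ltW a0).
pose f : {mfun measurableTypeR R >-> measurableTypeR R} := HB.pack (fun x : measurableTypeR R => (a * x + b)%R : measurableTypeR R) (isMeasurableFun.Build _ _ _ _ _ mf).
have := @lebesgue_measure_unique R (mscale a' (pushforward mu f)).
move=> /(_ mf _ A mA) -> // _ [[x y]] _ <-.
have E : f @^-1` `]x, y]%classic = `]((x - b) / a)%R, ((y - b) / a)%R]%classic.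
  by apply/seteqP; split => z /=; rewrite !in_itv/= ltr_pdivrMr// ler_pdivlMr// ltrBlDr lerBrDr mulrC.
rewrite -[RHS]/(a%:E * mu (f @^-1` `]x, y]%classic)) E.
rewrite !lebesgue_measure_itv/= !lte_fin ltr_pM2r ?invr_gt0// ltrD2r.
case: ifP => xy; last by rewrite mule0.
by rewrite -!EFinB -EFinM; congr (_%:E); field; rewrite gt_eqF.
Qed.

Lemma ge0_integral_affine (a b : R) (f : R -> \bar R) : (0 < a)%R ->
  measurable_fun setT f -> (forall x, 0 <= f x) ->
  \int[mu]_x f x = a%:E * \int[mu]_x f (a * x + b)%R.
Proof.
move=> a0 mf f0.
have mg : measurable_fun setT (fun x : measurableTypeR R => (a * x + b)%R : measurableTypeR R).
  by apply: measurable_funD => //; apply: measurable_funM.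
pose a' := NngNum (ltW a0).
rewrite -[X in _ * X](ge0_integral_pushforward mg mu measurableT mf (fun x _ => f0 x)).
rewrite -[X in X%:E * _]/((NngNum (ltW a0))%:num) -ge0_integral_mscale//.
by apply: eq_measure_integral => A mA _; exact: lebesgue_measure_affine.
Qed.

End lebesgue_affine.

Section gauss1_ge0.
Context {R : realType}.
Local Notation mu := (@lebesgue_measure R).
Local Notation g1 := (@normal_prob R 0 1).
Local Notation phi := (@normal_pdf R 0 1).
Local Open Scope ereal_scope.

Lemma normal_pdf01E (x : R) : phi x = (normal_peak 1 * expR (- x ^+ 2 / 2))%R.
Proof. by rewrite normal_pdfE ?oner_neq0// /normal_fun subr0 expr1n. Qed.

Lemma ge0_integral_normal (f : R -> \bar R) : measurable_fun setT f ->
  (forall x, 0 <= f x) -> \int[g1]_x f x = \int[mu]_x (f x * (phi x)%:E).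
Proof.
move=> mf f0; apply: (@ge0_integral_density _ _ _ mu g1) => //.
- exact: measurable_normal_pdf.
- exact: normal_pdf_ge0.
Qed.

(** Substituting [x + a] under the Lebesgue integral multiplies the normal density by the
    exponential factor. This identity is the source of the exponential moments, of the variance and
    of the smoothing by the heat flow. *)
Lemma ge0_cameron_martin (a : R) (f : R -> \bar R) : measurable_fun setT f ->
  (forall x, 0 <= f x) ->
  \int[g1]_x f x = \int[g1]_x (f (x + a)%R * (expR (- (a * x) - a ^+ 2 / 2))%:E).
Proof.
move=> mf f0.
have mfa : measurable_fun setT (fun x : R => f (x + a)%R).
  by apply: measurableT_comp => //; exact: measurable_funD.
have mE : measurable_fun setT (fun x : R => expR (- (a * x) - a ^+ 2 / 2)).
  apply: measurableT_comp => //; apply: measurable_funB => //.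
  by apply: measurableT_comp => //; exact: measurable_funM.
have mp := @measurable_normal_pdf R 0 1.
rewrite !ge0_integral_normal//; last 2 first.
- by apply: emeasurable_funM => //; exact/measurable_EFinP.
- by move=> x; rewrite mule_ge0// lee_fin expR_ge0.
rewrite (@ge0_integral_affine _ 1 a)//; last 2 first.
- by apply: emeasurable_funM => //; exact/measurable_EFinP.
- by move=> x; rewrite mule_ge0// lee_fin normal_pdf_ge0.
rewrite mul1e; apply: eq_integral => x _; rewrite mul1r -muleA; congr (_ * _).
rewrite -EFinM !normal_pdf01E mulrCA -expRD; congr (_ * expR _)%:E.
by field.
Qed.

(* Both sides integrate [F] against the density of a centred Gaussian vector with unit
   variances and covariance [c], which is symmetric in the two coordinates. *)
Lemma ge0_exchange1 (c s : R) (F : R * R -> \bar R) : (0 < s)%R ->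
  (c ^+ 2 + s ^+ 2 = 1)%R -> measurable_fun setT F -> (forall x, 0 <= F x) ->
  \int[g1]_x \int[g1]_z F (x, c * x + s * z)%R =
  \int[g1]_x \int[g1]_z F (c * x + s * z, x)%R.
Proof.
move=> s0 cs1.
have s0' : s != 0%R by rewrite gt_eqF.
pose K x y := (phi ((y - c * x) / s) * phi x)%R.
have KC x y : K x y = K y x.
  rewrite /K !normal_pdf01E [LHS]mulrACA [RHS]mulrACA -!expRD.
  have aux u v : (- ((v - c * u) / s) ^+ 2 / 2 + - u ^+ 2 / 2 =
      - (u ^+ 2 - 2 * c * u * v + v ^+ 2) / (2 * s ^+ 2))%R.
    transitivity (- (u ^+ 2 * (c ^+ 2 + s ^+ 2) - 2 * c * u * v + v ^+ 2) / (2 * s ^+ 2))%R.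
      by field.
    by rewrite cs1 mulr1.
  congr (_ * expR _)%R; rewrite !aux; congr (- _ / _)%R; ring.
have mK : measurable_fun setT (fun p : R * R => K p.1 p.2).
  apply: measurable_funM; last exact: measurableT_comp (measurable_normal_pdf _ _) _.
  apply: measurableT_comp (measurable_normal_pdf _ _) _.
  apply: measurable_funM => //; apply: measurable_funB => //.
  exact: measurable_funM.
have K0 x y : (0 <= K x y)%R by rewrite mulr_ge0 ?normal_pdf_ge0.
have main (G : R * R -> \bar R) : measurable_fun setT G -> (forall x, 0 <= G x) ->
    \int[g1]_x \int[g1]_z G (x, c * x + s * z)%R =
    (s^-1)%:E * \int[mu]_x \int[mu]_y (G (x, y) * (K x y)%:E).
  move=> mG G0.
  have inner x : \int[g1]_z G (x, c * x + s * z)%R =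
      (s^-1)%:E * \int[mu]_y (G (x, y) * (phi ((y - c * x) / s))%:E).
    have mGx : measurable_fun setT (fun y : R => G (x, y)).
      by apply: measurableT_comp => //; exact: measurable_pair1.
    rewrite ge0_integral_normal//; last first.
      by apply: (measurableT_comp mGx); apply: measurable_funD => //; exact: measurable_funM.
    rewrite [in RHS](@ge0_integral_affine _ s (c * x))//; last 2 first.
    - apply: emeasurable_funM => //; apply/measurable_EFinP.
      apply: measurableT_comp (measurable_normal_pdf _ _) _.
      by apply: measurable_funM => //; exact: measurable_funB.
    - by move=> y; rewrite mule_ge0// lee_fin normal_pdf_ge0.
    rewrite muleA -EFinM mulVf// mul1e.
    apply: eq_integral => z _; rewrite addrC; congr (_ * (phi _)%:E).
    by field.
  under eq_integral do rewrite inner.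
  have mH : measurable_fun setT (fun p : R * R => G p * (phi ((p.2 - c * p.1) / s))%:E).
    apply: emeasurable_funM => //; apply/measurable_EFinP.
    apply: measurableT_comp (measurable_normal_pdf _ _) _.
    apply: measurable_funM => //; apply: measurable_funB => //.
    exact: measurable_funM.
  have H0 p : 0 <= G p * (phi ((p.2 - c * p.1) / s))%:E.
    by rewrite mule_ge0// lee_fin normal_pdf_ge0.
  have mI := @measurable_fun_fubini_tonelli_F _ _ _ _ _ mu _ mH H0.
  rewrite ge0_integral_normal//; last 2 first.
  - by apply: measurable_funeM; exact: mI.
  - move=> x; rewrite mule_ge0 ?lee_fin ?invr_ge0 ?(ltW s0)//.
    by apply: integral_ge0 => y _; exact: (H0 (x, y)).
  under eq_integral do rewrite -muleA.
  rewrite ge0_integralZl//; last 3 first.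
  - apply: emeasurable_funM; [exact: mI|apply/measurable_EFinP].
    exact: measurable_normal_pdf.
  - move=> x _; rewrite mule_ge0 ?lee_fin ?normal_pdf_ge0//.
    by apply: integral_ge0 => y _; exact: (H0 (x, y)).
  - by rewrite lee_fin invr_ge0 ltW.
  congr (_ * _); apply: eq_integral => x _.
  rewrite -ge0_integralZr//; last 2 first.
  - exact: (measurableT_comp mH (measurable_pair1 x)).
  - by rewrite lee_fin normal_pdf_ge0.
  by apply: eq_integral => y _; rewrite -muleA -EFinM.
move=> mF F0.
rewrite (main F)//.
have mswap : measurable_fun setT (fun p : R * R => F (p.2, p.1)).
  exact: (measurableT_comp mF (@measurable_swap _ _ _ _)).
transitivity (s^-1%:E * \int[mu]_x \int[mu]_y (F (y, x) * (K x y)%:E)); last first.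
  exact/esym/(main (fun p => F (p.2, p.1)) mswap (fun p => F0 _)).
congr (_ * _).
rewrite (@fubini_tonelli _ _ _ _ _ mu mu (fun p => F p * (K p.1 p.2)%:E)).
- apply: eq_integral => y _; apply: eq_integral => x _ /=.
  by rewrite KC.
- by apply: emeasurable_funM => //; exact/measurable_EFinP.
- by move=> p; rewrite mule_ge0// lee_fin.
Qed.

End gauss1_ge0.

(** Follows from [1 + y <= expR y] used at [y] and at [- y]. The exponential on the right is
    harmless under a Gaussian. *)
Lemma expR_taylor1 (R : realType) (y : R) : `|expR y - 1 - y| <= y ^+ 2 * expR `|y|.
Proof.
have h1 := expR_ge1Dx y.
have h2 : expR y - 1 <= y * expR y.
  have := expR_ge1Dx (- y); rewrite -(ler_pM2r (expR_gt0 y)) -expRD addNr expR0.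
  nra.
rewrite ger0_norm; last lra.
have e0 := expR_gt0 y.
have [y0|y0] := leP 0 y.
  rewrite ger0_norm//; nra.
have : 1 <= expR `|y| by rewrite -[leLHS]expR0 ler_expR.
have : y * (expR y - 1 - y) <= 0 by apply: mulr_le0_ge0; lra.
nra.
Qed.

(** * Functions of at most exponential growth *)

Section ebd.
Context d (T : measurableType d) (R : realType) (w : T -> R).
Hypothesis w0 : forall x, 0 <= w x.

(** A single constant is both factor and rate, which makes the class closed under sums and products.
    Exponential moments of [w] make its members integrable, so integrability conditions become
    closure rules. The weights used are the absolute value on the line, [l1] on R^n and [w2] on
    pairs. *)
Definition ebd (F : T -> R) := measurable_fun setT F /\
  exists2 C, 0 <= C & forall x, `|F x| <= C * expR (C * w x).

Lemma ebd_le (F G : T -> R) : measurable_fun setT F -> ebd G ->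
  (forall x, `|F x| <= `|G x|) -> ebd F.
Proof.
move=> mF [mG [C C0 GC]] FG; split => //; exists C => // x.
exact: le_trans (FG x) (GC x).
Qed.

Lemma ebd_cst (c : R) : ebd (fun=> c).
Proof.
split; first exact: measurable_cst.
exists `|c| => // x; rewrite ler_peMr// -[leLHS]expR0 ler_expR mulr_ge0//.
Qed.

Lemma ebdN (F : T -> R) : ebd F -> ebd (fun x => - F x).
Proof.
move=> [mF [C C0 FC]]; split; first exact: measurableT_comp.
by exists C => // x; rewrite normrN.
Qed.

Lemma ebd_norm (F : T -> R) : ebd F -> ebd (fun x => `|F x|).
Proof.
move=> [mF [C C0 FC]]; split; first exact: measurableT_comp.
by exists C => // x; rewrite normr_id.
Qed.

Lemma ebdD (F : T -> R) G : ebd F -> ebd G -> ebd (fun x => F x + G x).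
Proof.
move=> [mF [C C0 FC]] [mG [D D0 GD]]; split; first exact: measurable_funD.
exists (C + D); first exact: addr_ge0.
move=> x; rewrite (le_trans (ler_normD _ _))// mulrDl lerD//.
  rewrite (le_trans (FC x))// ler_wpM2l// ler_expR ler_wpM2r//; lra.
rewrite (le_trans (GD x))// ler_wpM2l// ler_expR ler_wpM2r//; lra.
Qed.

Lemma ebdB (F : T -> R) G : ebd F -> ebd G -> ebd (fun x => F x - G x).
Proof. by move=> hF hG; apply: ebdD => //; exact: ebdN. Qed.

Lemma ebdM (F : T -> R) G : ebd F -> ebd G -> ebd (fun x => F x * G x).
Proof.
move=> [mF [C C0 FC]] [mG [D D0 GD]]; split; first exact: measurable_funM.
exists (C * D + (C + D)); first by rewrite !addr_ge0// mulr_ge0.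
move=> x; rewrite normrM (@le_trans _ _ ((C * D) * expR ((C + D) * w x)))//.
  rewrite [in leRHS]mulrDl expRD mulrACA ler_pM//.
have CD := mulr_ge0 C0 D0.
rewrite ler_pM ?expR_ge0//; first lra.
rewrite ler_expR ler_wpM2r//; lra.
Qed.

Lemma ebdZ (c : R) (F : T -> R) : ebd F -> ebd (fun x => c * F x).
Proof. by apply: ebdM; exact: ebd_cst. Qed.

Lemma ebdX (F : T -> R) n : ebd F -> ebd (fun x => F x ^+ n).
Proof.
move=> hF; elim: n => [|n ih].
  by under eq_fun do rewrite expr0; exact: ebd_cst.
by under eq_fun do rewrite exprS; exact: ebdM.
Qed.

Lemma ebd_expR (F : T -> R) (C : R) : measurable_fun setT F ->
  (forall x, F x <= C + C * w x) -> ebd (fun x => expR (F x)).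
Proof.
move=> mF FC; split; first exact: measurableT_comp.
exists (Num.max 0 C + expR C); first by rewrite addr_ge0 ?expR_ge0// le_max lexx.
move=> x; rewrite ger0_norm ?expR_ge0//.
apply: (@le_trans _ _ (expR C * expR (Num.max 0 C * w x))).
  rewrite -expRD ler_expR (le_trans (FC x))// lerD2l ler_wpM2r// le_max lexx orbT//.
have m0 : 0 <= Num.max 0 C by rewrite le_max lexx.
rewrite ler_pM ?expR_ge0//; first lra.
rewrite ler_expR ler_wpM2r//; have := expR_gt0 C; lra.
Qed.

Lemma ebd_lin (F : T -> R) (C : R) : measurable_fun setT F ->
  (forall x, `|F x| <= C + C * w x) -> ebd F.
Proof.
move=> mF FC; apply: (@ebd_le _ (fun x => expR (`|F x|))) => //.
  apply: (@ebd_expR _ C) => //; exact: measurableT_comp.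
move=> x; rewrite [leRHS]ger0_norm ?expR_ge0//.
by have := expR_ge1Dx `|F x|; lra.
Qed.

Variable (mu : {measure set T -> \bar R}).
Hypothesis mw : measurable_fun setT w.
Hypothesis expw : forall C : R, (\int[mu]_x (expR (C * w x))%:E < +oo)%E.

Lemma ebd_integrable (F : T -> R) : ebd F -> mu.-integrable setT (EFin \o F).
Proof.
move=> [mF [C C0 FC]]; apply/integrableP; split; first exact/measurable_EFinP.
have me : measurable_fun setT (fun x => expR (C * w x)).
  by apply: measurableT_comp => //; exact: measurable_funM.
apply: (@le_lt_trans _ _ (\int[mu]_x (C%:E * (expR (C * w x))%:E))%E).
  apply: ge0_le_integral => //=.
  - by do 2 apply: measurableT_comp => //.
  - by apply: measurable_funeM; exact/measurable_EFinP.
  - by move=> x _; rewrite lee_fin.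
rewrite ge0_integralZl//; first by rewrite lte_mul_pinfty.
exact/measurable_EFinP.
Qed.

Local Notation E F := (\int[mu]_x F x).

Lemma ebd_fin (F : T -> R) : ebd F -> (E F)%:E = (\int[mu]_x (F x)%:E)%E.
Proof. by move=> hF; rewrite fineK//; exact/integrable_fin_num/ebd_integrable. Qed.

Lemma ebd_ED (F : T -> R) G : ebd F -> ebd G ->
  \int[mu]_x (F x + G x) = E F + E G.
Proof. by move=> hF hG; rewrite RintegralD//; exact: ebd_integrable. Qed.

Lemma ebd_EB (F : T -> R) G : ebd F -> ebd G ->
  \int[mu]_x (F x - G x) = E F - E G.
Proof. by move=> hF hG; rewrite RintegralB//; exact: ebd_integrable. Qed.

Lemma ebd_EZ c (F : T -> R) : ebd F -> \int[mu]_x (c * F x) = c * E F.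
Proof. by move=> hF; rewrite RintegralZl//; exact: ebd_integrable. Qed.

Lemma ebd_le_E (F : T -> R) G : ebd F -> ebd G -> (forall x, F x <= G x) -> E F <= E G.
Proof. by move=> hF hG FG; apply: le_Rintegral => //; exact: ebd_integrable. Qed.

Lemma ebd_norm_E (F : T -> R) : ebd F -> `|E F| <= \int[mu]_x `|F x|.
Proof. by move=> hF; apply: le_normr_Rintegral => //; exact: ebd_integrable. Qed.

Lemma ebd_norm_E_le (F : T -> R) G : ebd F -> ebd G -> (forall x, `|F x| <= G x) -> `|E F| <= E G.
Proof.
move=> hF hG FG; apply: le_trans (ebd_norm_E hF) _.
by apply: ebd_le_E => //; exact: ebd_norm.
Qed.

Lemma ebd_E_gt0 F : mu setT = 1%E -> ebd F -> (forall x, 0 < F x) -> 0 < E F.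
Proof.
move=> mu1 hF F0; rewrite lt_neqAle Rintegral_ge0 ?andbT; last by move=> x _; exact: ltW.
apply/negP => /eqP E0.
have : (\int[mu]_x `|(F x)%:E|)%E = 0%E.
  transitivity (\int[mu]_x (F x)%:E)%E.
    by apply: eq_integral => x _; rewrite gee0_abs// lee_fin ltW.
  by rewrite -ebd_fin// -E0.
have mF : measurable_fun setT (EFin \o F) by apply/measurable_EFinP; case: hF.
move=> /(proj1 (@ae_eq_integral_abs _ _ _ mu setT measurableT _ mF)).
move=> [N [mN N0 sub]].
have : (mu setT <= mu N)%E.
  apply: le_measure; rewrite ?inE// => x _; apply: sub => /= /(_ I) /eqP.
  by rewrite eqe gt_eqF.
by rewrite [mu N]N0 mu1 lee_fin ler10.
Qed.

Lemma E_cst (c : R) : mu setT = 1%E -> \int[mu]_x c = c.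
Proof. by move=> mu1; rewrite Rintegral_cst// mu1 mulr1. Qed.

End ebd.

(** * Means of functions of exponential growth under the normal law *)

Section gauss1.
Context {R : realType}.
Local Notation g1 := (@normal_prob R 0 1).
Local Notation E f := (\int[g1]_x f x).

(** Cameron-Martin for the constant function one and the shift [- a]: total mass one forces the
    value. *)
Lemma integral_normal_expR (a : R) : (\int[g1]_x (expR (a * x))%:E = (expR (a ^+ 2 / 2))%:E)%E.
Proof.
have m1 : measurable_fun setT (fun x : R => (1%:E : \bar R)) by exact: measurable_cst.
have := ge0_cameron_martin (- a) m1 (fun _ => lee01).
rewrite integral_cst// [X in (_ * X)%E](@probability_setT _ _ _ g1) mul1e.
under eq_integral do rewrite mul1e mulNr opprK sqrrN expRD mulrC EFinM.
rewrite ge0_integralZl//; last first.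
  by apply/measurable_EFinP; apply: measurableT_comp => //; exact: measurable_funM.
move=> /(congr1 (fun y => (expR (a ^+ 2 / 2))%:E * y)%E).
by rewrite mule1 muleA -EFinM -expRD subrr expR0 mul1e => <-.
Qed.

Lemma integral_normal_expR_norm (C : R) : (\int[g1]_x (expR (C * `|x|))%:E < +oo)%E.
Proof.
have me (a : R) : measurable_fun setT (fun x : measurableTypeR R => (expR (a * x))%:E).
  by apply/measurable_EFinP; apply: measurableT_comp => //; exact: measurable_funM.
have mn : measurable_fun setT (fun x : measurableTypeR R => (expR (C * `|x|))%:E).
  by apply/measurable_EFinP; apply: measurableT_comp => //; apply: measurable_funM => //.
have e0 (a x : R) : (0 <= (expR (a * x))%:E)%E by rewrite lee_fin expR_ge0.
apply: (@le_lt_trans _ _ (\int[g1]_x ((expR (C * x))%:E + (expR ((- C) * x))%:E))%E).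
  apply: ge0_le_integral => //.
  exact: emeasurable_funD.
  - move=> x _; rewrite -EFinD lee_fin; have [x0|x0] := leP 0 x.
      by rewrite ger0_norm//; have := expR_gt0 (- C * x); lra.
    by rewrite ltr0_norm// mulrN mulNr; have := expR_gt0 (C * x); lra.
by rewrite ge0_integralD// !integral_normal_expR -EFinD ltry.
Qed.

Definition eb1 (F : R -> R) := @ebd _ (measurableTypeR R) R (fun x => `|x|) F.

Let w0 (x : R) : 0 <= `|x|. Proof. exact: normr_ge0. Qed.
Let mw : measurable_fun setT (fun x : measurableTypeR R => `|x| : R).
Proof. exact: measurableT_comp. Qed.
Let ew (C : R) := integral_normal_expR_norm C.

Lemma eb1_cst c : eb1 (fun=> c). Proof. exact: ebd_cst. Qed.
Lemma eb1D F G : eb1 F -> eb1 G -> eb1 (fun x => F x + G x). Proof. exact: ebdD. Qed.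
Lemma eb1B F G : eb1 F -> eb1 G -> eb1 (fun x => F x - G x). Proof. exact: ebdB. Qed.
Lemma eb1M F G : eb1 F -> eb1 G -> eb1 (fun x => F x * G x). Proof. exact: ebdM. Qed.
Lemma eb1Z c F : eb1 F -> eb1 (fun x => c * F x). Proof. exact: ebdZ. Qed.
Lemma eb1X F n : eb1 F -> eb1 (fun x => F x ^+ n). Proof. exact: ebdX. Qed.
Lemma eb1_norm F : eb1 F -> eb1 (fun x => `|F x|). Proof. exact: ebd_norm. Qed.
Lemma eb1_fin F : eb1 F -> (E F)%:E = (\int[g1]_x (F x)%:E)%E.
Proof. exact: ebd_fin. Qed.
Lemma E1D F G : eb1 F -> eb1 G -> \int[g1]_x (F x + G x) = E F + E G.
Proof. exact: ebd_ED. Qed.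
Lemma E1B F G : eb1 F -> eb1 G -> \int[g1]_x (F x - G x) = E F - E G.
Proof. exact: ebd_EB. Qed.
Lemma E1Z c F : eb1 F -> \int[g1]_x (c * F x) = c * E F.
Proof. exact: ebd_EZ. Qed.
Lemma le_E1 F G : eb1 F -> eb1 G -> (forall x, F x <= G x) -> E F <= E G.
Proof. exact: ebd_le_E. Qed.
Lemma norm_E1_le F G : eb1 F -> eb1 G -> (forall x, `|F x| <= G x) -> `|E F| <= E G.
Proof. exact: ebd_norm_E_le. Qed.
Let g1T : g1 setT = 1%E. Proof. exact: (@probability_setT _ _ _ g1). Qed.
Lemma E1_gt0 F : eb1 F -> (forall x, 0 < F x) -> 0 < E F.
Proof. exact: ebd_E_gt0. Qed.
Lemma E1_cst c : \int[g1]_x c = c.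
Proof. exact: E_cst. Qed.

Definition lipR (L : R) (f : R -> R) := forall x y, `|f x - f y| <= L * `|x - y|.

Lemma lipR_continuous L f : lipR L f -> continuous f.
Proof.
move=> fL x; apply/cvgrPdist_lt => e e0.
have L1 : 0 < `|L| + 1 by rewrite ltr_wpDl.
near=> y.
apply: (le_lt_trans (fL x y)).
apply: (@le_lt_trans _ _ ((`|L| + 1) * `|x - y|)).
  by rewrite ler_wpM2r//; have := ler_norm L; lra.
rewrite -ltr_pdivlMl//.
near: y; apply: cvgr_dist_lt => //.
by rewrite mulr_gt0// invr_gt0.
Unshelve. all: by end_near. Qed.

Lemma lipR_measurable L f : lipR L f -> measurable_fun setT f.
Proof. by move=> fL; apply: continuous_measurable_fun; exact: lipR_continuous fL. Qed.

Lemma lipR_bound L f x : 0 <= L -> lipR L f -> `|f x| <= (`|f 0| + L) + (`|f 0| + L) * `|x|.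
Proof.
move=> L0 fL; have := fL x 0; rewrite subr0 => h.
have : `|f x| <= `|f 0| + `|f x - f 0| by rewrite -[X in `|X| <= _](subrK (f 0)) addrC ler_normD.
have := normr_ge0 (f 0); have := normr_ge0 x; nra.
Qed.

Lemma lipR_eb1 L f : 0 <= L -> lipR L f -> eb1 f.
Proof.
move=> L0 fL; apply: (@ebd_lin _ _ _ _ _ _ (`|f 0| + L)) => //.
  exact: lipR_measurable fL.
by move=> x; exact: lipR_bound.
Qed.

Lemma lipR_expR_eb1 L f : 0 <= L -> lipR L f -> eb1 (fun r => expR (f r)).
Proof.
move=> L0 fL; apply: (@ebd_expR _ _ _ _ _ _ (`|f 0| + L)) => //.
  exact: lipR_measurable fL.
by move=> x; apply: le_trans (ler_norm _) _; exact: lipR_bound.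
Qed.

Lemma eb1_id : eb1 id.
Proof. by apply: (@lipR_eb1 1) => // x y; rewrite mul1r. Qed.

Lemma E1_cameron_martin (a : R) (F : R -> R) : (forall x, 0 <= F x) -> measurable_fun setT F ->
  E F = \int[g1]_r (F (r + a) * expR (- (a * r) - a ^+ 2 / 2)).
Proof.
move=> F0 mF; rewrite /Rintegral (@ge0_cameron_martin _ a)//=.
exact/measurable_EFinP.
Qed.

Lemma ge0_integral_normalN (F : R -> \bar R) : measurable_fun setT F ->
  (forall x, (0 <= F x)%E) -> (\int[g1]_x F (- x)%R = \int[g1]_x F x)%E.
Proof.
move=> mF F0.
have mN : measurable_fun setT (-%R : measurableTypeR R -> measurableTypeR R) by [].
have mFN : measurable_fun setT (fun x : R => F (- x)) by exact: measurableT_comp.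
rewrite !ge0_integral_normal//.
have mG : measurable_fun setT (fun x : R => F x * (normal_pdf 0 1 x)%:E)%E.
  by apply: emeasurable_funM => //; apply/measurable_EFinP; exact: measurable_normal_pdf.
have G0 x : (0 <= F x * (normal_pdf 0 1 x)%:E)%E by rewrite mule_ge0// lee_fin normal_pdf_ge0.
have := ge0_integral_pushforward mN (@lebesgue_measure R) measurableT mG (fun x _ => G0 x).
rewrite preimage_setT.
under [in X in _ = X -> _]eq_integral do rewrite /= !normal_pdf01E sqrrN -normal_pdf01E.
move=> <-; apply: eq_measure_integral => A mA _; exact: lebesgue_measureN.
Qed.

(** The positive part [P] of an odd [F] satisfies [F x = P x - P (- x)], and reflection gives both
    terms the same mean. *)
Lemma E1_odd F : eb1 F -> (forall x, F (- x) = - F x) -> E F = 0.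
Proof.
move=> [mF [C C0 FC]] FN.
have eF : eb1 F by split => //; exists C.
pose P x := Num.max (F x) 0.
have mP : measurable_fun setT P by apply: measurable_maxr.
have eP : eb1 P.
  apply: (@ebd_le _ _ _ _ P F) => // x; rewrite /P; case: (leP (F x) 0) => h; rewrite ?normr0//.
have mPN : measurable_fun setT (fun x : R => P (- x)) by exact: measurableT_comp.
have ePN : eb1 (fun x => P (- x)).
  apply: (@ebd_le _ _ _ _ _ F) => // x; rewrite /P FN.
  by case: (leP (- F x) 0) => h; rewrite ?normr0// normrN.
have -> : E F = \int[g1]_x (P x - P (- x)).
  apply: eq_Rintegral => x _; rewrite /P FN.
  by case: (leP (F x) 0); case: (leP (- F x) 0) => *; lra.
rewrite E1B// /Rintegral (@ge0_integral_normalN (fun x => (P x)%:E)) ?subrr//.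
- exact/measurable_EFinP.
- by move=> x; rewrite lee_fin le_max lexx orbT.
Qed.

Lemma E1_id : \int[g1]_r r = 0.
Proof. exact: E1_odd eb1_id _. Qed.

End gauss1.

(** * The heat semigroup on the line *)

Section heat1.
Context {R : realType}.
Local Notation g1 := (@normal_prob R 0 1).
Local Notation E f := (\int[g1]_x f x).

Lemma eb1_affine (f : R -> R) x a : eb1 f -> eb1 (fun r => f (x + a * r)).
Proof.
move=> [mf [C C0 fC]]; split.
  apply: measurableT_comp => //; apply: measurable_funD => //; exact: measurable_funM.
exists (C * expR (C * `|x|) + C * `|a|).
  by rewrite addr_ge0// mulr_ge0// expR_ge0.
move=> r; apply: le_trans (fC _) _.
apply: (@le_trans _ _ ((C * expR (C * `|x|)) * expR (C * `|a| * `|r|))).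
  rewrite -mulrA -expRD ler_wpM2l// ler_expR -mulrA -mulrDr ler_wpM2l//.
  by rewrite -normrM ler_normD.
have e0 : 0 <= C * expR (C * `|x|) by rewrite mulr_ge0// expR_ge0.
have e1 : 0 <= C * `|a| by rewrite mulr_ge0.
rewrite ler_pM ?expR_ge0//; first lra.
rewrite ler_expR ler_wpM2r//; lra.
Qed.

(** Adding and subtracting the absolute value of [F] leaves two nonnegative functions, for which the
    identity is known. The same device extends later Tonelli-type identities to signed functions. *)
Lemma E1_cm (a : R) (F : R -> R) : eb1 F ->
  E F = \int[g1]_r (F (r + a) * expR (- (a * r) - a ^+ 2 / 2)).
Proof.
move=> eF.
have eexp : eb1 (fun r : R => expR (- (a * r) - a ^+ 2 / 2)).
  apply: (@lipR_expR_eb1 _ `|a|) => // x y.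
  rewrite -normrM -normrN; rewrite le_eqVlt; apply/orP; left; apply/eqP; congr (`|_|); ring.
have sh G : eb1 G -> eb1 (fun r : R => G (r + a)).
  move=> eG; have := eb1_affine a 1 eG.
  by under eq_fun do rewrite mul1r addrC.
have eFn := eb1_norm eF.
have -> : E F = \int[g1]_r ((F r + `|F r|) - `|F r|).
  by apply: eq_Rintegral => r _; rewrite addrK.
have eP := eb1D eF eFn.
rewrite E1B// (@E1_cameron_martin _ a (fun r => F r + `|F r|)); last 2 first.
- by move=> r; rewrite -lerBlDr sub0r lerNl -normrN ler_norm.
- by case: eP.
rewrite (@E1_cameron_martin _ a (fun r => `|F r|))//; last by case: eFn.
rewrite -E1B.
- by apply: eq_Rintegral => r _; rewrite -mulrBl addrK.
- exact: eb1M (sh _ eP) eexp.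
- exact: eb1M (sh _ eFn) eexp.
Qed.

(** Cameron-Martin differentiated in the shift. As [r] has mean zero, [(r + a) * expR (- (a * r))]
    has mean zero for every [a]. Replacing the exponential by [1 - a * r] changes the mean to [a]
    times one minus the second moment, with an error of order [a ^+ 2]; then [a] tends to zero. *)
Lemma E1_sqr : \int[g1]_r (r ^+ 2) = 1 :> R.
Proof.
have eid := @eb1_id R.
pose C : R := \int[g1]_r ((`|r| + 1) * (r ^+ 2 * expR `|r|)).
have eC : eb1 (fun r : R => (`|r| + 1) * (r ^+ 2 * expR `|r|)).
  apply: eb1M; first by apply: eb1D; [exact: eb1_norm|exact: eb1_cst].
  apply: eb1M; first exact: eb1X.
  by apply: (@lipR_expR_eb1 _ 1) => // x y; rewrite mul1r ler_dist_dist.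
have C0 : 0 <= C.
  by rewrite /C Rintegral_ge0// => r _; rewrite mulr_ge0 ?addr_ge0// mulr_ge0 ?expR_ge0 ?sqr_ge0.
have main (a : R) : 0 < a <= 1 -> `|1 - \int[g1]_r (r ^+ 2)| <= a * C.
  move=> /andP[a0 a1].
  have eexp : eb1 (fun r : R => expR (- (a * r))).
    apply: (@lipR_expR_eb1 _ a); first exact: ltW.
    move=> x y; rewrite -[X in _ <= X * _](gtr0_norm a0) -normrM -normrN.
    rewrite le_eqVlt; apply/orP; left; apply/eqP; congr (`|_|); ring.
  have eid1 : eb1 (fun r : R => r + a) by apply: eb1D => //; exact: eb1_cst.
  have h0 : \int[g1]_r ((r + a) * expR (- (a * r))) = 0.
    have := E1_cm a eid; rewrite E1_id.
    under eq_Rintegral do rewrite expRD mulrA mulrC.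
    rewrite E1Z; last exact: eb1M.
    by move=> /esym/eqP; rewrite mulf_eq0 gt_eqF ?expR_gt0//= => /eqP.
  have h1 : \int[g1]_r ((r + a) * (1 - a * r)) = a * (1 - \int[g1]_r (r ^+ 2)).
    transitivity (\int[g1]_r ((1 - a ^+ 2) * r + (a - a * r ^+ 2))).
      by apply: eq_Rintegral => r _; ring.
    rewrite E1D ?E1Z ?E1_id ?mulr0 ?add0r//.
    - rewrite E1B ?E1_cst ?E1Z; [ring|exact: eb1X|exact: eb1_cst|].
      by apply: eb1Z; exact: eb1X.
    - exact: eb1Z.
    - by apply: eb1B; [exact: eb1_cst|apply: eb1Z; exact: eb1X].
  have e2 : eb1 (fun r : R => (r + a) * (1 - a * r)).
    by apply: eb1M => //; apply: eb1B; [exact: eb1_cst|exact: eb1Z].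
  have e3 : eb1 (fun r : R => (r + a) * expR (- (a * r))) by exact: eb1M.
  rewrite -(ler_pM2l a0) -[X in X * `|_| <= _](gtr0_norm a0) -normrM -h1.
  have -> : \int[g1]_r ((r + a) * (1 - a * r)) =
      \int[g1]_r ((r + a) * (1 - a * r) - (r + a) * expR (- (a * r))).
    by rewrite E1B// h0 subr0.
  rewrite mulrA -E1Z//.
  apply: norm_E1_le; [exact: eb1B|exact: eb1Z|move=> r].
  rewrite -mulrBr normrM mulrCA ler_pM//.
    by rewrite (le_trans (ler_normD _ _))// lerD2l gtr0_norm.
  rewrite (_ : _ - _ = - (expR (- (a * r)) - 1 - - (a * r))); last by ring.
  rewrite normrN; apply: le_trans (expR_taylor1 _) _.
  rewrite sqrrN exprMn -expr2 -mulrA ler_wpM2l ?sqr_ge0// ler_wpM2l ?sqr_ge0//.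
  rewrite ler_expR normrN normrM gtr0_norm//.
  by rewrite ler_piMl.
apply/eqP; rewrite eq_sym -subr_eq0 -normr_le0; apply/ler_addgt0Pr => e e0.
rewrite add0r.
have C1 : 0 < C + 1 by rewrite ltr_wpDl.
pose a := Num.min 1 (e / (C + 1)).
have a0 : 0 < a <= 1 by rewrite lt_min ltr01 divr_gt0//= ge_min lexx.
apply: le_trans (main a a0) _.
apply: (@le_trans _ _ (e / (C + 1) * (C + 1))); last by rewrite divfK// gt_eqF.
rewrite ler_pM//; [by case/andP: a0 => /ltW|by rewrite ge_min lexx orbT|lra].
Qed.

(* Heat flow with the time normalised so that [t] is the variance. *)
Definition heat (f : R -> R) (t x : R) : R := \int[g1]_r f (x + Num.sqrt t * r).

Lemma heat0 f x : heat f 0 x = f x.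
Proof.
rewrite /heat sqrtr0; under eq_Rintegral do rewrite mul0r addr0.
exact: E1_cst.
Qed.

Let meas2 (f : R -> R) (t : R) : measurable_fun setT f ->
  measurable_fun setT (fun p : R * R => f (p.1 + t * p.2)).
Proof.
move=> mf; apply: measurableT_comp => //; apply: measurable_funD => //.
exact: measurable_funM.
Qed.

Lemma eb1_heat f t : eb1 f -> eb1 (heat f t).
Proof.
move=> ef.
have mge0 g : eb1 g -> (forall x, 0 <= g x) -> measurable_fun setT (heat g t).
  move=> eg g0.
  have mg : measurable_fun setT (fun p : R * R => (g (p.1 + Num.sqrt t * p.2))%:E).
    by apply/measurable_EFinP; apply: meas2; case: eg.
  have := @measurable_fun_fubini_tonelli_F _ _ _ _ _ g1 _ mg.
  move=> /(_ (fun p => g0 _)) h.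
  exact: (measurableT_comp (fine_measurable measurableT) h).
split.
  have -> : heat f t = (fun x => heat (fun y => f y + `|f y|) t x - heat (fun y => `|f y|) t x).
    apply/funext => x; rewrite /heat E1D; [ring|exact: eb1_affine|].
    exact/eb1_norm/eb1_affine.
  apply: measurable_funB; apply: mge0 => //.
  - by apply: eb1D => //; exact: eb1_norm.
  - by move=> x; rewrite -lerBlDr sub0r lerNl -normrN ler_norm.
  - exact: eb1_norm.
case: (ef) => mf [C C0 fC].
have eexp a : eb1 (fun r : R => expR (a * `|r|)).
  apply: (@lipR_expR_eb1 _ `|a|) => // x y.
  by rewrite -mulrBr normrM ler_wpM2l// ler_dist_dist.
pose D := C * \int[g1]_r expR (C * Num.sqrt t * `|r|).
have D0 : 0 <= D by rewrite mulr_ge0// Rintegral_ge0// => r _; rewrite expR_ge0.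
exists (D + C); first by rewrite addr_ge0.
move=> x.
apply: (@le_trans _ _ (D * expR (C * `|x|))); last first.
  rewrite ler_pM ?expR_ge0//; first lra.
  rewrite ler_expR ler_wpM2r//; lra.
rewrite /D mulrAC -E1Z//.
apply: norm_E1_le; [exact: eb1_affine|exact: eb1Z|].
move=> r; apply: le_trans (fC _) _.
rewrite -[leRHS]mulrA -expRD ler_wpM2l// ler_expR -mulrA -mulrDr ler_wpM2l//.
rewrite (le_trans (ler_normD _ _))// normrM [`|Num.sqrt _|]ger0_norm//.
Qed.

(** Apply [ge0_exchange1] with weights [c], [s] proportional to [Num.sqrt a], [Num.sqrt b] to a
    function of the second coordinate only. One side is the iterated average, and on the other the
    inner integrand is constant. *)
Lemma heat_heat f a b x : eb1 f -> 0 <= a -> 0 <= b ->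
  heat (heat f b) a x = heat f (a + b) x.
Proof.
move=> ef; rewrite le_eqVlt => /predU1P[<- _|a0]; first by rewrite heat0 add0r.
rewrite le_eqVlt => /predU1P[<-|b0].
  rewrite addr0 /heat; apply: eq_Rintegral => r _.
  exact: heat0.
have T0 : 0 < a + b by exact: addr_gt0.
have main g : eb1 g -> (forall x, 0 <= g x) -> heat (heat g b) a x = heat g (a + b) x.
  move=> eg g0; have [mg _] := eg.
  pose c := Num.sqrt (a / (a + b)); pose s := Num.sqrt (b / (a + b)).
  have s0 : 0 < s by rewrite sqrtr_gt0 divr_gt0.
  have cs1 : c ^+ 2 + s ^+ 2 = 1.
    rewrite !sqr_sqrtr ?divr_ge0 ?(ltW a0) ?(ltW b0) ?(ltW T0)//.
    by rewrite -mulrDl divff// gt_eqF.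
  have Ta : Num.sqrt (a + b) * c = Num.sqrt a.
    by rewrite -sqrtrM ?(ltW T0)// mulrC divfK// gt_eqF.
  have Tb : Num.sqrt (a + b) * s = Num.sqrt b.
    by rewrite -sqrtrM ?(ltW T0)// mulrC divfK// gt_eqF.
  pose F := fun p : R * R => (g (x + Num.sqrt (a + b) * p.2))%:E.
  have mF : measurable_fun setT F.
    apply/measurable_EFinP; apply: measurableT_comp => //.
    by apply: measurable_funD => //; exact: measurable_funM.
  have F0 p : (0 <= F p)%E by rewrite lee_fin.
  have := ge0_exchange1 s0 cs1 mF F0.
  rewrite /F/= => h; rewrite /heat.
  congr fine.
  transitivity (\int[g1]_y \int[g1]_z (g (x + Num.sqrt (a + b) * (c * y + s * z)))%:E)%E.
    apply: eq_integral => y _; rewrite eb1_fin; last exact: eb1_affine.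
    apply: eq_integral => z _; congr ((g _)%:E).
    by rewrite mulrDr !mulrA Ta Tb addrA.
  rewrite h; apply: eq_integral => y _.
  by rewrite integral_cst//= [X in (_ * X)%E](@probability_setT _ _ _ g1) mule1.
have split_heat t y : heat f t y = heat (fun y => f y + `|f y|) t y - heat (fun y => `|f y|) t y.
  rewrite /heat E1D; [ring|exact: eb1_affine|].
  exact/eb1_norm/eb1_affine.
have efn := eb1_norm ef.
have efp := eb1D ef efn.
rewrite [RHS]split_heat -!main//; last first.
  by move=> y; rewrite -lerBlDr sub0r lerNl -normrN ler_norm.
rewrite {1}/heat; under eq_Rintegral do rewrite split_heat.
by rewrite E1B//; apply: eb1_affine; exact: eb1_heat.
Qed.

End heat1.

(** * Heat flow of exponentials on the line *)

Section lheat.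
Context {R : realType}.
Local Notation g1 := (@normal_prob R 0 1).
Local Notation E f := (\int[g1]_x f x).
Implicit Types (f g k u : R -> R) (x y z t L : R).

Lemma eb1_norm_id : eb1 (fun r : R => `|r|).
Proof. exact/eb1_norm/eb1_id. Qed.

Lemma eb1_expR_norm (a b : R) : eb1 (fun r : R => expR (a + b * `|r|)).
Proof.
apply: (@lipR_expR_eb1 _ `|b|) => // x y.
rewrite opprD addrACA subrr add0r -mulrBr normrM ler_wpM2l//.
exact: ler_dist_dist.
Qed.

Lemma lipR_heat L f t : 0 <= L -> lipR L f -> lipR L (heat f t).
Proof.
move=> L0 fL x y; have ef := lipR_eb1 L0 fL.
rewrite /heat -E1B; [|exact: eb1_affine|exact: eb1_affine].
rewrite -[leRHS](@E1_cst R); apply: norm_E1_le.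
- by apply: eb1B; exact: eb1_affine.
- exact: eb1_cst.
- move=> r; apply: le_trans (fL _ _) _.
  by rewrite opprD addrACA subrr addr0.
Qed.

Lemma heat_expR_gt0 L f t x : 0 <= L -> lipR L f -> 0 < heat (fun y => expR (f y)) t x.
Proof.
move=> L0 fL; apply: E1_gt0; last by move=> r; exact: expR_gt0.
exact: (eb1_affine _ _ (lipR_expR_eb1 L0 fL)).
Qed.

(** The Cole-Hopf transform, which solves u_t = (u'' + (u')^2) / 2. By the variational formula it is
    a supremum over drifts; [lheat_ge] and [lheat_le] are the two halves of that formula for short
    times and a constant drift. *)
Definition lheat f t x : R := ln (heat (fun y => expR (f y)) t x).

Lemma expR_lheat L f t x : 0 <= L -> lipR L f ->
  expR (lheat f t x) = heat (fun y => expR (f y)) t x.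
Proof. by move=> L0 fL; rewrite lnK// posrE; exact: (heat_expR_gt0 _ _ L0 fL). Qed.

Lemma lipR_lheat L f t : 0 <= L -> lipR L f -> lipR L (lheat f t).
Proof.
move=> L0 fL.
have ef := lipR_expR_eb1 L0 fL.
have le1 x y : lheat f t x <= L * `|x - y| + lheat f t y.
  rewrite -ler_expR (expR_lheat t x L0 fL) [leRHS]expRD (expR_lheat t y L0 fL) /heat -E1Z; last exact: (eb1_affine _ _ ef).
  apply: le_E1; [exact: (eb1_affine _ _ ef)|by apply: eb1Z; exact: (eb1_affine _ _ ef)|].
  move=> r; rewrite -expRD ler_expR.
  have := fL (x + Num.sqrt t * r) (y + Num.sqrt t * r).
  rewrite opprD addrACA subrr addr0 => h.
  have := ler_norm (f (x + Num.sqrt t * r) - f (y + Num.sqrt t * r)); lra.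
move=> x y; rewrite ler_norml; apply/andP; split.
  by rewrite lerNl opprB lerBlDr distrC.
by rewrite lerBlDr.
Qed.

Lemma lheatD L f t s x : 0 <= L -> lipR L f -> 0 <= t -> 0 <= s ->
  lheat f (s + t) x = lheat (lheat f t) s x.
Proof.
move=> L0 fL t0 s0; rewrite /lheat; congr ln.
rewrite -heat_heat//; last exact: (lipR_expR_eb1 L0 fL).
by apply: eq_Rintegral => r _; rewrite (expR_lheat _ _ L0 fL).
Qed.

Lemma heat_tilt L f t w x : 0 <= L -> lipR L f -> 0 <= t ->
  heat (fun y => expR (f y)) t x =
  \int[g1]_r expR (f (x + Num.sqrt t * r + t * w) - Num.sqrt t * w * r - t * w ^+ 2 / 2).
Proof.
move=> L0 fL t0; rewrite /heat (@E1_cm _ (Num.sqrt t * w)); last first.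
  exact: (eb1_affine _ _ (lipR_expR_eb1 L0 fL)).
apply: eq_Rintegral => r _; rewrite -expRD; congr expR.
have : Num.sqrt t ^+ 2 = t by rewrite sqr_sqrtr.
move: (Num.sqrt t) => s <-.
have -> : x + s * (r + s * w) = x + s * r + s ^+ 2 * w by ring.
by field.
Qed.

Lemma E1_sqrt_tilt f t w x c : eb1 f ->
  \int[g1]_r (f (x + Num.sqrt t * r + t * w) - Num.sqrt t * w * r - c) =
  \int[g1]_r f (x + Num.sqrt t * r + t * w) - c.
Proof.
move=> ef.
have e1 : eb1 (fun r => f (x + Num.sqrt t * r + t * w)).
  have := eb1_affine (x + t * w) (Num.sqrt t) ef.
  by under eq_fun do rewrite addrAC.
have e2 : eb1 (fun r : R => Num.sqrt t * w * r) by apply: eb1Z; exact: eb1_id.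
rewrite E1B; [|exact: eb1B|exact: eb1_cst].
by rewrite E1B// E1_cst E1Z ?E1_id ?mulr0 ?subr0//; exact: eb1_id.
Qed.

Lemma eb1_tilt f t w x c : eb1 f ->
  eb1 (fun r => f (x + Num.sqrt t * r + t * w) - Num.sqrt t * w * r - c).
Proof.
move=> ef.
have e1 : eb1 (fun r => f (x + Num.sqrt t * r + t * w)).
  have := eb1_affine (x + t * w) (Num.sqrt t) ef.
  by under eq_fun do rewrite addrAC.
by apply: eb1B; [apply: eb1B => //; apply: eb1Z; exact: eb1_id|exact: eb1_cst].
Qed.

Lemma lipR_tilt L f t w x c : 0 <= L -> lipR L f ->
  lipR (L * Num.sqrt t + Num.sqrt t * `|w|) (fun r => f (x + Num.sqrt t * r + t * w) - Num.sqrt t * w * r - c).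
Proof.
move=> L0 fL r r'.
rewrite (_ : _ - _ = (f (x + Num.sqrt t * r + t * w) - f (x + Num.sqrt t * r' + t * w)) - Num.sqrt t * w * (r - r')); last by ring.
rewrite (le_trans (ler_normB _ _))// mulrDl lerD//.
  apply: le_trans (fL _ _) _; rewrite -mulrA ler_wpM2l//.
  rewrite [X in `|X|](_ : _ = Num.sqrt t * (r - r')); last by ring.
  by rewrite normrM ger0_norm.
by rewrite !normrM [`|Num.sqrt t|]ger0_norm.
Qed.

(* Shifting the Gaussian by [sqrt t w] (Cameron-Martin) and applying Jensen's inequality. *)
Lemma lheat_ge L f t w x : 0 <= L -> lipR L f -> 0 <= t ->
  \int[g1]_r f (x + Num.sqrt t * r + t * w) - t * w ^+ 2 / 2 <= lheat f t x.
Proof.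
move=> L0 fL t0; have ef := lipR_eb1 L0 fL.
rewrite -ler_expR (expR_lheat _ _ L0 fL) (heat_tilt w x L0 fL t0).
rewrite -(E1_sqrt_tilt t w x _ ef).
set Y := (fun r => _); set m := \int[g1]_r _.
have eY : eb1 Y by exact: eb1_tilt.
have Ls : 0 <= L * Num.sqrt t + Num.sqrt t * `|w| by rewrite addr_ge0// mulr_ge0.
have eeY : eb1 (fun r => expR (Y r)) by apply: (lipR_expR_eb1 Ls); exact: lipR_tilt.
(* The tangent of [expR] at [m], evaluated at [Y r], has mean [expR m] and stays below
   [expR (Y r)]. *)
have -> : expR m = \int[g1]_r (expR m * (1 + (Y r - m))).
  have e3 : eb1 (fun r => Y r - m) by apply: eb1B => //; exact: eb1_cst.
  have e4 := eb1D (eb1_cst 1) e3.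
  rewrite E1Z// E1D//; last exact: eb1_cst.
  rewrite E1B//; last exact: eb1_cst.
  by rewrite !E1_cst subrr addr0 mulr1.
apply: le_E1 => //.
  by apply: eb1Z; apply: eb1D; [exact: eb1_cst|apply: eb1B => //; exact: eb1_cst].
move=> r; rewrite -[leRHS]/(expR (Y r)).
have -> : expR (Y r) = expR m * expR (Y r - m) by rewrite -expRD addrC subrK.
by rewrite ler_wpM2l ?expR_ge0// expR_ge1Dx.
Qed.

(* The converse of [lheat_ge], up to order [t^2], when the drift [v] is the derivative of [u]
   at [x]: the exponent then has no first order term after the shift. *)
Lemma lheat_le (L A V : R) : 0 <= L -> 0 <= A -> 0 <= V ->
  exists2 C, 0 <= C & forall u x v t, lipR L u -> 0 < t <= 1 -> `|v| <= V ->
    (forall h, `|u (x + h) - u x - v * h| <= A * h ^+ 2) ->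
    lheat u t x <= \int[g1]_r u (x + Num.sqrt t * r + t * v) - t * v ^+ 2 / 2 + C * t ^+ 2.
Proof.
move=> L0 A0 V0.
(* [B] controls the growth of the exponent in [r], and [c] its size relative to [t]. *)
pose B := L + V + L * V + V ^+ 2.
pose c := 2 * A * (V ^+ 2 + 1) + V ^+ 2.
have c0 : 0 <= c by rewrite addr_ge0// ?mulr_ge0// ?addr_ge0 ?sqr_ge0.
have B0 : 0 <= B by rewrite !addr_ge0// ?mulr_ge0// sqr_ge0.
pose G := fun r : R => (c * (1 + r ^+ 2)) ^+ 2 * expR (B + B * `|r|).
have eG : eb1 G.
  apply: eb1M; last exact: eb1_expR_norm.
  apply: eb1X; apply: eb1Z; apply: eb1D; [exact: eb1_cst|apply: eb1X; exact: eb1_id].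
exists (E G); first by rewrite Rintegral_ge0// => r _; rewrite mulr_ge0 ?sqr_ge0 ?expR_ge0.
move=> u x v t uL /andP[t0 t1] vV uA.
have eu := lipR_eb1 L0 uL.
pose Y r := u (x + Num.sqrt t * r + t * v) - Num.sqrt t * v * r - (t * v ^+ 2 / 2 + u x).
have eY : eb1 Y by exact: eb1_tilt.
have Ls : 0 <= L * Num.sqrt t + Num.sqrt t * `|v| by rewrite addr_ge0// mulr_ge0.
have eeY : eb1 (fun r => expR (Y r)) by apply: (lipR_expR_eb1 Ls); exact: lipR_tilt.
have EY : E Y = \int[g1]_r u (x + Num.sqrt t * r + t * v) - (t * v ^+ 2 / 2 + u x).
  exact: E1_sqrt_tilt.
have heatE : heat (fun y => expR (u y)) t x = expR (u x) * \int[g1]_r expR (Y r).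
  rewrite (heat_tilt v x L0 uL (ltW t0)) -E1Z//; apply: eq_Rintegral => r _.
  by rewrite -expRD; congr expR; rewrite /Y; ring.
have st := sqr_sqrtr (ltW t0).
have s0 : 0 <= Num.sqrt t by [].
have s1 : Num.sqrt t <= 1 by rewrite -sqrtr1 ler_wsqrtr.
have v2 : v ^+ 2 <= V ^+ 2 by rewrite -[v ^+ 2]real_normK ?num_real// lerXn2r ?nnegrE.
(* For [h] the total displacement, the subtracted terms amount to [v * h - t * v ^+ 2 / 2], so the
   part of order [Num.sqrt t] cancels and only [A * h ^+ 2] and a term of order [t] remain. Thus [Y]
   has order [t], and replacing its exponential by [1 + Y] costs order [t ^+ 2]. *)
have Yc r : `|Y r| <= t * (c * (1 + r ^+ 2)).
  pose h := Num.sqrt t * r + t * v.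
  have -> : Y r = (u (x + h) - u x - v * h) + t * v ^+ 2 / 2.
    by rewrite /Y /h [x + (_ + _)]addrA; field.
  apply: le_trans (ler_normD _ _) _.
  rewrite [`|_ / 2|]ger0_norm; last by rewrite divr_ge0// mulr_ge0 ?sqr_ge0// ltW.
  have h2 : h ^+ 2 <= 2 * t * (r ^+ 2 + V ^+ 2).
    have -> : h ^+ 2 = t * (r + Num.sqrt t * v) ^+ 2.
      by rewrite /h; move: st; move: (Num.sqrt t) => s <-; ring.
    have : (r + Num.sqrt t * v) ^+ 2 <= 2 * (r ^+ 2 + V ^+ 2).
      have : (Num.sqrt t * v) ^+ 2 <= V ^+ 2.
        rewrite exprMn st; have := sqr_ge0 v; nra.
      have := sqr_ge0 (r - Num.sqrt t * v); nra.
    by rewrite -(ler_pM2l t0) => /le_trans; apply; rewrite le_eqVlt; apply/orP; left; apply/eqP; ring.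
  have := uA h.
  have hA : A * h ^+ 2 <= A * (2 * t * (r ^+ 2 + V ^+ 2)) by rewrite ler_wpM2l.
  have r2 := sqr_ge0 r.
  have V2 := sqr_ge0 V.
  have p1 : 0 <= t * A * (V ^+ 2 * r ^+ 2 + 1) by apply: mulr_ge0; [exact: mulr_ge0 (ltW t0) A0|rewrite addr_ge0// mulr_ge0].
  have p2 : 0 <= t * V ^+ 2 * r ^+ 2 by rewrite mulr_ge0// mulr_ge0// ltW.
  have p3 : t * v ^+ 2 <= t * V ^+ 2 by rewrite ler_pM2l.
  have p4 : 0 <= t * V ^+ 2 by rewrite mulr_ge0// ltW.
  rewrite /c; lra.
have YB r : `|Y r| <= B + B * `|r|.
  have -> : Y r = (u (x + Num.sqrt t * r + t * v) - u x) - (Num.sqrt t * v * r + t * v ^+ 2 / 2).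
    by rewrite /Y; ring.
  apply: le_trans (ler_normB _ _) _.
  have q1 := uL (x + Num.sqrt t * r + t * v) x.
  have q2 : `|x + Num.sqrt t * r + t * v - x| <= `|r| + V.
    rewrite [X in `|X|](_ : _ = Num.sqrt t * r + t * v); last by ring.
    rewrite (le_trans (ler_normD _ _))// !normrM lerD//.
      by rewrite ger0_norm// ler_piMl.
    rewrite gtr0_norm// (le_trans _ vV)// ler_piMl//.
  have q3 : L * `|x + Num.sqrt t * r + t * v - x| <= L * (`|r| + V) by rewrite ler_wpM2l.
  have q4 : `|Num.sqrt t * v * r + t * v ^+ 2 / 2| <= V * `|r| + V ^+ 2.
    rewrite (le_trans (ler_normD _ _))// lerD//.
      rewrite !normrM ler_wpM2r// ger0_norm// (le_trans _ vV)// ler_piMl//.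
    rewrite ger0_norm; last by rewrite divr_ge0// mulr_ge0 ?sqr_ge0// ltW.
    have := sqr_ge0 v; nra.
  have r0 := normr_ge0 r.
  have LV := mulr_ge0 L0 V0.
  have LVr := mulr_ge0 LV r0.
  have V2 := sqr_ge0 V.
  have V2r := mulr_ge0 V2 r0.
  rewrite /B; lra.
have key : \int[g1]_r expR (Y r) <= 1 + (E Y + t ^+ 2 * E G).
  rewrite -[X in X + (_ + _)](@E1_cst R) -E1Z//.
  have etG := eb1Z (t ^+ 2) eG.
  rewrite -E1D// -E1D; [|exact: eb1_cst|exact: eb1D].
  apply: le_E1 => //; first by apply: eb1D; [exact: eb1_cst|exact: eb1D].
  move=> r.
  have h1 := ler_norm (expR (Y r) - 1 - Y r).
  have h2 := expR_taylor1 (Y r).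
  suff : Y r ^+ 2 * expR `|Y r| <= t ^+ 2 * G r by lra.
  rewrite /G mulrA -exprMn ler_pM ?sqr_ge0 ?expR_ge0 ?ler_expR//.
  rewrite -[Y r ^+ 2]real_normK ?num_real// lerXn2r ?nnegrE//.
  by rewrite mulr_ge0 ?(ltW t0)// mulr_ge0// addr_ge0 ?sqr_ge0.
have Epos : 0 < \int[g1]_r expR (Y r) by apply: E1_gt0 => // r; exact: expR_gt0.
rewrite /lheat heatE lnM ?posrE ?expR_gt0// expRK.
have := @le_ln1Dx _ (\int[g1]_r expR (Y r) - 1).
have -> : 1 + (\int[g1]_r expR (Y r) - 1) = \int[g1]_r expR (Y r) by ring.
move=> /(_ _)/wrap[]; first lra.
rewrite EY in key; lra.
Qed.

End lheat.

(** * Smoothing by the logarithmic heat flow *)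

Section lheat_regularity.
Context {R : realType}.
Local Notation g1 := (@normal_prob R 0 1).
Local Notation E f := (\int[g1]_x f x).
Implicit Types (f g k u : R -> R) (x y z t L : R).

(** First order expansion of the Cameron-Martin density in the shift [a]; the term [a ^+ 2 / 2]
    already counts as error. *)
Let tilt_bound (a r : R) : `|a| <= 1 ->
  `|expR (a * r - a ^+ 2 / 2) - 1 - a * r| <=
  a ^+ 2 * ((`|r| + 1) ^+ 2 * expR (1 + 1 * `|r|) + 1).
Proof.
move=> a1; set y := a * r - _.
have a2 : a ^+ 2 <= `|a|.
  by rewrite -[a ^+ 2]real_normK ?num_real// expr2 ler_piMl.
have a20 := sqr_ge0 a.
have yb : `|y| <= `|a| * (`|r| + 1).
  rewrite (le_trans (ler_normB _ _))// normrM mulrDr mulr1 lerD//.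
  rewrite ger0_norm ?divr_ge0//; lra.
have yb1 : `|y| <= 1 + 1 * `|r|.
  by rewrite mul1r addrC (le_trans yb)// ler_piMl// addr_ge0.
have y2 : y ^+ 2 <= a ^+ 2 * (`|r| + 1) ^+ 2.
  rewrite -[y ^+ 2]real_normK ?num_real// -[a ^+ 2]real_normK ?num_real//.
  by rewrite -exprMn lerXn2r ?nnegrE// mulr_ge0// addr_ge0.
have h := expR_taylor1 y.
have h2 : y ^+ 2 * expR `|y| <= a ^+ 2 * (`|r| + 1) ^+ 2 * expR (1 + 1 * `|r|).
  by rewrite ler_pM ?sqr_ge0 ?expR_ge0// ler_expR.
rewrite (_ : expR y - 1 - a * r = (expR y - 1 - y) - a ^+ 2 / 2); last first.
  by rewrite /y; field.
rewrite (le_trans (ler_normB _ _))// [`|_ / 2|]ger0_norm ?divr_ge0//.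
lra.
Qed.

(* Regularity of the heat flow at positive time, stated without derivatives:
   [v] plays the role of the derivative at [x]. *)
Lemma lheat_C11 (L e : R) : 0 <= L -> 0 < e ->
  exists A V, [/\ 0 <= A, 0 <= V & forall f t x, lipR L f -> e <= t <= 1 ->
  exists2 v, `|v| <= V & forall h, `|lheat f t (x + h) - lheat f t x - v * h| <= A * h ^+ 2].
Proof.
move=> L0 e0.
pose G := fun r : R => expR (0 + L * `|r|) * ((`|r| + 1) ^+ 2 * expR (1 + 1 * `|r|) + 1).
have eG : eb1 G.
  apply: eb1M; first exact: eb1_expR_norm.
  apply: eb1D; last exact: eb1_cst.
  apply: eb1M; last exact: eb1_expR_norm.
  by apply: eb1X; apply: eb1D; [exact: eb1_norm_id|exact: eb1_cst].
have G0 r : 0 <= G r.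
  by rewrite /G mulr_ge0 ?expR_ge0// addr_ge0// mulr_ge0 ?sqr_ge0 ?expR_ge0.
pose H := fun r : R => expR (0 + L * `|r|) * `|r|.
have eH : eb1 H by apply: eb1M; [exact: eb1_expR_norm|exact: eb1_norm_id].
have H0 r : 0 <= H r by rewrite mulr_ge0 ?expR_ge0.
(* Below, [F] is squeezed between multiples of [expR (f x)] by fixed functions of [r]. This factor
   cancels in every ratio to the mean of [F], which is at least [expR (f x) * c0], so the constants
   depend only on [L] and [e]. *)
pose c0 := \int[g1]_r expR (0 + (- L) * `|r|).
have c00 : 0 < c0.
  by apply: E1_gt0; [exact: eb1_expR_norm|move=> r; exact: expR_gt0].
pose K := E G / c0.
pose P := E H / c0.
have K0 : 0 <= K by rewrite divr_ge0 ?(ltW c00)// Rintegral_ge0.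
have P0 : 0 <= P by rewrite divr_ge0 ?(ltW c00)// Rintegral_ge0.
(* [K] is the error for the heat flow, [L ^+ 2 * expR L] that of taking the logarithm, and [L + P]
   covers increments larger than [Num.sqrt t], where linear bounds suffice. *)
pose K2 := K + L ^+ 2 * expR L + L + P.
have K20 : 0 <= K2 by rewrite !addr_ge0// mulr_ge0 ?sqr_ge0 ?expR_ge0.
exists (K2 / e), (P / Num.sqrt e); split.
- by rewrite divr_ge0// ltW.
- by rewrite divr_ge0.
move=> f t x fL /andP[et t1].
have t0 : 0 < t by exact: lt_le_trans et.
have s0 : 0 < Num.sqrt t by rewrite sqrtr_gt0.
have s1 : Num.sqrt t <= 1 by rewrite -sqrtr1 ler_wsqrtr.
have st := sqr_sqrtr (ltW t0).
have ef := lipR_expR_eb1 L0 fL.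
pose F r := expR (f (x + Num.sqrt t * r)).
have eF : eb1 F by exact: (eb1_affine _ _ ef).
have Fub r : F r <= expR (f x) * expR (0 + L * `|r|).
  rewrite -expRD ler_expR.
  have := fL (x + Num.sqrt t * r) x; rewrite addrAC subrr add0r normrM ger0_norm ?(ltW s0)//.
  have : L * (Num.sqrt t * `|r|) <= L * `|r| by rewrite ler_wpM2l// ler_piMl.
  have := ler_norm (f (x + Num.sqrt t * r) - f x); lra.
have Flb r : expR (f x) * expR (0 + (- L) * `|r|) <= F r.
  rewrite -expRD ler_expR.
  have := fL x (x + Num.sqrt t * r); rewrite opprD addrA subrr add0r normrN normrM ger0_norm ?(ltW s0)//.
  have : L * (Num.sqrt t * `|r|) <= L * `|r| by rewrite ler_wpM2l// ler_piMl.
  have := ler_norm (f x - f (x + Num.sqrt t * r)); lra.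
have EFlb : expR (f x) * c0 <= E F.
  rewrite -E1Z; last exact: eb1_expR_norm.
  by apply: le_E1 => //; apply: eb1Z; exact: eb1_expR_norm.
have EF0 : 0 < E F by apply: lt_le_trans EFlb; rewrite mulr_gt0 ?expR_gt0.
have fx0 := expR_gt0 (f x).
have eid := @eb1_id R.
pose p := \int[g1]_r (F r * r).
have eFr : eb1 (fun r => F r * r) by exact: eb1M.
have pP : `|p / E F| <= P.
  rewrite normrM normfV [`|E F|]gtr0_norm// ler_pdivrMr//.
  apply: (@le_trans _ _ (P * (expR (f x) * c0))); last by rewrite ler_wpM2l.
  rewrite /P mulrCA mulrC [_ / c0 * c0]divfK ?gt_eqF// mulrC -E1Z//.
  apply: norm_E1_le => //; first exact: eb1Z.
  move=> r; rewrite normrM [`|F r|]gtr0_norm ?expR_gt0// /H mulrA ler_wpM2r//.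
(* Cameron-Martin moves the increment [h] from [f] to the density, so no derivative of [f] enters.
   The price is an expansion in [h / Num.sqrt t], whence the lower bound [e] on the time. *)
have heatE h : heat (fun y => expR (f y)) t (x + h) =
    \int[g1]_r (F r * expR (h / Num.sqrt t * r - (h / Num.sqrt t) ^+ 2 / 2)).
  rewrite /heat (@E1_cm _ (- (h / Num.sqrt t))); last exact: (eb1_affine _ _ ef).
  apply: eq_Rintegral => r _; rewrite mulNr opprK sqrrN; congr (expR (f _) * _).
  by field; rewrite gt_eqF.
have ee (a : R) : eb1 (fun r : R => expR (a * r - a ^+ 2 / 2)).
  apply: (@lipR_expR_eb1 _ `|a|) => // y z.
  rewrite -normrM le_eqVlt; apply/orP; left; apply/eqP; congr `|_|; ring.
have small h : `|h / Num.sqrt t| <= 1 ->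
    `|heat (fun y => expR (f y)) t (x + h) / E F - 1 - p / E F * (h / Num.sqrt t)| <=
    K * (h / Num.sqrt t) ^+ 2.
  move=> h1; rewrite heatE; set a := h / _ in h1 *.
  have eFe : eb1 (fun r => F r * expR (a * r - a ^+ 2 / 2)) by exact: eb1M.
  rewrite (_ : _ - _ - _ = (\int[g1]_r (F r * (expR (a * r - a ^+ 2 / 2) - 1 - a * r))) / E F); last first.
    have -> : \int[g1]_r (F r * (expR (a * r - a ^+ 2 / 2) - 1 - a * r)) =
        \int[g1]_r ((F r * expR (a * r - a ^+ 2 / 2) - F r) - a * (F r * r)).
      by apply: eq_Rintegral => r _; ring.
    rewrite E1B ?E1B ?E1Z//; [|exact: eb1B|exact: eb1Z].
    by rewrite -/p; field; rewrite gt_eqF.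
  rewrite normrM normfV [`|E F|]gtr0_norm// ler_pdivrMr//.
  apply: (@le_trans _ _ (K * a ^+ 2 * (expR (f x) * c0))); last first.
    by rewrite ler_wpM2l// mulr_ge0 ?sqr_ge0.
  have -> : K * a ^+ 2 * (expR (f x) * c0) = (a ^+ 2 * expR (f x)) * E G.
    by rewrite /K; field; rewrite gt_eqF.
  rewrite -E1Z//; apply: norm_E1_le; last 2 first.
  - exact: eb1Z.
  - move=> r; rewrite normrM [`|F r|]gtr0_norm ?expR_gt0//.
    have tb := tilt_bound r h1.
    rewrite /G [leRHS](_ : _ = (expR (f x) * expR (0 + L * `|r|)) *
       (a ^+ 2 * ((`|r| + 1) ^+ 2 * expR (1 + 1 * `|r|) + 1))); last by ring.
    by rewrite ler_pM// expR_ge0.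
  - apply: eb1M => //; apply: eb1B; last exact: eb1Z.
    by apply: eb1B => //; exact: eb1_cst.
(* The derivative of [lheat f t] at [x], read off from the first order term of the density. *)
exists (p / E F / Num.sqrt t).
  rewrite normrM normfV [`|Num.sqrt t|]gtr0_norm// ler_pM// ?invr_ge0//.
  by rewrite lef_pV2 ?posrE ?sqrtr_gt0// ler_wsqrtr.
move=> h; set l := lheat f t (x + h) - lheat f t x.
have lL : `|l| <= L * `|h|.
  by have := lipR_lheat t L0 fL (x + h) x; rewrite (_ : x + h - x = h)//; ring.
have hh : h = Num.sqrt t * (h / Num.sqrt t) by field; rewrite gt_eqF.
have -> : p / E F / Num.sqrt t * h = p / E F * (h / Num.sqrt t) by rewrite mulrAC mulrA.
have habs : `|h| <= `|h / Num.sqrt t|.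
  by rewrite {1}hh normrM ger0_norm ?(ltW s0)// ler_piMl.
apply: (@le_trans _ _ (K2 * (h / Num.sqrt t) ^+ 2)); last first.
  rewrite exprMn exprVn st -[leRHS]mulrA ler_wpM2l// mulrC ler_wpM2r ?sqr_ge0//.
  by rewrite lef_pV2 ?posrE.
have a20 := sqr_ge0 (h / Num.sqrt t).
have M0 : 0 <= L ^+ 2 * expR L by rewrite mulr_ge0 ?sqr_ge0 ?expR_ge0.
have a2E : `|h / Num.sqrt t| ^+ 2 = (h / Num.sqrt t) ^+ 2 by rewrite real_normK ?num_real.
have lL2 : `|l| <= L * `|h / Num.sqrt t| by rewrite (le_trans lL)// ler_wpM2l.
have [h1|h1] := leP `|h / Num.sqrt t| 1.
  have := small _ h1.
  have -> : heat (fun y => expR (f y)) t (x + h) / E F = expR l.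
    by rewrite -(expR_lheat t (x + h) L0 fL) -[E F](expR_lheat t x L0 fL) -expRB.
  have := expR_taylor1 l.
  have l2 : l ^+ 2 <= L ^+ 2 * (h / Num.sqrt t) ^+ 2.
    rewrite -[l ^+ 2]real_normK ?num_real// -a2E -exprMn lerXn2r ?nnegrE//.
    by rewrite mulr_ge0.
  have el : expR `|l| <= expR L.
    by rewrite ler_expR (le_trans lL2)// ler_piMr.
  have : l ^+ 2 * expR `|l| <= L ^+ 2 * (h / Num.sqrt t) ^+ 2 * expR L.
    by rewrite ler_pM ?sqr_ge0 ?expR_ge0.
  move=> q1 q2 q3.
  rewrite (_ : l - _ = (expR l - 1 - p / E F * (h / Num.sqrt t)) - (expR l - 1 - l)); last by ring.
  rewrite (le_trans (ler_normB _ _))//.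
  have b1 := mulr_ge0 L0 a20; have b2 := mulr_ge0 P0 a20.
  have -> : K2 * (h / Num.sqrt t) ^+ 2 = K * (h / Num.sqrt t) ^+ 2 +
      L ^+ 2 * (h / Num.sqrt t) ^+ 2 * expR L + (L * (h / Num.sqrt t) ^+ 2 + P * (h / Num.sqrt t) ^+ 2).
    by rewrite /K2; ring.
  apply: (le_trans (lerD q3 (le_trans q2 q1))).
  by rewrite lerDl addr_ge0.
have ha : `|h / Num.sqrt t| <= (h / Num.sqrt t) ^+ 2.
  by rewrite -a2E expr2 ler_peMr// ltW.
rewrite (le_trans (ler_normB _ _))// normrM.
have q1 : L * `|h / Num.sqrt t| <= L * (h / Num.sqrt t) ^+ 2 by rewrite ler_wpM2l.
have q2 : `|p / E F| * `|h / Num.sqrt t| <= P * (h / Num.sqrt t) ^+ 2 by rewrite ler_pM.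
have b1 := mulr_ge0 K0 a20; have b2 := mulr_ge0 M0 a20.
have -> : K2 * (h / Num.sqrt t) ^+ 2 = (L * (h / Num.sqrt t) ^+ 2 + P * (h / Num.sqrt t) ^+ 2) +
      (K * (h / Num.sqrt t) ^+ 2 + L ^+ 2 * expR L * (h / Num.sqrt t) ^+ 2).
  by rewrite /K2; ring.
apply: (le_trans (lerD (le_trans lL2 q1) q2)).
by rewrite lerDl addr_ge0.
Qed.

End lheat_regularity.

(** * The inequality between exponential means on the line *)

Section log_mean_exp1.
Context {R : realType}.
Local Notation g1 := (@normal_prob R 0 1).
Local Notation E f := (\int[g1]_x f x).
Implicit Types (f g k u : R -> R) (x y z t L : R).

(* The drift [v] for [f] is matched by the drift [v / s] for [g] (and none for [k]), so the
   quadratic costs [v^2 / 2] and [s^2 (v / s)^2 / 2] cancel. *)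
Lemma lheat_step (L s e : R) : 0 <= L -> 0 < s -> 0 < e ->
  exists2 C, 0 <= C & forall f g k t h c, lipR L f -> lipR L g -> lipR L k ->
    e <= t <= 1 -> 0 < h <= 1 ->
    (forall y z, lheat f t (s * y + (1 - s) * z) <= s ^+ 2 * lheat g t y + heat k t z + c) ->
    forall y z, lheat f (h + t) (s * y + (1 - s) * z) <=
      s ^+ 2 * lheat g (h + t) y + heat k (h + t) z + (c + C * h ^+ 2).
Proof.
move=> L0 s0 e0.
have [A [V [A0 V0 C11]]] := lheat_C11 L0 e0.
have [C C0 rJ] := lheat_le L0 A0 V0.
exists C => // f g k t h c fL gL kL et /andP[h0 h1] hyp y z.
have t0 : 0 <= t by case/andP: et => et _; rewrite (le_trans _ et)// ltW.
have [v vV vA] := C11 f t (s * y + (1 - s) * z) fL et.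
have hh : 0 < h <= 1 by rewrite h0.
have := rJ _ _ _ _ (lipR_lheat t L0 fL) hh vV vA.
have := lheat_ge (v / s) y L0 (lipR_lheat t L0 gL) (ltW h0).
rewrite !(lheatD _ L0 _ t0 (ltW h0))//.
rewrite -(heat_heat z (lipR_eb1 L0 kL) (ltW h0) t0).
pose a := lheat (lheat g t) h y; pose b := lheat (lheat f t) h (s * y + (1 - s) * z).
pose d := heat (heat k t) h z; pose G := \int[g1]_r lheat g t (y + Num.sqrt h * r + h * (v / s)).
pose F := \int[g1]_r lheat f t (s * y + (1 - s) * z + Num.sqrt h * r + h * v).
move=> hG; rewrite -/G -/a in hG; move=> hF; rewrite -/F -/b in hF; rewrite -/a -/b -/d.
have elg := lipR_eb1 L0 (lipR_lheat t L0 gL).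
have elf := lipR_eb1 L0 (lipR_lheat t L0 fL).
have ehk := lipR_eb1 L0 (lipR_heat t L0 kL).
have sh u x w : eb1 u -> eb1 (fun r : R => u (x + Num.sqrt h * r + w)).
  move=> eu; have := eb1_affine (x + w) (Num.sqrt h) eu.
  by under eq_fun do rewrite addrAC.
(* One Gaussian increment [r] drives all three points: [s] times [y + Num.sqrt h * r + h * (v / s)]
   plus [1 - s] times [z + Num.sqrt h * r] is exactly the displaced argument of [f]. The hypothesis
   at time [t] therefore applies for each [r]. *)
have main : F <= s ^+ 2 * G + d + c.
  rewrite -[X in _ <= _ + X](@E1_cst R) /d /heat -/(heat k t) -E1Z; last exact: sh.
  rewrite -E1D; last 2 first.
  - by apply: eb1Z; exact: sh.
  - exact: (eb1_affine _ _ ehk).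
  rewrite -E1D; last 2 first.
  - by apply: eb1D; [apply: eb1Z; exact: sh|exact: (eb1_affine _ _ ehk)].
  - exact: eb1_cst.
  apply: le_E1; first exact: sh.
    apply: eb1D; last exact: eb1_cst.
    by apply: eb1D; [apply: eb1Z; exact: sh|exact: (eb1_affine _ _ ehk)].
  move=> r; apply: le_trans (hyp _ _); rewrite le_eqVlt; apply/orP; left; apply/eqP.
  by congr lheat; field; rewrite gt_eqF.
have hG2 : s ^+ 2 * G - h * v ^+ 2 / 2 <= s ^+ 2 * a.
  rewrite -(ler_pM2l (exprn_gt0 2 s0)) in hG; apply: le_trans hG.
  rewrite le_eqVlt; apply/orP; left; apply/eqP; field.
  by rewrite gt_eqF.
lra.
Qed.

(** Starts the induction: the constants of [lheat_C11] are available only from a positive time on,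
    so up to that time the Lipschitz bound alone is used, with an error of order [Num.sqrt t]. *)
Lemma lheat_small_time (L s : R) : 0 <= L -> 0 < s -> s < 1 ->
  exists2 C, 0 <= C & forall f g k t, lipR L f -> lipR L g -> lipR L k ->
    0 < t <= 1 -> (forall y z, f (s * y + (1 - s) * z) <= s ^+ 2 * g y + k z) ->
    forall y z, lheat f t (s * y + (1 - s) * z) <=
      s ^+ 2 * lheat g t y + heat k t z + C * Num.sqrt t.
Proof.
move=> L0 s0 s1.
pose H := fun r : R => L * `|r| * expR (0 + L * `|r|).
have eH : eb1 H.
  by apply: eb1M; [apply: eb1Z; exact: eb1_norm_id|exact: eb1_expR_norm].
have H0 : 0 <= E H by rewrite Rintegral_ge0// => r _; rewrite mulr_ge0 ?expR_ge0// mulr_ge0.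
pose N : R := L * \int[g1]_r `|r|.
have N0 : 0 <= N by rewrite mulr_ge0// Rintegral_ge0.
exists (E H + 2 * N); first by rewrite addr_ge0// mulr_ge0.
move=> f g k t fL gL kL /andP[t0 t1] hyp y z.
have s00 : 0 <= Num.sqrt t by [].
have s11 : Num.sqrt t <= 1 by rewrite -sqrtr1 ler_wsqrtr.
have hlow u x : lipR L u -> u x - N * Num.sqrt t <= heat u t x.
  move=> uL; have eu := lipR_eb1 L0 uL.
  rewrite -[X in X - _](@E1_cst R) /N mulrAC -E1Z; last exact: eb1_norm_id.
  rewrite /heat -E1B; [|exact: eb1_cst|by apply: eb1Z; exact: eb1_norm_id].
  apply: le_E1; last move=> r.
  - by apply: eb1B; [exact: eb1_cst|by apply: eb1Z; exact: eb1_norm_id].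
  - exact: eb1_affine.
  - have := uL x (x + Num.sqrt t * r).
    have -> : `|x - (x + Num.sqrt t * r)| = Num.sqrt t * `|r|.
      by rewrite opprD addrA subrr add0r normrN normrM ger0_norm.
    have := ler_norm (u x - u (x + Num.sqrt t * r)); lra.
have hf : lheat f t (s * y + (1 - s) * z) <= f (s * y + (1 - s) * z) + E H * Num.sqrt t.
  set x := s * y + _; have ef := lipR_expR_eb1 L0 fL.
  have EH1 : 0 <= E H * Num.sqrt t by rewrite mulr_ge0.
  rewrite -ler_expR (expR_lheat _ _ L0 fL) expRD.
  apply: (@le_trans _ _ (expR (f x) * (1 + E H * Num.sqrt t))); last first.
    by rewrite ler_wpM2l ?expR_ge0// expR_ge1Dx.
  rewrite mulrC [E H * _]mulrC -[X in X + _](@E1_cst R) -E1Z//.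
  have etH := eb1Z (Num.sqrt t) eH.
  rewrite -E1D//; last exact: eb1_cst.
  rewrite mulrC -E1Z; last by apply: eb1D => //; exact: eb1_cst.
  apply: le_E1; first exact: (eb1_affine _ _ ef).
    by apply: eb1Z; apply: eb1D => //; exact: eb1_cst.
  move=> r.
  pose w := L * (Num.sqrt t * `|r|).
  have w0 : 0 <= w by rewrite /w !mulr_ge0.
  have wL : w <= L * `|r| by rewrite ler_wpM2l// ler_piMl.
  apply: (@le_trans _ _ (expR (f x) * expR w)).
    rewrite -expRD ler_expR.
    have := fL (x + Num.sqrt t * r) x.
    have -> : `|x + Num.sqrt t * r - x| = Num.sqrt t * `|r|.
      by rewrite addrAC subrr add0r normrM ger0_norm.
    have := ler_norm (f (x + Num.sqrt t * r) - f x); rewrite /w; lra.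
  rewrite ler_wpM2l ?expR_ge0//.
  have e1 : expR w <= 1 + w * expR w.
    have := expR_ge1Dx (- w); rewrite -(ler_pM2r (expR_gt0 w)) -expRD addNr expR0; lra.
  apply: (le_trans e1); rewrite lerD2l.
  have -> : Num.sqrt t * H r = w * expR (0 + L * `|r|) by rewrite /H /w; ring.
  by rewrite ler_wpM2l// ler_expR add0r.
have hg := lheat_ge 0 y L0 gL (ltW t0).
rewrite expr0n/= mulr0 mul0r subr0 in hg.
have g0E : \int[g1]_r g (y + Num.sqrt t * r + 0) = heat g t y.
  by apply: eq_Rintegral => r _; rewrite addr0.
rewrite g0E in hg.
have hg2 := hlow g y gL; have hk := hlow k z kL.
have hyz := hyp y z.
have p1 : s ^+ 2 * (g y - N * Num.sqrt t) <= s ^+ 2 * lheat g t y.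
  rewrite ler_wpM2l ?sqr_ge0//; exact: le_trans hg.
have p2 : s ^+ 2 * (N * Num.sqrt t) <= N * Num.sqrt t.
  have s2 : s ^+ 2 <= 1 by rewrite exprn_ile1// ltW.
  by rewrite -[leRHS]mul1r ler_wpM2r// mulr_ge0.
move: hf p1 p2 hk hyz; move: (lheat f _ _) (lheat g _ _) (heat k _ _) (\int[g1]_x H x) => a b c d.
by clear; lra.
Qed.

(** For any [d], time [e] is reached with error at most [d / 2]. Then [n.+1] steps of length [h]
    lead to time one, and their errors [C * h ^+ 2] add up to at most [C / n.+1], again at most
    [d / 2]. *)
Theorem log_mean_exp_bound1 (L s : R) f g k : 0 <= L -> 0 < s -> s < 1 ->
  lipR L f -> lipR L g -> lipR L k ->
  (forall y z, f (s * y + (1 - s) * z) <= s ^+ 2 * g y + k z) ->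
  forall y z, lheat f 1 (s * y + (1 - s) * z) <= s ^+ 2 * lheat g 1 y + heat k 1 z.
Proof.
move=> L0 s0 s1 fL gL kL hyp y0 z0.
have [B B0 hB] := lheat_small_time L0 s0 s1.
apply/ler_addgt0Pr => d d0.
pose e := Num.min 1 ((d / (2 * (B + 1))) ^+ 2).
have B1 : 0 < B + 1 by rewrite ltr_wpDl.
have q0 : 0 < d / (2 * (B + 1)) by rewrite divr_gt0// mulr_gt0.
have e0 : 0 < e by rewrite lt_min ltr01 exprn_gt0.
have e1 : e <= 1 by rewrite ge_min lexx.
have Be : B * Num.sqrt e <= d / 2.
  have : Num.sqrt e <= d / (2 * (B + 1)).
    rewrite -[leRHS]gtr0_norm// -sqrtr_sqr ler_wsqrtr// ge_min lexx orbT//.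
  move=> h; apply: (@le_trans _ _ ((B + 1) * (d / (2 * (B + 1))))).
    by rewrite ler_pM//; lra.
  by rewrite le_eqVlt; apply/orP; left; apply/eqP; field; rewrite gt_eqF.
have [C C0 hC] := lheat_step L0 s0 e0.
have [n hn] : exists n : nat, C * 2 / d < n.+1%:R.
  exists (Num.truncn (C * 2 / d)); apply: truncnS_gt.
pose h := (1 - e) / n.+1%:R.
have n0 : 0 < n.+1%:R :> R by rewrite ltr0n.
(* If [e] is one, the step length [h] vanishes, which [lheat_step] excludes, but the small time
   estimate already reaches time one. *)
have [e1'|e1'] := eqVneq e 1.
  have := hB f g k 1 fL gL kL _ hyp y0 z0.
  rewrite ltr01 lexx => /(_ isT).
  rewrite e1' in Be; move: (lheat f _ _) (lheat g _ _) (heat k _ _) Be (ltW d0) => a b c.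
  by clear; lra.
have h0 : 0 < h by rewrite divr_gt0// subr_gt0 lt_neqAle e1' e1.
have hn1 : h <= n.+1%:R^-1 by rewrite /h ler_piMl ?invr_ge0 ?ler0n//; lra.
have h1 : h <= 1 by rewrite (le_trans hn1)// invf_le1 ?ler1n.
have ind m : (m <= n.+1)%N -> forall y z,
    lheat f (m%:R * h + e) (s * y + (1 - s) * z) <=
    s ^+ 2 * lheat g (m%:R * h + e) y + heat k (m%:R * h + e) z + (d / 2 + m%:R * (C * h ^+ 2)).
  elim: m => [|m IH] mn y z.
    rewrite !mul0r add0r addr0.
    have := hB f g k e fL gL kL _ hyp y z.
    rewrite e0 e1 => /(_ isT).
    by move: (lheat f _ _) (lheat g _ _) (heat k _ _) Be => a b c; clear; lra.
  have -> : m.+1%:R * h + e = h + (m%:R * h + e) by rewrite -natr1; ring.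
  have -> : d / 2 + m.+1%:R * (C * h ^+ 2) = (d / 2 + m%:R * (C * h ^+ 2)) + C * h ^+ 2.
    by rewrite -natr1; ring.
  apply: hC => //; last 2 first.
  - by rewrite h0 h1.
  - exact: IH (ltnW mn).
  - rewrite lerDr mulr_ge0 ?(ltW h0)//=.
    apply: (@le_trans _ _ (n.+1%:R * h + e)).
      by rewrite lerD2r ler_pM2r// ler_nat ltnW.
    by rewrite /h mulrC divfK ?gt_eqF// subrK.
have := ind n.+1 (leqnn _) y0 z0.
have -> : n.+1%:R * h + e = 1 by rewrite /h mulrC divfK ?gt_eqF// subrK.
have : n.+1%:R * (C * h ^+ 2) <= d / 2.
  apply: (@le_trans _ _ (C * n.+1%:R^-1)).
    have -> : n.+1%:R * (C * h ^+ 2) = C * ((n.+1%:R * h) * h) by ring.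
    have nh : n.+1%:R * h <= 1 by rewrite /h mulrC divfK ?gt_eqF//; lra.
    have nh0 : 0 <= n.+1%:R * h by rewrite mulr_ge0// ltW.
    by rewrite ler_wpM2l// -[leRHS]mul1r ler_pM// ltW.
  rewrite ler_pdivrMr//.
  by move: hn; rewrite ltr_pdivrMr// => /ltW; clear; lra.
by move: (lheat f _ _) (lheat g _ _) (heat k _ _) => a b c; clear; lra.
Qed.

End log_mean_exp1.

(** * The Gaussian measure on R^n *)

Section borelRn_theory.
Context {R : realType} {n : nat}.
Implicit Types (A B : 'I_n -> set R).

Definition box A : set (borelRn R n) := [set x | forall i, A i (x ord0 i)].

Lemma borelRn_openE : @measurable _ (borelRn R n) = <<s @open 'rV[R]_n >>.
Proof. by []. Qed.

Lemma open_borelRn (U : set 'rV[R]_n) : open U -> measurable (U : set (borelRn R n)).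
Proof. by move=> oU; exact: sub_sigma_algebra. Qed.

Lemma continuous_borelRn (f : 'rV[R]_n -> R) : continuous f ->
  measurable_fun setT (f : borelRn R n -> R).
Proof.
move=> /continuousP cf; apply: (measurability _ (RGenOpens.measurableE R)).
move=> _ [_ [a [b ->] <-]]; rewrite setTI.
by apply: open_borelRn; apply: cf; exact: interval_open.
Qed.

Lemma measurable_coord i : measurable_fun setT (fun x : borelRn R n => x ord0 i : R).
Proof. by apply: continuous_borelRn; exact: coord_continuous. Qed.

Lemma measurable_box A : (forall i, measurable (A i)) -> measurable (box A).
Proof.
move=> mA.
have -> : box A = \bigcap_(i in setT) ((fun x : borelRn R n => x ord0 i) @^-1` A i).
  by apply/seteqP; split => x /= h i; [move=> _|]; exact: h.
apply: fin_bigcap_measurable => [|i _]; first exact: finite_finset.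
by rewrite -[X in measurable X]setTI; exact: measurable_coord.
Qed.

Definition qbox (q : {ffun 'I_n -> rat * rat}) : set (borelRn R n) :=
  box (fun i => `]ratr (q i).1, ratr (q i).2[%classic).

(** Boxes with rational endpoints are a countable base of the topology. *)
Lemma open_bigcup_qbox (U : set 'rV[R]_n) : open U ->
  (U : set (borelRn R n)) = \bigcup_(q in [set q | qbox q `<=` U]) qbox q.
Proof.
move=> oU; apply/seteqP; split; last by move=> x [q /= qU] /qU.
move=> x Ux; have : nbhs x U by exact: open_nbhs_nbhs.
move=> /nbhs_ballP[e /= e0 eU].
have h1 (i : 'I_n) : exists q : rat, ratr q \in `](x ord0 i - e), (x ord0 i)[.
  by apply: rat_in_itvoo; rewrite ltrBlDr ltrDl.
have h2 (i : 'I_n) : exists q : rat, ratr q \in `](x ord0 i), (x ord0 i + e)[.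
  by apply: rat_in_itvoo; rewrite ltrDl.
pose q := [ffun i => (xchoose (h1 i), xchoose (h2 i))].
have hq i : [/\ x ord0 i - e < ratr (q i).1, ratr (q i).1 < x ord0 i,
    x ord0 i < ratr (q i).2 & ratr (q i).2 < x ord0 i + e].
  rewrite ffunE/=; have := xchooseP (h1 i); have := xchooseP (h2 i).
  by rewrite !in_itv/= => /andP[? ?] /andP[? ?]; split.
exists q => /=; last by move=> i; rewrite /= in_itv/=; have [_ -> -> _] := hq i.
move=> y qy; apply: eU; split => // i j; rewrite ord1.
have := qy j; rewrite /= in_itv/= => /andP[y1 y2].
have [q1 q2 q3 q4] := hq j.
by rewrite /ball/= ltr_norml; apply/andP; split; lra.
Qed.

Definition boxes : set (set (borelRn R n)) :=
  [set B | exists2 A, forall i, measurable (A i) & B = box A].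

(** [is_std_gaussian] prescribes values on boxes only. Boxes generate the Borel sets and are stable
    under intersection, so measures may be compared on boxes, and measurability into R^n may be
    checked coordinate by coordinate. *)
Lemma borelRn_boxE : @measurable _ (borelRn R n) = <<s boxes >>.
Proof.
apply/seteqP; split; last first.
  apply: smallest_sub; first exact: sigma_algebra_measurable.
  by move=> _ [A mA ->]; exact: measurable_box.
rewrite borelRn_openE; apply: smallest_sub; first exact: smallest_sigma_algebra.
move=> U oU; rewrite (open_bigcup_qbox oU).
pose T' := g_sigma_algebraType boxes.
have -> : \bigcup_(q in [set q | qbox q `<=` U]) qbox q =
    \bigcup_q (if q \in [set q | qbox q `<=` U] then qbox q else set0).
  apply/seteqP; split => x.
    by move=> [q qU qx]; exists q => //; rewrite mem_set.
  by move=> [q _]; case: ifP => // /set_mem qU qx; exists q.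
apply: (@countable_bigcupT_measurable _ T' {ffun 'I_n -> rat * rat}).
  exact: countableP.
move=> q; case: ifP => _; last exact: measurable0.
apply: sub_sigma_algebra; exists (fun i => `]ratr (q i).1, ratr (q i).2[%classic) => //.
Qed.

Lemma measurable_borelRnP d (T : measurableType d) (h : T -> borelRn R n) :
  (forall i, measurable_fun setT (fun t => h t ord0 i : R)) -> measurable_fun setT h.
Proof.
move=> mh; apply: (measurability _ borelRn_boxE) => _ [_ [A mA ->] <-].
rewrite setTI.
have -> : h @^-1` box A = \bigcap_(i in setT) ((fun t => h t ord0 i) @^-1` A i).
  by apply/seteqP; split => x /= hx i; [move=> _|]; exact: hx.
apply: fin_bigcap_measurable => [|i _]; first exact: finite_finset.
by rewrite -[X in measurable X]setTI; exact: mh.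
Qed.

Lemma borelRn_measure_unique (m1 m2 : {measure set (borelRn R n) -> \bar R}) :
  (m1 setT < +oo)%E ->
  (forall A, (forall i, measurable (A i)) -> m1 (box A) = m2 (box A)) ->
  forall D, measurable D -> m1 D = m2 D.
Proof.
move=> m1T h D mD.
apply: (measure_unique boxes (fun=> setT) borelRn_boxE) => //.
- move=> _ _ [A mA ->] [A' mA' ->]; exists (fun i => A i `&` A' i).
    by move=> i; exact: measurableI.
  apply/seteqP; split => x /=; first by move=> [h1 h2] i; split; [exact: h1|exact: h2].
  by move=> hx; split => i; have [] := hx i.
- by move=> _; exists (fun=> setT) => //; apply/seteqP; split.
- by rewrite bigcup_const.
- by move=> _ [A mA ->]; exact: h.
Qed.

End borelRn_theory.

(** * Resampling one coordinate *)

Section resample.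
Context {R : realType} {n : nat}.
Local Notation g1 := (@normal_prob R 0 1).
Variable gamma : probability (borelRn R n) R.
Hypothesis gg : is_std_gaussian gamma.

Definition upd (i : 'I_n) (x : 'rV[R]_n) (r : R) : 'rV[R]_n :=
  \row_j (if j == i then r else x ord0 j).

Lemma updE i x r j : upd i x r ord0 j = if j == i then r else x ord0 j.
Proof. by rewrite mxE. Qed.

Lemma measurable_upd i : measurable_fun setT
  (fun p : borelRn R n * measurableTypeR R => upd i p.1 p.2 : borelRn R n).
Proof.
apply: measurable_borelRnP => j.
under eq_fun do rewrite updE.
case: (j == i); first exact: measurable_snd.
exact: (measurableT_comp (measurable_coord j) measurable_fst).
Qed.

(** Replacing coordinate [i] by an independent normal variable preserves [gamma]: on a box, the
    image of the product measure has the same product of normal probabilities. This is how results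
    on the line enter R^n. *)
Lemma ge0_resample i (F : borelRn R n -> \bar R) : measurable_fun setT F ->
  (forall x, (0 <= F x)%E) ->
  (\int[gamma]_x F x = \int[gamma]_x \int[g1]_r F (upd i x r))%E.
Proof.
move=> mF F0.
have mU := measurable_upd i.
have mFU : measurable_fun setT (fun p : borelRn R n * measurableTypeR R => F (upd i p.1 p.2)).
  exact: (measurableT_comp mF mU).
rewrite -(@fubini_tonelli1 _ _ _ _ _ gamma g1 _ mFU)//.
rewrite -[RHS](ge0_integral_pushforward mU (gamma \x g1)%E measurableT mF (fun x _ => F0 x)).
apply: eq_measure_integral => B mB _.
apply: borelRn_measure_unique => //.
  by rewrite [X in (X < _)%E]probability_setT ltry.
have gbox A : (forall i, measurable (A i)) -> (gamma (box A) = \prod_(j < n) g1 (A j))%E by exact: gg.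
move=> A mA; rewrite [LHS](gbox _ mA) /pushforward.
have E : (fun p : borelRn R n * measurableTypeR R => upd i p.1 p.2 : borelRn R n) @^-1` box A =
    box (fun j => if j == i then setT else A j) `*` A i.
  apply/seteqP; split => -[x r] /=.
    move=> h; split; last by have := h i; rewrite updE eqxx.
    by move=> j; have := h j; rewrite updE; case: (j == i).
  move=> [h1 h2] j; rewrite updE; have := h1 j; case: eqVneq => // ->//.
have mA' j : measurable (if j == i then setT else A j) by case: ifP.
transitivity ((gamma \x g1)%E (box (fun j => if j == i then setT else A j) `*` A i)); last by rewrite -E.
rewrite [RHS]product_measure1E; [|exact: (measurable_box mA')|exact: mA].
rewrite [X in (_ = X * _)%E]gbox// (bigD1 i)//= [in RHS](bigD1 i)//= eqxx.
rewrite [X in (_ = X * _ * _)%E](@probability_setT _ _ _ g1) mul1e muleC.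
by congr (_ * _)%E; apply: eq_bigr => j /negbTE ->.
Qed.

End resample.

Section l1norm.
Context {R : realType} {n : nat}.
Implicit Types x y z : 'rV[R]_n.

(** For this norm, unlike the sup norm of the library, a Lipschitz constant is the same as a common
    bound on the partial derivatives of a differentiable function, and it passes unchanged to
    coordinate lines. *)
Definition l1 x : R := \sum_(i < n) `|x ord0 i|.

Lemma l1_ge0 x : 0 <= l1 x. Proof. exact: sumr_ge0. Qed.

Lemma l1_coord x i : `|x ord0 i| <= l1 x.
Proof. by rewrite /l1 (bigD1 i)//= lerDl sumr_ge0. Qed.

Lemma l1D x y : l1 (x + y) <= l1 x + l1 y.
Proof.
rewrite /l1 -big_split/=; apply: ler_sum => i _.
by rewrite mxE ler_normD.
Qed.

Lemma l1N x : l1 (- x) = l1 x.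
Proof. by apply: eq_bigr => i _; rewrite mxE normrN. Qed.

Lemma l1Z (a : R) x : l1 (a *: x) = `|a| * l1 x.
Proof. by rewrite mulr_sumr; apply: eq_bigr => i _; rewrite mxE normrM. Qed.

Lemma l1_0 : l1 0 = 0.
Proof. by rewrite /l1 big1// => i _; rewrite mxE normr0. Qed.

Lemma l1_e i : l1 (eRn R i) = 1.
Proof.
rewrite /l1 (bigD1 i)//= mxE !eqxx normr1 big1 ?addr0// => j ji.
by rewrite mxE (negbTE ji) andbF normr0.
Qed.

Definition lipn (L : R) (f : 'rV[R]_n -> R) := forall x y, `|f x - f y| <= L * l1 (x - y).

Lemma lipn_continuous L f : lipn L f -> continuous f.
Proof.
move=> fL x; apply/(@cvgrPdist_lt _ _ _ (nbhs x) (nbhs_filter x)) => e e0.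
have L1 : 0 < (`|L| + 1) * (n%:R + 1).
  by rewrite mulr_gt0// ltr_wpDl.
apply/nbhs_ballP; exists (e / ((`|L| + 1) * (n%:R + 1))) => /=; first exact: divr_gt0.
move=> y [_ xy]; apply: (le_lt_trans (fL x y)).
apply: (@le_lt_trans _ _ ((`|L| + 1) * (n%:R * (e / ((`|L| + 1) * (n%:R + 1)))))).
  apply: (@le_trans _ _ ((`|L| + 1) * l1 (x - y))).
    by rewrite ler_wpM2r ?l1_ge0//; have := ler_norm L; lra.
  rewrite ler_wpM2l ?addr_ge0// mulr_natl.
  have -> : e / ((`|L| + 1) * (n%:R + 1)) *+ n = \sum_(i < n) (e / ((`|L| + 1) * (n%:R + 1))).
    by rewrite sumr_const card_ord.
  apply: ler_sum => i _; rewrite !mxE; apply: ltW; exact: (xy ord0 i).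
have n1 : 0 < n%:R + 1 :> R by rewrite ltr_wpDl.
have L2 : 0 < `|L| + 1 by rewrite ltr_wpDl.
have -> : (`|L| + 1) * (n%:R * (e / ((`|L| + 1) * (n%:R + 1)))) = e * (n%:R / (n%:R + 1)).
  by field; rewrite !gt_eqF.
by rewrite gtr_pMr// ltr_pdivrMr// mul1r ltrDl.
Qed.

Lemma lipn_l1 : lipn 1 l1.
Proof.
move=> x y; rewrite mul1r ler_norml; apply/andP; split.
  rewrite lerNl opprB lerBlDr -[l1 (x - y)]l1N opprB.
  by apply: le_trans (l1D _ _); rewrite subrK.
by rewrite lerBlDr; apply: le_trans (l1D _ _); rewrite subrK.
Qed.

Lemma lipn_coord i : lipn 1 (fun x => x ord0 i).
Proof.
move=> x y; rewrite mul1r; have := l1_coord (x - y) i.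
by rewrite !mxE.
Qed.

Lemma lipn_le (L M : R) f : L <= M -> lipn L f -> lipn M f.
Proof. by move=> LM fL x y; apply: le_trans (fL x y) _; rewrite ler_wpM2r ?l1_ge0. Qed.

Lemma lipn_bound L f x : 0 <= L -> lipn L f -> `|f x| <= (`|f 0| + L) + (`|f 0| + L) * l1 x.
Proof.
move=> L0 fL; have := fL x 0; rewrite subr0 => h.
have : `|f x| <= `|f 0| + `|f x - f 0| by rewrite -[X in `|X| <= _](subrK (f 0)) addrC ler_normD.
have := normr_ge0 (f 0); have := l1_ge0 x; nra.
Qed.

Lemma lipn_line L f x i : lipn L f -> lipR L (fun r => f (x + r *: eRn R i)).
Proof.
move=> fL a b; apply: le_trans (fL _ _) _.
by rewrite opprD addrACA subrr add0r -scalerBl l1Z l1_e mulr1.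
Qed.

End l1norm.

(** * Gaussian means and moments on R^n *)

Section gaussn.
Context {R : realType} {n : nat}.
Local Notation g1 := (@normal_prob R 0 1).
Variable gamma : probability (borelRn R n) R.
Hypothesis gg : is_std_gaussian gamma.
Local Notation E f := (\int[gamma]_x f x).
Implicit Types (x y z : 'rV[R]_n).

Lemma measurable_l1 : measurable_fun setT (l1 : borelRn R n -> R).
Proof. by apply: continuous_borelRn; exact: lipn_continuous lipn_l1. Qed.

Lemma ge0_marginal i (F : R -> \bar R) : measurable_fun setT F ->
  (forall r, (0 <= F r)%E) ->
  (\int[gamma]_x F (x ord0 i) = \int[g1]_r F r)%E.
Proof.
move=> mF F0; have mFi := measurableT_comp mF (@measurable_coord R n i).
rewrite (ge0_resample gg i mFi (fun x => F0 _)).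
under eq_integral.
  move=> x _; under eq_integral do rewrite /= updE eqxx.
  over.
by rewrite integral_cst//= [X in (_ * X)%E](@probability_setT _ _ _ gamma) mule1.
Qed.

(** [l1 x] is at most [n] times the largest coordinate in absolute value, so the exponential is
    dominated by one plus a sum of exponentials of single coordinates, and the marginals suffice.
    The summand one covers [n] equal to zero. *)
Lemma integral_gauss_expR_l1 (C : R) : (\int[gamma]_x (expR (C * l1 x))%:E < +oo)%E.
Proof.
have mE (a : R) i : measurable_fun setT (fun x : borelRn R n => (expR (a * `|x ord0 i|))%:E).
  apply/measurable_EFinP; apply: measurableT_comp => //; apply: measurable_funM => //.
  by apply: measurableT_comp => //; exact: measurable_coord.
apply: (@le_lt_trans _ _ (\int[gamma]_x (1%:E + \sum_(i < n) (expR (n%:R * `|C| * `|x ord0 i|))%:E))%E).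
  apply: ge0_le_integral => //.
  - apply/measurable_EFinP; apply: measurableT_comp => //; apply: measurable_funM => //.
    exact: measurable_l1.
  - by apply: emeasurable_funD => //; apply: emeasurable_sum => i; exact: mE.
  move=> x _; rewrite sumEFin -EFinD lee_fin.
  have [M hM|] := pickP (fun i => [forall j, `|x ord0 j| <= `|x ord0 i|]).
    rewrite (bigD1 M)//=.
    have h : l1 x <= n%:R * `|x ord0 M|.
      rewrite mulr_natl.
      have -> : `|x ord0 M| *+ n = \sum_(j < n) `|x ord0 M| by rewrite sumr_const card_ord.
      by apply: ler_sum => j _; move/forallP: hM => /(_ j).
    apply: (@le_trans _ _ (expR (n%:R * `|C| * `|x ord0 M|))).
      rewrite ler_expR -mulrA mulrCA.
      apply: (@le_trans _ _ (`|C| * l1 x)); first by rewrite ler_wpM2r ?l1_ge0// ler_norm.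
      by rewrite ler_wpM2l.
    rewrite addrCA lerDl addr_ge0// sumr_ge0// => j _; exact: expR_ge0.
  move=> h.
  have x0 : l1 x = 0.
    rewrite /l1 big1// => i _; exfalso.
    have := @arg_maxP _ _ _ i xpredT (fun j => `|x ord0 j|) isT.
    case => j _ hj; have := h j => /negP; apply; apply/forallP => k; exact: hj.
  by rewrite x0 mulr0 expR0 lerDl sumr_ge0// => j _; exact: expR_ge0.
rewrite ge0_integralD//=; last 2 first.
- by move=> x _; rewrite sume_ge0.
- by apply: emeasurable_sum => i; exact: mE.
rewrite integral_cst//= ge0_integral_sum//=.
rewrite [X in (_ * X)%E](@probability_setT _ _ _ gamma) mule1.
rewrite lte_add_pinfty ?ltry// lte_sum_pinfty// => i _.
rewrite (@ge0_marginal i (fun r => (expR (n%:R * `|C| * `|r|))%:E)).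
- exact: integral_normal_expR_norm.
- by apply/measurable_EFinP; apply: measurableT_comp => //; apply: measurable_funM => //.
- by move=> r; rewrite lee_fin expR_ge0.
Qed.

Definition ebn (F : 'rV[R]_n -> R) := @ebd _ (borelRn R n) R l1 F.

Let w0 x : 0 <= l1 x. Proof. exact: l1_ge0. Qed.
Let mw := measurable_l1.
Let ew (C : R) := integral_gauss_expR_l1 C.
Let gT : gamma setT = 1%E. Proof. exact: (@probability_setT _ _ _ gamma). Qed.

Lemma ebn_cst c : ebn (fun=> c). Proof. exact: ebd_cst. Qed.
Lemma ebnD F G : ebn F -> ebn G -> ebn (fun x => F x + G x). Proof. exact: ebdD. Qed.
Lemma ebnB F G : ebn F -> ebn G -> ebn (fun x => F x - G x). Proof. exact: ebdB. Qed.
Lemma ebnM F G : ebn F -> ebn G -> ebn (fun x => F x * G x). Proof. exact: ebdM. Qed.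
Lemma ebnZ c F : ebn F -> ebn (fun x => c * F x). Proof. exact: ebdZ. Qed.
Lemma ebnX F m : ebn F -> ebn (fun x => F x ^+ m). Proof. exact: ebdX. Qed.
Lemma ebn_norm F : ebn F -> ebn (fun x => `|F x|). Proof. exact: ebd_norm. Qed.
Lemma ebn_fin F : ebn F -> (E F)%:E = (\int[gamma]_x (F x)%:E)%E.
Proof. exact: ebd_fin. Qed.
Lemma EnD F G : ebn F -> ebn G -> \int[gamma]_x (F x + G x) = E F + E G.
Proof. exact: ebd_ED. Qed.
Lemma EnB F G : ebn F -> ebn G -> \int[gamma]_x (F x - G x) = E F - E G.
Proof. exact: ebd_EB. Qed.
Lemma EnZ c F : ebn F -> \int[gamma]_x (c * F x) = c * E F.
Proof. exact: ebd_EZ. Qed.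
Lemma le_En F G : ebn F -> ebn G -> (forall x, F x <= G x) -> E F <= E G.
Proof. exact: ebd_le_E. Qed.
Lemma norm_En_le F G : ebn F -> ebn G -> (forall x, `|F x| <= G x) -> `|E F| <= E G.
Proof. exact: ebd_norm_E_le. Qed.
Lemma En_gt0 F : ebn F -> (forall x, 0 < F x) -> 0 < E F.
Proof. exact: ebd_E_gt0. Qed.
Lemma En_cst c : \int[gamma]_x c = c.
Proof. exact: E_cst. Qed.

Lemma ebn_sum (I : finType) (F : I -> 'rV[R]_n -> R) :
  (forall i, ebn (F i)) -> ebn (fun x => \sum_i F i x).
Proof.
move=> hF; rewrite (_ : (fun x => _) = \sum_i F i); last first.
  by apply/funext => x; rewrite fct_sumE.
apply: big_ind => //; [exact: ebn_cst|exact: ebnD].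
Qed.

Lemma En_sum (I : finType) (F : I -> 'rV[R]_n -> R) :
  (forall i, ebn (F i)) -> \int[gamma]_x (\sum_i F i x) = \sum_i E (F i).
Proof.
move=> hF.
suff: forall s : seq I, ebn (fun x => \sum_(i <- s) F i x) /\
    \int[gamma]_x (\sum_(i <- s) F i x) = \sum_(i <- s) E (F i).
  by move=> /(_ (index_enum I))[].
elim => [|i s [ih1 ih2]].
  have E0 : (fun x => \sum_(i <- [::]) F i x) = (fun=> 0) by apply/funext => x; rewrite big_nil.
  by rewrite E0 [RHS]big_nil; split; [exact: ebn_cst|exact: En_cst].
have E1 : (fun x => \sum_(j <- i :: s) F j x) = (fun x => F i x + \sum_(j <- s) F j x).
  by apply/funext => x; rewrite big_cons.
by rewrite E1 [RHS]big_cons -ih2 -EnD//; split => //; exact: ebnD.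
Qed.

Lemma lipn_ebn L f : 0 <= L -> lipn L f -> ebn f.
Proof.
move=> L0 fL; apply: (@ebd_lin _ _ _ _ _ _ (`|f 0| + L)) => //.
  by apply: continuous_borelRn; exact: lipn_continuous fL.
by move=> x; exact: lipn_bound.
Qed.

Lemma lipn_expR_ebn L f : 0 <= L -> lipn L f -> ebn (fun r => expR (f r)).
Proof.
move=> L0 fL; apply: (@ebd_expR _ _ _ _ _ _ (`|f 0| + L)) => //.
  by apply: continuous_borelRn; exact: lipn_continuous fL.
by move=> x; apply: le_trans (ler_norm _) _; exact: lipn_bound.
Qed.

Lemma ebn_l1 : ebn l1. Proof. exact: lipn_ebn ler01 lipn_l1. Qed.
Lemma ebn_coord i : ebn (fun x => x ord0 i).
Proof. exact: lipn_ebn ler01 (lipn_coord i). Qed.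

Lemma ebn_upd F i x : ebn F -> eb1 (fun r => F (upd i x r)).
Proof.
move=> [mF [C C0 FC]]; split.
  exact: (measurableT_comp mF (measurableT_comp (measurable_upd i) (@measurable_pair1 _ _ (borelRn R n) (measurableTypeR R) x))).
exists (C * expR (C * l1 x) + C).
  by rewrite addr_ge0// mulr_ge0// expR_ge0.
move=> r; apply: le_trans (FC _) _.
have h : l1 (upd i x r) <= l1 x + `|r|.
  rewrite /l1 (bigD1 i)//= updE eqxx [leRHS]addrC lerD2l.
  rewrite [leRHS](bigD1 i)//= ler_wpDl//; apply: ler_sum => j /negbTE ji.
  by rewrite updE ji.
apply: (@le_trans _ _ ((C * expR (C * l1 x)) * expR (C * `|r|))).
  by rewrite -mulrA -expRD ler_wpM2l// ler_expR -mulrDr ler_wpM2l.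
have e0 : 0 <= C * expR (C * l1 x) by rewrite mulr_ge0// expR_ge0.
rewrite ler_pM ?expR_ge0//; first lra.
rewrite ler_expR ler_wpM2r//; lra.
Qed.

Lemma En_resample F i : ebn F -> (forall x, 0 <= F x) ->
  E F = \int[gamma]_x \int[g1]_r F (upd i x r).
Proof.
move=> eF F0; rewrite /Rintegral; congr fine.
have mF : measurable_fun setT (fun x : borelRn R n => (F x)%:E).
  by apply/measurable_EFinP; case: eF.
rewrite (ge0_resample gg i mF (fun x => F0 x)).
by apply: eq_integral => x _; rewrite -eb1_fin//; exact: ebn_upd.
Qed.

(** Integrates out one coordinate of a signed function; both the moments of [gamma] and the
    tensorisation rest on it. *)
Lemma En_resample_eq F G i : ebn F -> ebn G ->
  (forall x, \int[g1]_r F (upd i x r) = G x) -> E F = E G.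
Proof.
move=> eF eG FG.
have eFn := ebn_norm eF.
have eP := ebnD eF eFn.
have P0 x : 0 <= F x + `|F x| by rewrite -lerBlDr sub0r lerNl -normrN ler_norm.
have -> : E F = \int[gamma]_x (F x + `|F x|) - \int[gamma]_x `|F x|.
  by rewrite EnD// addrK.
rewrite (@En_resample (fun x => F x + `|F x|) i)// (@En_resample (fun x => `|F x|) i)//.
have mI H : ebn H -> (forall x, 0 <= H x) ->
    gamma.-integrable setT (EFin \o (fun x => \int[g1]_r H (upd i x r))).
  move=> eH H0; have mH : measurable_fun setT (fun x : borelRn R n => (H x)%:E).
    by apply/measurable_EFinP; case: eH.
  have E1 (x : borelRn R n) : (\int[g1]_r H (upd i x r))%:E = (\int[g1]_r (H (upd i x r))%:E)%E.
    by rewrite -eb1_fin//; exact: ebn_upd.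
  apply/integrableP; split.
    have mU := measurableT_comp mH (measurable_upd i).
    have := @measurable_fun_fubini_tonelli_F _ _ _ _ _ g1 _ mU.
    move=> /(_ (fun p => H0 _)).
    by congr (measurable_fun _ _); apply/funext => x; rewrite /= E1.
  under eq_integral.
    move=> x _; rewrite gee0_abs/=; last by rewrite lee_fin Rintegral_ge0.
    rewrite E1; over.
  by rewrite -(ge0_resample gg i mH (fun x => H0 x)) -ebn_fin// ltry.
rewrite -RintegralB//; last 2 first.
- exact: (mI (fun x => F x + `|F x|) eP P0).
- exact: (mI (fun x => `|F x|) eFn (fun x => normr_ge0 _)).
apply: eq_Rintegral => x _; rewrite -FG.
have e1 := @ebn_upd F i x eF.
by rewrite (E1D e1 (eb1_norm e1)) addrK.
Qed.

Lemma En_coord i : \int[gamma]_x (x ord0 i) = 0.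
Proof.
rewrite (@En_resample_eq _ (fun=> 0) i) ?En_cst//; [exact: ebn_coord|exact: ebn_cst|].
move=> x; rewrite -[RHS](@E1_id R).
by apply: eq_Rintegral => r _; rewrite updE eqxx.
Qed.

Lemma En_coordM i j : \int[gamma]_x (x ord0 i * x ord0 j) = (i == j)%:R.
Proof.
have eij : ebn (fun x => x ord0 i * x ord0 j) by apply: ebnM; exact: ebn_coord.
rewrite (@En_resample_eq _ (fun=> (i == j)%:R) i) ?En_cst//; first exact: ebn_cst.
move=> x; have [<-|ij] := eqVneq i j.
  by rewrite -[RHS](@E1_sqr R); apply: eq_Rintegral => r _; rewrite updE eqxx expr2.
rewrite -[RHS](mulr0 (x ord0 j)) -[X in _ = _ * X](@E1_id R) -E1Z; last exact: eb1_id.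
by apply: eq_Rintegral => r _; rewrite !updE eqxx eq_sym (negbTE ij) mulrC.
Qed.

End gaussn.

(** * The inequality between exponential means *)

Section log_mean_exp.
Context {R : realType} {n : nat}.
Local Notation g1 := (@normal_prob R 0 1).
Variable gamma : probability (borelRn R n) R.
Hypothesis gg : is_std_gaussian gamma.
Local Notation E f := (\int[gamma]_x f x).
Implicit Types (x y z : 'rV[R]_n).

(* Coordinates are integrated out one at a time; [mask k x] forgets the first [k]. *)
Definition mask (k : nat) x : 'rV[R]_n := \row_j (if (j < k)%N then 0 else x ord0 j).

Lemma mask0 x : mask 0 x = x.
Proof. by apply/rowP => j; rewrite mxE. Qed.

Lemma maskn x : mask n x = 0.
Proof. by apply/rowP => j; rewrite !mxE ltn_ord. Qed.

Lemma mask_upd (i : 'I_n) x r : mask i (upd i x r) = mask i.+1 x + r *: eRn R i.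
Proof.
apply/rowP => j; rewrite !mxE ltnS eqxx/=.
have [->|ji] := eqVneq j i; first by rewrite ltnn leqnn mulr1 add0r.
rewrite mulr0 addr0 ltn_neqAle.
by have -> : (j == i :> nat) = false by apply/negbTE.
Qed.

Lemma l1_mask k x y : l1 (mask k x - mask k y) <= l1 (x - y).
Proof.
by apply: ler_sum => i _; rewrite !mxE; case: ifP => // _; rewrite subrr normr0.
Qed.

Lemma lipn_mask L (f : 'rV[R]_n -> R) k : 0 <= L -> lipn L f -> lipn L (fun x => f (mask k x)).
Proof.
by move=> L0 fL x y; apply: le_trans (fL _ _) _; rewrite ler_wpM2l// l1_mask.
Qed.

(** [ldir] and [mdir] are [lheat] and [heat] at time one along a coordinate line, taken at the
    origin of that line. *)
Definition ldir (f : 'rV[R]_n -> R) i x : R := ln (\int[g1]_r expR (f (x + r *: eRn R i))).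
Definition mdir (f : 'rV[R]_n -> R) i x : R := \int[g1]_r f (x + r *: eRn R i).

Let mdirE (f : 'rV[R]_n -> R) i x : mdir f i x = heat (fun r => f (x + r *: eRn R i)) 1 0.
Proof.
by rewrite /mdir /heat sqrtr1; apply: eq_Rintegral => r _; rewrite mul1r add0r.
Qed.

Let ldirE (f : 'rV[R]_n -> R) i x : ldir f i x = lheat (fun r => f (x + r *: eRn R i)) 1 0.
Proof. exact: (congr1 (@ln R) (mdirE (fun y => expR (f y)) i x)). Qed.

Lemma lipn_mdir L f i : 0 <= L -> lipn L f -> lipn L (mdir f i).
Proof.
move=> L0 fL x y.
have ex x' := lipR_eb1 L0 (lipn_line x' i fL).
rewrite /mdir -E1B// -[leRHS](@E1_cst R); apply: norm_E1_le.
- exact: eb1B.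
- exact: eb1_cst.
- by move=> r; apply: le_trans (fL _ _) _; rewrite opprD addrACA subrr addr0.
Qed.

Lemma expR_ldir L f i x : 0 <= L -> lipn L f ->
  expR (ldir f i x) = \int[g1]_r expR (f (x + r *: eRn R i)).
Proof.
move=> L0 fL; rewrite lnK// posrE.
apply: E1_gt0; last by move=> r; exact: expR_gt0.
exact: (lipR_expR_eb1 L0 (lipn_line x i fL)).
Qed.

Lemma lipn_ldir L f i : 0 <= L -> lipn L f -> lipn L (ldir f i).
Proof.
move=> L0 fL.
have ex x' := lipR_expR_eb1 L0 (lipn_line x' i fL).
have le1 x y : ldir f i x <= L * l1 (x - y) + ldir f i y.
  rewrite -ler_expR (expR_ldir i x L0 fL) [leRHS]expRD (expR_ldir i y L0 fL) -E1Z//.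
  apply: le_E1 => //; first exact: eb1Z.
  move=> r; rewrite -expRD ler_expR.
  have := fL (x + r *: eRn R i) (y + r *: eRn R i).
  rewrite opprD addrACA subrr addr0 => h.
  have := ler_norm (f (x + r *: eRn R i) - f (y + r *: eRn R i)); lra.
move=> x y; rewrite ler_norml; apply/andP; split.
  by rewrite lerNl opprB lerBlDr -l1N opprB.
by rewrite lerBlDr.
Qed.

(** Restricted to lines in direction [i], the hypothesis becomes that of [log_mean_exp_bound1]. The
    conclusion has the shape of the hypothesis, so it can be fed back for the next coordinate. *)
Lemma log_mean_exp_dir (L s : R) f g k i : 0 <= L -> 0 < s -> s < 1 ->
  lipn L f -> lipn L g -> lipn L k ->
  (forall y z, f (s *: y + (1 - s) *: z) <= s ^+ 2 * g y + k z) ->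
  forall y z, ldir f i (s *: y + (1 - s) *: z) <= s ^+ 2 * ldir g i y + mdir k i z.
Proof.
move=> L0 s0 s1 fL gL kL h y z; rewrite !ldirE mdirE.
set x := s *: y + _.
have := @log_mean_exp_bound1 R L s _ _ _ L0 s0 s1 (lipn_line x i fL) (lipn_line y i gL) (lipn_line z i kL).
move=> /(_ _ 0 0); rewrite !mulr0 addr0; apply => a b.
apply: le_trans (h _ _); rewrite le_eqVlt; apply/orP; left; apply/eqP; congr f.
by rewrite !scalerDr !scalerA addrACA -scalerDl.
Qed.

Lemma En_ldir L f (i : 'I_n) : 0 <= L -> lipn L f ->
  \int[gamma]_x expR (ldir f i (mask i.+1 x)) = \int[gamma]_x expR (f (mask i x)).
Proof.
move=> L0 fL; apply/esym.
apply: (@En_resample_eq _ _ _ gg _ _ i).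
- by apply: (lipn_expR_ebn L0); exact: lipn_mask.
- by apply: (lipn_expR_ebn L0); apply: lipn_mask => //; exact: lipn_ldir.
move=> x; rewrite (expR_ldir _ _ L0 fL).
by apply: eq_Rintegral => r _; rewrite mask_upd.
Qed.

Lemma En_mdir L f (i : 'I_n) : 0 <= L -> lipn L f ->
  \int[gamma]_x mdir f i (mask i.+1 x) = \int[gamma]_x f (mask i x).
Proof.
move=> L0 fL; apply/esym.
apply: (@En_resample_eq _ _ _ gg _ _ i).
- by apply: (lipn_ebn L0); exact: lipn_mask.
- by apply: (lipn_ebn L0); apply: lipn_mask => //; exact: lipn_mdir.
by move=> x; apply: eq_Rintegral => r _; rewrite mask_upd.
Qed.

(** Each pass integrates out one coordinate and keeps the Lipschitz constant, the pointwise
    inequality and the three means. After [n] passes [mask] sends every point to the origin, where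
    the pointwise inequality is the claim. *)
Theorem log_mean_exp_bound (L s : R) f g k : 0 <= L -> 0 < s -> s < 1 ->
  lipn L f -> lipn L g -> lipn L k ->
  (forall y z, f (s *: y + (1 - s) *: z) <= s ^+ 2 * g y + k z) ->
  ln (\int[gamma]_x expR (f x)) <= s ^+ 2 * ln (\int[gamma]_x expR (g x)) + E k.
Proof.
move=> L0 s0 s1 fL gL kL h.
have : forall m, (m <= n)%N -> exists f' g' k', [/\ lipn L f', lipn L g', lipn L k',
    (forall y z, f' (s *: y + (1 - s) *: z) <= s ^+ 2 * g' y + k' z) &
    [/\ \int[gamma]_x expR (f' (mask m x)) = \int[gamma]_x expR (f x),
     \int[gamma]_x expR (g' (mask m x)) = \int[gamma]_x expR (g x) &
     \int[gamma]_x (k' (mask m x)) = E k]].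
  elim=> [_|m ih mn].
    exists f, g, k; split; [exact: fL|exact: gL|exact: kL|exact: h|].
    by split; apply: eq_Rintegral => x _; rewrite mask0.
  have [f' [g' [k' [fL' gL' kL' h' [ef eg ek]]]]] := ih (ltnW mn).
  pose i := Ordinal mn.
  exists (ldir f' i), (ldir g' i), (mdir k' i); split.
  - exact: lipn_ldir.
  - exact: lipn_ldir.
  - exact: lipn_mdir.
  - exact: (log_mean_exp_dir _ L0 s0 s1 fL' gL' kL' h').
  - by rewrite -ef -eg -ek; split; [exact: (En_ldir i L0 fL')|exact: (En_ldir i L0 gL')|exact: (En_mdir i L0 kL')].
move=> /(_ n (leqnn n))[f' [g' [k' [_ _ _ h' [<- <- <-]]]]].
have E0 (F : 'rV[R]_n -> R) : \int[gamma]_x F (mask n x) = F 0.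
  transitivity (\int[gamma]_(x in setT) F 0); last exact: En_cst.
  by apply: eq_Rintegral => x _; rewrite maskn.
rewrite (E0 (fun x => expR (f' x))) (E0 (fun x => expR (g' x))) (E0 k') !expRK.
by have := h' 0 0; rewrite !scaler0 addr0.
Qed.

End log_mean_exp.

(** * Rotation invariance *)

Section exchange.
Context {R : realType} {n : nat}.
Local Notation g1 := (@normal_prob R 0 1).
Variable gamma : probability (borelRn R n) R.
Hypothesis gg : is_std_gaussian gamma.
Local Notation V := (borelRn R n).
Local Notation RR := (measurableTypeR R).
Implicit Types (x y z : 'rV[R]_n).

(** Brings both copies of coordinate [i] innermost, where [ge0_exchange1] can act on them. *)
Lemma ge0_resample2 i (F : V * V -> \bar R) : measurable_fun setT F ->
  (forall p, (0 <= F p)%E) ->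
  (\int[gamma]_x \int[gamma]_z F (x, z) =
   \int[gamma]_x \int[gamma]_z \int[g1]_r \int[g1]_q F (upd i x r, upd i z q))%E.
Proof.
move=> mF F0.
have mG := @measurable_fun_fubini_tonelli_F _ _ _ _ _ gamma _ mF F0.
rewrite (ge0_resample gg i mG); last by move=> x; exact: integral_ge0.
apply: eq_integral => x _.
have mFr (r : R) : measurable_fun setT (fun z : V => F (upd i x r, z)).
  exact: (measurableT_comp mF (measurable_pair1 _)).
transitivity (\int[g1]_r \int[gamma]_z \int[g1]_q F (upd i x r, upd i z q))%E.
  by apply: eq_integral => r _; rewrite /fubini_F (ge0_resample gg i (mFr r)).
pose H := fun p : (RR * V) * RR => F (upd i x p.1.1, upd i p.1.2 p.2).
have mux : measurable_fun setT (fun r : RR => upd i x r : V).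
  exact: (measurableT_comp (measurable_upd i) (@measurable_pair1 _ _ V RR x)).
have mH : measurable_fun setT H.
  apply: (measurableT_comp mF); apply: measurable_fun_pair.
    exact: (measurableT_comp mux (measurableT_comp measurable_fst measurable_fst)).
  have m2 : measurable_fun setT (fun p : (RR * V) * RR => (p.1.2, p.2)).
    apply: measurable_fun_pair => //.
    exact: (measurableT_comp measurable_snd measurable_fst).
  exact: (measurableT_comp (measurable_upd i) m2).
have mK := @measurable_fun_fubini_tonelli_F _ _ _ _ _ g1 _ mH (fun p => F0 _).
rewrite (@fubini_tonelli _ _ _ _ _ g1 gamma _ mK)//.
by move=> p; apply: integral_ge0 => q _; exact: F0.
Qed.

Section fixed_angle.
Variables (c s : R).
Hypothesis s0 : 0 < s.
Hypothesis cs1 : c ^+ 2 + s ^+ 2 = 1.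

(* Interpolates between the two sides of [ge0_exchange], rotating the first [k] coordinates. *)
Definition hyb (b : bool) (k : nat) x z : 'rV[R]_n :=
  \row_j (if (j < k)%N (+) b then c * x ord0 j + s * z ord0 j else x ord0 j).

Lemma measurable_hyb b k : measurable_fun setT (fun p : V * V => hyb b k p.1 p.2 : V).
Proof.
apply: measurable_borelRnP => j.
under eq_fun do rewrite mxE.
have m1 : measurable_fun setT (fun p : V * V => p.1 ord0 j : R).
  exact: (measurableT_comp (measurable_coord j) measurable_fst).
have m2 : measurable_fun setT (fun p : V * V => p.2 ord0 j : R).
  exact: (measurableT_comp (measurable_coord j) measurable_snd).
case: (_ (+) _) => //.
by apply: measurable_funD; exact: measurable_funM.
Qed.

Lemma hyb_upd b (i : 'I_n) x z r q :
  hyb b i (upd i x r) (upd i z q) = upd i (hyb b i x z) (if b then c * r + s * q else r).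
Proof.
apply/rowP => j; rewrite !mxE; have [->|ji] := eqVneq j i.
  by rewrite ltnn /=; case: b.
by [].
Qed.

Lemma hyb_updS b (i : 'I_n) x z r q :
  hyb b i.+1 (upd i x r) (upd i z q) = upd i (hyb b i x z) (if b then r else c * r + s * q).
Proof.
apply/rowP => j; rewrite !mxE; have [->|ji] := eqVneq j i.
  by rewrite ltnSn; case: b.
by rewrite ltnS leq_eqVlt (negbTE (ji : (j != i :> nat))).
Qed.

(** [Psi 0] is the left integrand and [Psi n] the right one. Passing from [i] to [i.+1] swaps which
    argument of [F] has its coordinate [i] rotated, and that is [ge0_exchange1]. *)
Lemma ge0_exchange (F : V * V -> \bar R) : measurable_fun setT F ->
  (forall p, (0 <= F p)%E) ->
  (\int[gamma]_x \int[gamma]_z F (x, (c *: x + s *: z)%R) =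
   \int[gamma]_x \int[gamma]_z F ((c *: x + s *: z)%R, x))%E.
Proof.
move=> mF F0.
pose Psi k (p : V * V) := F (hyb false k p.1 p.2, hyb true k p.1 p.2).
have mPsi k : measurable_fun setT (Psi k).
  by apply: (measurableT_comp mF); apply: measurable_fun_pair; exact: measurable_hyb.
have step (i : 'I_n) : (\int[gamma]_x \int[gamma]_z Psi i (x, z) =
    \int[gamma]_x \int[gamma]_z Psi i.+1 (x, z))%E.
  rewrite (ge0_resample2 i (mPsi i)); last by move=> p; exact: F0.
  rewrite (ge0_resample2 i (mPsi i.+1)); last by move=> p; exact: F0.
  apply: eq_integral => x _; apply: eq_integral => z _.
  pose H (p : R * R) := F (upd i (hyb false i x z) p.1, upd i (hyb true i x z) p.2).
  have mH : measurable_fun setT H.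
    apply: (measurableT_comp mF); apply: measurable_fun_pair.
      exact: (measurableT_comp (measurableT_comp (measurable_upd i) (@measurable_pair1 _ _ V RR _)) measurable_fst).
    exact: (measurableT_comp (measurableT_comp (measurable_upd i) (@measurable_pair1 _ _ V RR _)) measurable_snd).
  have := ge0_exchange1 s0 cs1 mH (fun p => F0 _).
  rewrite /H /Psi/= => h.
  transitivity (\int[g1]_x0 \int[g1]_z0 F (upd i (hyb false i x z) x0, upd i (hyb true i x z) (c * x0 + s * z0)%R))%E.
    by apply: eq_integral => r _; apply: eq_integral => q _; rewrite !hyb_upd.
  rewrite h; apply: eq_integral => r _; apply: eq_integral => q _.
  by rewrite !hyb_updS.
have : forall k, (k <= n)%N -> (\int[gamma]_x \int[gamma]_z Psi 0%N (x, z) =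
    \int[gamma]_x \int[gamma]_z Psi k (x, z))%E.
  elim=> [//|k ih kn]; rewrite (ih (ltnW kn)).
  exact: (step (Ordinal kn)).
move=> /(_ n (leqnn n)).
have h00 x z : hyb false 0%N x z = x by apply/rowP => j; rewrite !mxE.
have h01 x z : hyb true 0%N x z = c *: x + s *: z by apply/rowP => j; rewrite !mxE.
have h10 x z : hyb false n x z = c *: x + s *: z by apply/rowP => j; rewrite !mxE ltn_ord.
have h11 x z : hyb true n x z = x by apply/rowP => j; rewrite !mxE ltn_ord.
rewrite /Psi/= => h.
transitivity (\int[gamma]_x \int[gamma]_z F (hyb false 0%N x z, hyb true 0%N x z))%E.
  by apply: eq_integral => x _; apply: eq_integral => z _; rewrite h00 h01.
by rewrite h; apply: eq_integral => x _; apply: eq_integral => z _; rewrite h10 h11.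
Qed.

End fixed_angle.

Let g2 := (gamma \x gamma)%E.

Lemma integral_gauss2_expR_l1 (C : R) :
  (\int[g2]_p (expR (C * (l1 (p.1 : 'rV[R]_n) + l1 (p.2 : 'rV[R]_n))))%:E < +oo)%E.
Proof.
have ml : measurable_fun setT (fun x : V => (expR (C * l1 x))%:E).
  apply/measurable_EFinP; apply: measurableT_comp => //; apply: measurable_funM => //.
  exact: measurable_l1.
have ml1 : measurable_fun setT (fun p : V * V => l1 p.1 : R).
  exact: (measurableT_comp measurable_l1 measurable_fst).
have ml2 : measurable_fun setT (fun p : V * V => l1 p.2 : R).
  exact: (measurableT_comp measurable_l1 measurable_snd).
have ml12 : measurable_fun setT (fun p : V * V => (expR (C * (l1 p.1 + l1 p.2)))%:E).
  apply/measurable_EFinP; apply: measurableT_comp => //; apply: measurable_funM => //.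
  exact: measurable_funD.
rewrite [X in (X < _)%E](@fubini_tonelli1 _ _ _ _ _ gamma gamma _ ml12)//.
have lt := integral_gauss_expR_l1 gg C.
rewrite /fubini_F.
under eq_integral.
  move=> x _; under eq_integral do rewrite /= mulrDr expRD EFinM.
  rewrite ge0_integralZl//; over.
rewrite ge0_integralZr//; last by apply: integral_ge0 => y _; rewrite lee_fin expR_ge0.
apply: lte_mul_pinfty => //.
- by apply: integral_ge0 => y _; rewrite lee_fin expR_ge0.
- by rewrite ge0_fin_numE//; apply: integral_ge0 => y _; rewrite lee_fin expR_ge0.
Qed.

Definition w2 (p : V * V) : R := l1 (p.1 : 'rV[R]_n) + l1 (p.2 : 'rV[R]_n).
Definition eb2 (F : V * V -> R) := ebd w2 F.
Local Notation E2 F := (\int[g2]_p F p).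

Lemma w2_ge0 p : 0 <= w2 p. Proof. by rewrite addr_ge0// l1_ge0. Qed.
Lemma measurable_w2 : measurable_fun setT w2.
Proof.
apply: measurable_funD.
  exact: (measurableT_comp measurable_l1 measurable_fst).
exact: (measurableT_comp measurable_l1 measurable_snd).
Qed.
Let mw := measurable_w2.
Let w0 := w2_ge0.
Let ew (C : R) := integral_gauss2_expR_l1 C.

Lemma eb2_integrable F : eb2 F -> g2.-integrable setT (EFin \o F).
Proof. exact: ebd_integrable. Qed.
Lemma eb2_fin F : eb2 F -> (E2 F)%:E = (\int[g2]_p (F p)%:E)%E.
Proof. exact: ebd_fin. Qed.
Lemma E2D F G : eb2 F -> eb2 G -> \int[g2]_p (F p + G p) = E2 F + E2 G.
Proof. exact: ebd_ED. Qed.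
Lemma E2Z c F : eb2 F -> \int[g2]_p (c * F p) = c * E2 F.
Proof. exact: ebd_EZ. Qed.
Lemma eb2D F G : eb2 F -> eb2 G -> eb2 (fun p => F p + G p). Proof. by apply: ebdD; exact: w0. Qed.
Lemma eb2B F G : eb2 F -> eb2 G -> eb2 (fun p => F p - G p). Proof. by apply: ebdB; exact: w0. Qed.
Lemma eb2M F G : eb2 F -> eb2 G -> eb2 (fun p => F p * G p). Proof. by apply: ebdM; exact: w0. Qed.
Lemma eb2Z c F : eb2 F -> eb2 (fun p => c * F p). Proof. by apply: ebdZ; exact: w0. Qed.

Lemma eb2_lin (F : 'rV[R]_n -> R) (a b : R) : ebn F ->
  eb2 (fun p => F (a *: (p.1 : 'rV[R]_n) + b *: (p.2 : 'rV[R]_n))).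
Proof.
move=> [mF [C C0 FC]]; split.
  apply: (measurableT_comp mF); apply: measurable_borelRnP => j.
  under eq_fun do rewrite !mxE.
  apply: measurable_funD; apply: measurable_funM => //.
    exact: (measurableT_comp (measurable_coord j) measurable_fst).
  exact: (measurableT_comp (measurable_coord j) measurable_snd).
have D0 : 0 <= C * (`|a| + `|b|) by rewrite mulr_ge0// addr_ge0.
exists (C + C * (`|a| + `|b|)); first by rewrite addr_ge0.
move=> [x z]; apply: le_trans (FC _) _ => /=.
rewrite ler_pM ?expR_ge0//; first by rewrite lerDl.
rewrite ler_expR mulrDl.
have h : l1 (a *: (x : 'rV[R]_n) + b *: (z : 'rV[R]_n)) <= (`|a| + `|b|) * w2 (x, z).
  apply: le_trans (l1D _ _) _; rewrite !l1Z /w2/=.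
  have := l1_ge0 x; have := l1_ge0 z; have := normr_ge0 a; have := normr_ge0 b.
  move: (l1 x) (l1 z) `|a| `|b| => A B u v *; nra.
apply: (@le_trans _ _ (C * ((`|a| + `|b|) * w2 (x, z)))); first by rewrite ler_wpM2l.
by rewrite mulrA lerDr mulr_ge0.
Qed.

Lemma eb2_fst (F : 'rV[R]_n -> R) : ebn F -> eb2 (fun p => F p.1).
Proof.
move=> eF; have := eb2_lin 1 0 eF.
by congr eb2; apply/funext => p; rewrite scale1r scale0r addr0.
Qed.

Lemma eb2_slice F x : eb2 F -> ebn (fun z => F (x, z)).
Proof.
move=> [mF [C C0 FC]]; split; first exact: (measurableT_comp mF (@measurable_pair1 _ _ V V x)).
have e0 : 0 <= C * expR (C * l1 (x : 'rV[R]_n)) by rewrite mulr_ge0// expR_ge0.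
exists (C * expR (C * l1 (x : 'rV[R]_n)) + C); first exact: addr_ge0.
move=> z; apply: le_trans (FC _) _; rewrite /w2/= mulrDr expRD mulrA.
rewrite ler_pM ?expR_ge0//; first lra.
rewrite ler_expR ler_wpM2r ?l1_ge0//; lra.
Qed.

Lemma E2_fubini F : eb2 F -> E2 F = \int[gamma]_x \int[gamma]_z F (x, z).
Proof.
move=> eF; rewrite /Rintegral; congr fine.
rewrite -[LHS](integral12_prod_meas1 (eb2_integrable eF)).
by apply: eq_integral => x _; rewrite (ebn_fin gg (eb2_slice x eF)).
Qed.

Lemma E2_exchange (c s : R) (F : V * V -> R) : 0 < s -> c ^+ 2 + s ^+ 2 = 1 ->
  measurable_fun setT F ->
  eb2 (fun p => F (p.1, c *: (p.1 : 'rV[R]_n) + s *: (p.2 : 'rV[R]_n))) ->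
  eb2 (fun p => F (c *: (p.1 : 'rV[R]_n) + s *: (p.2 : 'rV[R]_n), p.1)) ->
  \int[g2]_p F (p.1, c *: (p.1 : 'rV[R]_n) + s *: (p.2 : 'rV[R]_n)) =
  \int[g2]_p F (c *: (p.1 : 'rV[R]_n) + s *: (p.2 : 'rV[R]_n), p.1).
Proof.
move=> s0 cs1 mF e1 e2.
have main (G : V * V -> R) : measurable_fun setT G -> (forall p, 0 <= G p) ->
  eb2 (fun p => G (p.1, c *: (p.1 : 'rV[R]_n) + s *: (p.2 : 'rV[R]_n))) ->
  eb2 (fun p => G (c *: (p.1 : 'rV[R]_n) + s *: (p.2 : 'rV[R]_n), p.1)) ->
  \int[g2]_p G (p.1, c *: (p.1 : 'rV[R]_n) + s *: (p.2 : 'rV[R]_n)) =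
  \int[g2]_p G (c *: (p.1 : 'rV[R]_n) + s *: (p.2 : 'rV[R]_n), p.1).
  move=> mG G0 eG1 eG2.
  have mG' : measurable_fun setT (fun p => (G p)%:E) by exact/measurable_EFinP.
  rewrite /Rintegral; congr fine.
  rewrite [LHS](@fubini_tonelli1 _ _ _ _ _ gamma gamma); last 2 first.
  - by apply/measurable_EFinP; case: eG1.
  - by move=> p; rewrite lee_fin.
  rewrite [RHS](@fubini_tonelli1 _ _ _ _ _ gamma gamma); last 2 first.
  - by apply/measurable_EFinP; case: eG2.
  - by move=> p; rewrite lee_fin.
  exact: (ge0_exchange s0 cs1 mG' (fun p => G0 p)).
have n1 := ebd_norm e1; have n2 := ebd_norm e2.
have spl (G : V * V -> R) : eb2 G -> E2 G = \int[g2]_p (G p + `|G p|) - \int[g2]_p `|G p|.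
  by move=> eG; rewrite (E2D eG (ebd_norm eG)) addrK.
rewrite (spl _ e1) (spl _ e2); congr (_ - _).
- apply: (main (fun p => F p + `|F p|)).
  + by apply: measurable_funD => //; exact: measurableT_comp.
  + by move=> p; rewrite -lerBlDr sub0r lerNl -normrN ler_norm.
  + exact: eb2D.
  + exact: eb2D.
- apply: (main (fun p => `|F p|)) => //.
  exact: measurableT_comp.
Qed.

Definition heatn (f : 'rV[R]_n -> R) (t : R) x : R := \int[gamma]_z f (x + Num.sqrt t *: z).

Lemma ebn_affine (f : 'rV[R]_n -> R) x (a : R) : ebn f -> ebn (fun z => f (x + a *: z)).
Proof.
move=> ef; have := eb2_slice x (eb2_lin 1 a ef).
by congr ebn; apply/funext => z; rewrite /= scale1r.
Qed.

(** As on the line: the exchange identity for a function of the second copy only. *)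
Lemma heatn_heatn f a b x : ebn f -> 0 < a -> 0 < b ->
  \int[gamma]_z heatn f b (x + Num.sqrt a *: z) = heatn f (a + b) x.
Proof.
move=> ef a0 b0.
have T0 : 0 < a + b by exact: addr_gt0.
pose c := Num.sqrt (a / (a + b)); pose s := Num.sqrt (b / (a + b)).
have s0 : 0 < s by rewrite sqrtr_gt0 divr_gt0.
have cs1 : c ^+ 2 + s ^+ 2 = 1.
  rewrite !sqr_sqrtr ?divr_ge0 ?(ltW a0) ?(ltW b0) ?(ltW T0)//.
  by rewrite -mulrDl divff// gt_eqF.
have Ta : Num.sqrt (a + b) * c = Num.sqrt a.
  by rewrite -sqrtrM ?(ltW T0)// mulrC divfK// gt_eqF.
have Tb : Num.sqrt (a + b) * s = Num.sqrt b.
  by rewrite -sqrtrM ?(ltW T0)// mulrC divfK// gt_eqF.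
have eg := ebn_affine x (Num.sqrt (a + b)) ef.
pose F (p : V * V) := f (x + Num.sqrt (a + b) *: (p.2 : 'rV[R]_n)).
have mF : measurable_fun setT F.
  have [mg _] := eg; exact: (measurableT_comp mg measurable_snd).
have e1 := eb2_lin c s eg.
have e2 := eb2_fst eg.
have := @E2_exchange c s F s0 cs1 mF e1 e2.
rewrite /F/= (E2_fubini e1) (E2_fubini e2)/= => h.
transitivity (\int[gamma]_y \int[gamma]_z f (x + Num.sqrt (a + b) *: (c *: (y : 'rV[R]_n) + s *: z))).
  apply: eq_Rintegral => y _; apply: eq_Rintegral => z _.
  by rewrite scalerDr !scalerA Ta Tb addrA.
by rewrite h; apply: eq_Rintegral => y _; exact: En_cst.
Qed.

End exchange.

(** * A lower bound for the heat flow *)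

Section calculus.
Context {R : realType} {n : nat}.
Implicit Types (x y z w : 'rV[R]_n) (f g : 'rV[R]_n -> R).

Lemma mx_norm_l1 x : `|x| <= l1 x.
Proof.
rewrite [leLHS]/Num.norm/= mx_normrE; apply: bigmax_le; first exact: l1_ge0.
by move=> [i j] _ /=; rewrite ord1 l1_coord.
Qed.

Lemma derive_sum f x w : differentiable f x ->
  'D_w f x = \sum_i w ord0 i * 'D_(eRn R i) f x.
Proof.
move=> df; rewrite deriveE// [w in LHS]row_sum_delta linear_sum.
by apply: eq_bigr => i _; rewrite linearZ/= deriveE.
Qed.

Lemma is_derive_line f x w (r : R) : differentiable f (x + r *: w) ->
  is_derive r 1 (fun t : R => f (x + t *: w)) ('D_w f (x + r *: w)).
Proof.
move=> df.
have E : (fun h : R => h^-1 *: (((fun t : R => f (x + t *: w)) \o shift r) (h *: (1 : R)) - f (x + r *: w))) =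
    (fun h : R => h^-1 *: ((f \o shift (x + r *: w)) (h *: w) - f (x + r *: w))).
  apply/funext => h /=; congr (_ *: (f _ - _)).
  by rewrite [h *: 1]mulr1 scalerDl addrCA.
apply: DeriveDef.
  by rewrite /derivable E; exact: diff_derivable.
by rewrite /derive E.
Qed.

Lemma diff_eps f x (e : R) : differentiable f x -> 0 < e ->
  exists2 d, 0 < d & forall w, `|w| < d ->
    `|f (x + w) - f x - \sum_i w ord0 i * 'D_(eRn R i) f x| <= e * `|w|.
Proof.
move=> df e0; have /eqaddoP := diff_locally df.
move=> /(_ e e0) /nbhs_normP [d /= d0 h]; exists d => // w wd.
have := h w; rewrite /= sub0r normrN => /(_ wd).
rewrite -[(_ - _) w]/(f (w + x) - (f x + 'd f x w)).
by rewrite -derive_sum// deriveE// [w + x]addrC opprD addrA.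
Qed.

Lemma mvt_line f x w : (forall y, differentiable f y) ->
  exists2 c : R, 0 <= c <= 1 &
    f (x + w) - f x = \sum_i w ord0 i * 'D_(eRn R i) f (x + c *: w).
Proof.
move=> df.
have dl (r : R) := is_derive_line (df (x + r *: w)).
have := @MVT_segment R (fun t => f (x + t *: w)) (fun t => 'D_w f (x + t *: w)) 0 1 ler01.
move=> /(_ (fun r _ => dl r)) [].
  apply: continuous_subspaceT => r; apply: differentiable_continuous.
  by apply/derivable1_diffP; have [] := dl r.
move=> c; rewrite in_itv/= => c01; rewrite scale1r scale0r addr0 subr0 mulr1 derive_sum//.
by exists c.
Qed.

Lemma lipn_grad f (L : R) : (forall y, differentiable f y) ->
  (forall i y, `|'D_(eRn R i) f y| <= L) -> lipn L f.
Proof.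
move=> df fL x y; have [c _] := mvt_line y (x - y) df.
rewrite [y + _]addrC subrK => ->.
rewrite (le_trans (ler_norm_sum _ _ _))// /l1 mulr_sumr; apply: ler_sum => i _.
by rewrite normrM mulrC ler_wpM2r.
Qed.

(** Second partial derivatives may be discontinuous, so there is no remainder in terms of second
    derivatives at intermediate points. The mean value theorem is used once along [w], and the
    partial derivatives are then expanded to first order at [x]. *)
Lemma peano2 f x (e : R) : twice_differentiable f -> 0 < e ->
  exists2 d, 0 < d & forall w, `|w| < d ->
    `|f (x + w) - f x - \sum_i w ord0 i * 'D_(eRn R i) f x -
     2^-1 * \sum_i \sum_j w ord0 i * w ord0 j * 'D_(eRn R j) (fun y => 'D_(eRn R i) f y) x|
    <= e * l1 w ^+ 2.
Proof.
move=> [df ddf] e0.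
have [d d0 hd] : exists2 d, 0 < d & forall i w, `|w| < d ->
    `|'D_(eRn R i) f (x + w) - 'D_(eRn R i) f x -
      \sum_j w ord0 j * 'D_(eRn R j) (fun y => 'D_(eRn R i) f y) x| <= e * `|w|.
  have h i := diff_eps (ddf i x) e0.
  pose dd i := s2val (cid2 (h i)).
  have dd0 i : 0 < dd i by rewrite /dd; case: cid2.
  have ddP i w : `|w| < dd i -> `|'D_(eRn R i) f (x + w) - 'D_(eRn R i) f x -
      \sum_j w ord0 j * 'D_(eRn R j) (fun y => 'D_(eRn R i) f y) x| <= e * `|w|.
    by rewrite /dd; case: cid2 => a a0 ha /= /ha.
  exists (\big[Order.min/1]_i dd i).
    by apply: lt_bigmin => //= i _.
  by move=> i w wd; apply: ddP; apply: lt_le_trans wd _; exact: bigmin_le_cond.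
exists d => // w wd.
pose a := \sum_i w ord0 i * 'D_(eRn R i) f x.
pose b := \sum_i \sum_j w ord0 i * w ord0 j * 'D_(eRn R j) (fun y => 'D_(eRn R i) f y) x.
rewrite -/a -/b.
have dl (r : R) := is_derive_line (df (x + r *: w)).
(* [f] along [w] minus its candidate quadratic polynomial. The derivative [dpsi] contains exactly
   the first order remainders of the partial derivatives. *)
pose psi (t : R) : R := f (x + t *: w) - (a * t + (2^-1 * b) * (t * t)).
pose dpsi (t : R) : R := 'D_w f (x + t *: w) - (a + b * t).
have dpsiP (r : R) : is_derive r 1 psi (dpsi r).
  have dlr := dl r.
  have dp : is_derive r 1 (fun t : R => a * t + (2^-1 * b) * (t * t)) (a + b * r).
    apply: is_derive_eq.
    rewrite /GRing.scale/= !mulr1 (_ : 2^-1 * b * (r + r) = b * r)//.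
    by field.
  exact: (is_deriveB dlr dp).
have cpsi : continuous psi.
  move=> r; apply: differentiable_continuous.
  by apply/derivable1_diffP; have [] := dpsiP r.
have [c] := @MVT_segment R psi dpsi 0 1 ler01 (fun r _ => dpsiP r) (continuous_subspaceT cpsi).
rewrite in_itv/= subr0 mulr1 => /andP[c0 c1].
rewrite {1 2}/psi scale1r scale0r addr0 !mulr0 !mulr1 addr0 subr0 => h.
have -> : f (x + w) - f x - a - 2^-1 * b = dpsi c by rewrite -h; ring.
have -> : dpsi c = \sum_i w ord0 i * ('D_(eRn R i) f (x + c *: w) - 'D_(eRn R i) f x -
      \sum_j (c *: w) ord0 j * 'D_(eRn R j) (fun y => 'D_(eRn R i) f y) x).
  rewrite /dpsi derive_sum// /a /b opprD addrA -sumrB mulr_suml -sumrB.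
  apply: eq_bigr => i _; rewrite !mulrBr; congr (_ - _).
  rewrite mulr_suml mulr_sumr; apply: eq_bigr => j _; rewrite mxE; ring.
have cw : `|c *: w| < d by rewrite normrZ (le_lt_trans _ wd)// ger0_norm// ler_piMl.
rewrite (le_trans (ler_norm_sum _ _ _))//.
apply: (@le_trans _ _ (\sum_i `|w ord0 i| * (e * l1 w))); last first.
  by rewrite -mulr_suml -/(l1 w) mulrCA expr2.
apply: ler_sum => i _; rewrite normrM ler_wpM2l//.
apply: le_trans (hd i _ cw) _; rewrite ler_wpM2l ?(ltW e0)//.
rewrite normrZ ger0_norm// (le_trans _ (mx_norm_l1 w))// ler_piMl//.
Qed.

End calculus.

Section heat_lower_bound.
Context {R : realType} {n : nat}.
Variable gamma : probability (borelRn R n) R.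
Hypothesis gg : is_std_gaussian gamma.
Implicit Types (x y z w : 'rV[R]_n) (f g : 'rV[R]_n -> R).

Let M2 : R := \int[gamma]_z (l1 z ^+ 2).
Let M4 : R := \int[gamma]_z (l1 z ^+ 4).

Let M20 : 0 <= M2. Proof. by rewrite Rintegral_ge0// => z _; exact: sqr_ge0. Qed.
Let M40 : 0 <= M4. Proof. by rewrite Rintegral_ge0// => z _; rewrite exprn_ge0// l1_ge0. Qed.

(** Coordinates are centred, uncorrelated and of variance one, so the linear part averages out and
    only the trace of [H] survives. *)
Lemma En_quadratic (t : R) (a : 'I_n -> R) (H : 'I_n -> 'I_n -> R) : 0 <= t ->
  \int[gamma]_z (\sum_i (Num.sqrt t *: z) ord0 i * a i +
     2^-1 * \sum_i \sum_j (Num.sqrt t *: z) ord0 i * (Num.sqrt t *: z) ord0 j * H i j) =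
  t / 2 * \sum_i H i i.
Proof.
move=> t0.
have e1 i : ebn (fun z : 'rV[R]_n => (Num.sqrt t * a i) * z ord0 i) by apply: ebnZ; exact: ebn_coord.
have e2 i j : ebn (fun z : 'rV[R]_n => (t * H i j) * (z ord0 i * z ord0 j)).
  by apply: ebnZ; apply: ebnM; exact: ebn_coord.
have e3 i : ebn (fun z : 'rV[R]_n => \sum_j (t * H i j) * (z ord0 i * z ord0 j)) by exact: ebn_sum.
transitivity (\int[gamma]_z (\sum_i (Num.sqrt t * a i) * z ord0 i +
   2^-1 * \sum_i \sum_j (t * H i j) * (z ord0 i * z ord0 j))).
  apply: eq_Rintegral => z _; congr (_ + _ * _).
    by apply: eq_bigr => i _; rewrite mxE; ring.
  apply: eq_bigr => i _; apply: eq_bigr => j _; rewrite !mxE.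
  by rewrite -{3}(sqr_sqrtr t0); ring.
have e4 := ebn_sum e1; have e5 := ebn_sum e3.
rewrite EnD//; last exact: ebnZ.
rewrite EnZ// !En_sum// big1 ?add0r; last first.
  by move=> i _; rewrite EnZ ?(En_coord gg) ?mulr0//; exact: ebn_coord.
rewrite [t / 2]mulrC -[RHS]mulrA; congr (_ * _).
rewrite mulr_sumr; apply: eq_bigr => i _.
rewrite En_sum// (bigD1 i)//= big1 ?addr0; last first.
  move=> j /negbTE ji; rewrite EnZ ?(En_coordM gg)//; last by apply: ebnM; exact: ebn_coord.
  by rewrite eq_sym ji mulr0.
rewrite EnZ ?(En_coordM gg)// ?eqxx ?mulr1//; by apply: ebnM; exact: ebn_coord.
Qed.

(** Near [x] the expansion of [peano2] is averaged. The radius depends on [x], and so does [t0]: the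
    bound is not uniform, which is why a maximum principle is needed afterwards. *)
Lemma heat_small f (L k : R) x : 0 <= L -> lipn L f -> twice_differentiable f -> 0 < k ->
  exists2 t0, 0 < t0 & forall t, 0 < t <= t0 ->
    t / 2 * laplacianRn f x - k * t <= heatn gamma f t x - f x.
Proof.
move=> L0 fL df k0.
pose e := k / (2 * (M2 + 1)).
have M21 : 0 < M2 + 1 by rewrite ltr_wpDl.
have e0 : 0 < e by rewrite divr_gt0// mulr_gt0.
have [d d0 hd] := peano2 x df e0.
pose a i := 'D_(eRn R i) f x.
pose H i j := 'D_(eRn R j) (fun y => 'D_(eRn R i) f y) x.
pose A := \sum_i `|a i|.
pose B := \sum_i \sum_j `|H i j|.
have A0 : 0 <= A by exact: sumr_ge0.
have B0 : 0 <= B by apply: sumr_ge0 => i _; exact: sumr_ge0.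
(* Where [w] has norm at least [d], linear and quadratic terms are absorbed into [K * l1 w ^+ 4]. At
   scale [Num.sqrt t] this has mean of order [t ^+ 2], negligible against [t]. *)
pose K := (L + A) / d ^+ 3 + B / d ^+ 2.
have K0 : 0 <= K by rewrite addr_ge0// divr_ge0// ?addr_ge0// exprn_ge0// ltW.
have lb w : \sum_i w ord0 i * a i + 2^-1 * \sum_i \sum_j w ord0 i * w ord0 j * H i j -
    (e * l1 w ^+ 2 + K * l1 w ^+ 4) <= f (x + w) - f x.
  have l0 := l1_ge0 w.
  have l40 : 0 <= l1 w ^+ 4 by exact: exprn_ge0.
  have [wd|wd] := ltP `|w| d.
    have := hd w wd; rewrite ler_norml => /andP[h _].
    have := mulr_ge0 K0 l40.
    rewrite /a /H; move: h; clear; lra.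
  have ld : d <= l1 w by exact: le_trans wd (mx_norm_l1 w).
  have h1 : `|\sum_i w ord0 i * a i| <= A * l1 w.
    rewrite (le_trans (ler_norm_sum _ _ _))// mulr_suml; apply: ler_sum => i _.
    by rewrite normrM mulrC ler_wpM2l// l1_coord.
  have h2 : `|\sum_i \sum_j w ord0 i * w ord0 j * H i j| <= B * l1 w ^+ 2.
    rewrite (le_trans (ler_norm_sum _ _ _))// mulr_suml; apply: ler_sum => i _.
    rewrite (le_trans (ler_norm_sum _ _ _))// mulr_suml; apply: ler_sum => j _.
    by rewrite normrM mulrC ler_wpM2l// normrM expr2 ler_pM// l1_coord.
  have h3 := fL (x + w) x; rewrite addrAC subrr add0r in h3.
  have h4 : (L + A) * l1 w <= (L + A) / d ^+ 3 * l1 w ^+ 4.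
    rewrite -mulrA ler_wpM2l ?addr_ge0// [l1 w ^+ 4]exprSr mulrA ler_peMl//.
    by rewrite ler_pdivlMl ?exprn_gt0// mulr1 lerXn2r ?nnegrE// ltW.
  have h5 : B * l1 w ^+ 2 <= B / d ^+ 2 * l1 w ^+ 4.
    rewrite -mulrA ler_wpM2l// (_ : 4 = 2 + 2)%N// exprD mulrA ler_peMl ?exprn_ge0//.
    by rewrite ler_pdivlMl ?exprn_gt0// mulr1 lerXn2r ?nnegrE// ltW.
  have h6 : 0 <= e * l1 w ^+ 2 by rewrite mulr_ge0 ?sqr_ge0// ltW.
  have h7 := ler_norm (\sum_i w ord0 i * a i).
  have h8 := ler_norm (\sum_i \sum_j w ord0 i * w ord0 j * H i j).
  have h9 : - (L * l1 w) <= f (x + w) - f x by move: h3; rewrite ler_norml => /andP[].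
  have hB : 0 <= B * l1 w ^+ 2 by rewrite mulr_ge0 ?sqr_ge0.
  rewrite /K mulrDl.
  move: h1 h2 h4 h5 h6 h7 h8 h9 hB; rewrite [(L + A) * l1 w]mulrDl.
  clear; lra.
pose t0 := Num.min 1 (k / (2 * (K * M4 + 1))).
have KM : 0 < K * M4 + 1 by rewrite ltr_wpDl// mulr_ge0.
exists t0; first by rewrite lt_min ltr01 divr_gt0// mulr_gt0.
move=> t /andP[tp tt0].
have ef := lipn_ebn L0 fL.
have el := @ebn_l1 R n.
have eQ : ebn (fun z => \sum_i (Num.sqrt t *: z) ord0 i * a i +
     2^-1 * \sum_i \sum_j (Num.sqrt t *: z) ord0 i * (Num.sqrt t *: z) ord0 j * H i j).
  have ec i : ebn (fun z : 'rV[R]_n => (Num.sqrt t *: z) ord0 i).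
    have := ebnZ (Num.sqrt t) (ebn_coord i).
    by congr ebn; apply/funext => z; rewrite mxE.
  apply: ebnD.
    by apply: ebn_sum => i; apply: ebnM => //; exact: ebn_cst.
  apply: ebnZ; apply: ebn_sum => i; apply: ebn_sum => j.
  by apply: ebnM; [exact: ebnM|exact: ebn_cst].
have eT : ebn (fun z => (e * t) * l1 z ^+ 2 + (K * t ^+ 2) * l1 z ^+ 4).
  by apply: ebnD; apply: ebnZ; exact: ebnX.
have eh := ebn_affine x (Num.sqrt t) ef.
rewrite -[X in _ <= _ - X](En_cst gamma) /heatn -EnB//; last exact: ebn_cst.
apply: (@le_trans _ _ (\int[gamma]_z ((\sum_i (Num.sqrt t *: z) ord0 i * a i +
     2^-1 * \sum_i \sum_j (Num.sqrt t *: z) ord0 i * (Num.sqrt t *: z) ord0 j * H i j) -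
     ((e * t) * l1 z ^+ 2 + (K * t ^+ 2) * l1 z ^+ 4)))); last first.
  apply: (le_En gg); [exact: ebnB|by apply: ebnB => //; exact: ebn_cst|].
  move=> z; apply: le_trans (lb _); rewrite lerD2l lerN2 !l1Z ger0_norm//.
  have st := sqr_sqrtr (ltW tp).
  have s4 : Num.sqrt t ^+ 4 = t ^+ 2 by rewrite (exprM _ 2 2) st.
  by rewrite !exprMn s4 st !mulrA.
rewrite EnB// En_quadratic ?(ltW tp)// EnD//; [|by apply: ebnZ; exact: ebnX|by apply: ebnZ; exact: ebnX].
rewrite EnZ ?EnZ//; [|exact: ebnX|exact: ebnX].
rewrite -/M2 -/M4 -/(laplacianRn f x) lerD2l lerN2.
have q1 : e * t * M2 <= k * t / 2.
  have -> : k * t / 2 = e * t * (M2 + 1) by rewrite /e; field; rewrite gt_eqF.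
  by rewrite ler_wpM2l ?lerDl// mulr_ge0// ltW.
have q2 : K * t ^+ 2 * M4 <= k * t / 2.
  have tk : t * (2 * (K * M4 + 1)) <= k.
    by rewrite -ler_pdivlMr ?mulr_gt0// (le_trans tt0)// ge_min lexx orbT.
  have -> : K * t ^+ 2 * M4 = t * (t * (K * M4)) by ring.
  have := ler_wpM2l (ltW tp) tk.
  have := mulr_ge0 (ltW tp) (ltW tp).
  clear; lra.
by move: q1 q2; clear; lra.
Qed.

End heat_lower_bound.

(** * The maximum principle *)

Section heat_max.
Context {R : realType} {n : nat}.
Variable gamma : probability (borelRn R n) R.
Hypothesis gg : is_std_gaussian gamma.
Implicit Types (x y z w : 'rV[R]_n) (f g : 'rV[R]_n -> R).

Definition sqdist y x : R := \sum_i (x ord0 i - y ord0 i) ^+ 2.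

Lemma sqdist_ge0 y x : 0 <= sqdist y x.
Proof. by apply: sumr_ge0 => i _; exact: sqr_ge0. Qed.

Lemma ebn_sqdist y : ebn (sqdist y).
Proof.
apply: ebn_sum => i; apply: ebnX; apply: ebnB; [exact: ebn_coord|exact: ebn_cst].
Qed.

Lemma continuous_sqdist y : continuous (sqdist y).
Proof.
apply: continuous_big => [|i _]; first exact: add_continuous.
have c2 : continuous (fun u : R => (u - y ord0 i) ^+ 2).
  by move=> u; apply: cvgM; (apply: cvgB; [exact: cvg_id|exact: cvg_cst]).
move=> x; apply: (@continuous_comp _ _ _ (fun x : 'rV[R]_n => x ord0 i) (fun u : R => (u - y ord0 i) ^+ 2)).
  exact: coord_continuous.
exact: c2.
Qed.

Lemma En_sqdist y x t : 0 <= t ->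
  \int[gamma]_z sqdist y (x + Num.sqrt t *: z) = sqdist y x + n%:R * t.
Proof.
move=> t0.
have e1 i : ebn (fun z : 'rV[R]_n => ((x + Num.sqrt t *: z) ord0 i - y ord0 i) ^+ 2).
  apply: ebnX; apply: ebnB; last exact: ebn_cst.
  exact: (ebn_affine x (Num.sqrt t) (ebn_coord i)).
rewrite En_sum// /sqdist (_ : n%:R * t = \sum_(i < n) t); last first.
  by rewrite sumr_const card_ord mulr_natl.
rewrite -big_split/=; apply: eq_bigr => i _.
have ec := @ebn_coord R n i.
have ecc : ebn (fun z : 'rV[R]_n => z ord0 i * z ord0 i) by exact: ebnM.
transitivity (\int[gamma]_z ((x ord0 i - y ord0 i) ^+ 2 +
  ((2 * Num.sqrt t * (x ord0 i - y ord0 i)) * z ord0 i + t * (z ord0 i * z ord0 i)))).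
  apply: eq_Rintegral => z _; rewrite !mxE.
  by rewrite -[in t * _](sqr_sqrtr t0); ring.
rewrite EnD//; [|exact: ebn_cst|by apply: ebnD; exact: ebnZ].
rewrite EnD//; [|exact: ebnZ|exact: ebnZ].
by rewrite En_cst !EnZ// (En_coord gg) (En_coordM gg) eqxx mulr0 add0r mulr1.
Qed.

Let M1 : R := \int[gamma]_z l1 z.
(** The heat flow in terms of the standard deviation [s], in which it is Lipschitz down to [s] equal
    to zero; in the time it would be only Hölder there. *)
Let Pf f (s : R) x : R := \int[gamma]_z f (x + s *: z).

Lemma Pf_lip L f s s' x x' : 0 <= L -> lipn L f ->
  `|Pf f s x - Pf f s' x'| <= L * l1 (x - x') + L * M1 * `|s - s'|.
Proof.
move=> L0 fL; have ef := lipn_ebn L0 fL.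
have el := @ebn_l1 R n.
have e1 := ebn_affine x s ef; have e2 := ebn_affine x' s' ef.
rewrite /Pf -EnB// mulrAC -EnZ// -[X in X + _](En_cst gamma) -EnD//; last 2 first.
- exact: ebn_cst.
- exact: ebnZ.
apply: (norm_En_le gg); [exact: ebnB|by apply: ebnD; [exact: ebn_cst|exact: ebnZ]|].
move=> z; apply: le_trans (fL _ _) _; rewrite -mulrA -mulrDr ler_wpM2l//.
rewrite opprD addrACA -scalerBl; apply: le_trans (l1D _ _) _.
by rewrite l1Z.
Qed.

Lemma continuous_Pf L f : 0 <= L -> lipn L f ->
  continuous (fun p : R * 'rV[R]_n => Pf f p.1 p.2).
Proof.
move=> L0 fL p0.
pose D (p : R * 'rV[R]_n) := L * l1 (p.2 - p0.2) + L * M1 * `|p.1 - p0.1|.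
have cD : D p @[p --> p0] --> D p0.
  apply: cvgD.
    apply: cvgM; first exact: cvg_cst.
    have cl : continuous (fun x : 'rV[R]_n => l1 (x - p0.2)).
      apply: (@lipn_continuous _ _ 1) => x y; apply: le_trans (lipn_l1 _ _) _.
      by rewrite opprD addrACA subrr addr0.
    by apply: (@continuous_comp _ _ _ snd (fun x : 'rV[R]_n => l1 (x - p0.2)) p0); [exact: cvg_snd|exact: cl].
  apply: cvgM; first exact: cvg_cst.
  by apply: cvg_norm; apply: cvgB; [exact: cvg_fst|exact: cvg_cst].
have D0 : D p0 = 0 by rewrite /D !subrr l1_0 normr0 !mulr0 addr0.
rewrite D0 in cD.
apply/(@cvgrPdist_lt _ _ _ (nbhs p0) (nbhs_filter p0)) => e e0.
have /(@cvgrPdist_lt _ _ _ (nbhs p0) (nbhs_filter p0)) /(_ e e0) := cD.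
apply: filterS => p; rewrite sub0r normrN => De.
rewrite distrC; apply: le_lt_trans (Pf_lip _ _ _ _ L0 fL) _.
exact: le_lt_trans (ler_norm _) De.
Qed.

(* Maximum principle: [heatn gamma f t y - f y + (M / 2 + e) t + h |y - x|^2] has a minimum over
   a compact set, which by [heat_small] is not attained at a positive time. *)
Theorem heat_max L M f (t : R) x : 0 <= L -> 0 <= M -> lipn L f ->
  twice_differentiable f -> (forall y, - M <= laplacianRn f y) -> 0 < t ->
  f x - M * t / 2 <= heatn gamma f t x.
Proof.
move: t x => t1 x1 L0 M0 fL df hM t1_gt0.
rewrite leNgt; apply/negP => bad.
pose k := f x1 - M * t1 / 2 - heatn gamma f t1 x1.
have k0 : 0 < k by rewrite subr_gt0.
(* Spends half of the assumed deficit [k], so that [W] still equals [- k / 2] at time [t1] and point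
   [x1]. *)
pose e := k / (2 * t1).
have e0 : 0 < e by rewrite divr_gt0// mulr_gt0.
(* The heat flow over time [t] raises the mean of [sqdist] by [n%:R * t]; this [h] keeps the cost
   below [e * t / 2]. *)
pose h := e / (2 * (n%:R + 1)).
have n1 : 0 < n%:R + 1 :> R by rewrite ltr_wpDl.
have h0 : 0 < h by rewrite divr_gt0// mulr_gt0.
have hn : h * n%:R <= e / 2.
  have -> : e / 2 = h * (n%:R + 1) by rewrite /h; field; rewrite gt_eqF.
  by rewrite ler_wpM2l ?(ltW h0)// lerDl.
pose W (p : R * 'rV[R]_n) := Pf f p.1 p.2 - f p.2 + ((M / 2 + e) * (p.1 * p.1) + h * sqdist x1 p.2).
have cW : continuous W.
  move=> p0; apply: cvgD; [apply: cvgB|apply: cvgD].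
  - exact: (continuous_Pf L0 fL).
  - apply: (@continuous_comp _ _ _ snd f); [exact: cvg_snd|exact: (lipn_continuous fL)].
  - by apply: cvgM; [exact: cvg_cst|apply: cvgM; exact: cvg_fst].
  - apply: cvgM; first exact: cvg_cst.
    by apply: (@continuous_comp _ _ _ snd (sqdist x1)); [exact: cvg_snd|exact: continuous_sqdist].
pose s1 := Num.sqrt t1.
have s10 : 0 < s1 by rewrite sqrtr_gt0.
have s12 : s1 ^+ 2 = t1 by rewrite sqr_sqrtr// ltW.
pose C0 := L * M1 * s1.
have C00 : 0 <= C0.
  rewrite /C0 !mulr_ge0 ?(ltW s10)// Rintegral_ge0// => z _; exact: l1_ge0.
have Pfb s x : 0 <= s <= s1 -> - C0 <= Pf f s x - f x.
  move=> /andP[s0 ss1].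
  have Pf0 : Pf f 0 x = f x.
    transitivity (\int[gamma]_(z in setT) f x); last exact: En_cst.
    by apply: eq_Rintegral => z _; rewrite scale0r addr0.
  have := Pf_lip s 0 x x L0 fL; rewrite Pf0 subrr l1_0 mulr0 add0r subr0 [`|s|]ger0_norm//.
  rewrite ler_norml => /andP[q _]; apply: le_trans q; rewrite lerN2 /C0.
  rewrite ler_wpM2l// mulr_ge0// Rintegral_ge0// => z _; exact: l1_ge0.
(* Outside the box of half-width [r] the penalty exceeds [C0], the most by which [Pf] can fall below
   [f], so [W] is nonnegative there and the minimum over the box is global. *)
pose r := C0 / h + 1.
have Ch : 0 <= C0 / h by rewrite divr_ge0// ltW.
have r0 : 0 < r by rewrite ltr_wpDl.
pose B : set 'rV[R]_n := [set v | forall i, `[x1 ord0 i - r, x1 ord0 i + r]%classic (v ord0 i)].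
pose A : set (R * 'rV[R]_n) := `[0, s1]%classic `*` B.
have cA : compact A.
  apply: compact_setX; first exact: segment_compact.
  by apply: (@rV_compact _ _ (fun i => `[x1 ord0 i - r, x1 ord0 i + r]%classic)) => i; exact: segment_compact.
have A1 : A (s1, x1).
  split => /=; first by rewrite in_itv/= lexx ltW.
  by move=> i; rewrite /= in_itv/=; apply/andP; split; rewrite ?lerBlDr lerDl ltW.
have [] := @compact_EVT_min _ R W A (ex_intro _ _ A1) cA (continuous_subspaceT cW).
move=> [s0 x0]; rewrite inE => -[/= s0b x0B] minA.
have Wm : W (s0, x0) < 0.
  have le1 := minA (s1, x1) (mem_set A1); apply: le_lt_trans le1 _.
  have sq0 : sqdist x1 x1 = 0 by rewrite /sqdist big1// => i _; rewrite subrr expr0n.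
  rewrite /W/= sq0 mulr0 addr0 -expr2 s12.
  have -> : Pf f s1 x1 = heatn gamma f t1 x1 by [].
  have : e * t1 = k / 2 by rewrite /e; field; rewrite gt_eqF.
  by move: k0; rewrite /k; clear; lra.
have Wge s x : 0 <= s <= s1 -> W (s0, x0) <= W (s, x).
  move=> ss1; have [xB|xB] := pselect (B x).
    by apply: minA; rewrite inE; split => //=; rewrite in_itv.
  apply: (le_trans (ltW Wm)).
  have [i hi] : exists i, ~ (x1 ord0 i - r <= x ord0 i <= x1 ord0 i + r).
    by apply/existsNP => hx; apply: xB => i /=; rewrite in_itv/=; exact: hx.
  have ri : r < `|x ord0 i - x1 ord0 i|.
    rewrite ltNge; apply/negP; rewrite ler_distl => hx; apply: hi.
    by move: hx; rewrite addrC.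
  have q : C0 / h <= sqdist x1 x.
    apply: (@le_trans _ _ (r ^+ 2)).
      by move: Ch; rewrite /r; move: (C0 / h) => c *; nra.
    rewrite /sqdist (bigD1 i)//= ler_wpDr ?sumr_ge0// => [j _|]; first exact: sqr_ge0.
    by rewrite -[leRHS]real_normK ?num_real// lerXn2r ?nnegrE ?(ltW r0)// ltW.
  have q2 : C0 <= h * sqdist x1 x by rewrite mulrC -ler_pdivrMr.
  have := Pfb s x ss1.
  have : 0 <= (M / 2 + e) * (s * s).
    case/andP: ss1 => s_ge0 _; apply: mulr_ge0; last exact: mulr_ge0.
    by apply: addr_ge0; [exact: divr_ge0|exact: ltW].
  by rewrite /W/=; move: q2; clear; lra.
have s00 : 0 < s0.
  move: s0b; rewrite in_itv/= => /andP[s0ge _].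
  rewrite lt_neqAle s0ge andbT; apply/negP => /eqP s0E.
  move: Wm; rewrite /W/= -s0E.
  have -> : Pf f 0 x0 = f x0.
    transitivity (\int[gamma]_(z in setT) f x0); last exact: En_cst.
    by apply: eq_Rintegral => z _; rewrite scale0r addr0.
  have := mulr_ge0 (ltW h0) (sqdist_ge0 x1 x0).
  by clear; lra.
pose t0 := s0 ^+ 2.
have t00 : 0 < t0 by rewrite exprn_gt0.
have st0 : Num.sqrt t0 = s0 by rewrite sqrtr_sqr gtr0_norm.
have e40 : 0 < e / 4 by rewrite divr_gt0.
have [T T0 hT] := heat_small gg x0 L0 fL df e40.
pose t := Num.min T (t0 / 2).
have tp : 0 < t by rewrite lt_min T0 divr_gt0.
have tT : 0 < t <= T by rewrite tp ge_min lexx.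
have tt0 : t < t0.
  by rewrite gt_min; apply/orP; right; rewrite ltr_pdivrMr// ltr_pMr// ltr1n.
have bp : 0 < t0 - t by rewrite subr_gt0.
have ef := lipn_ebn L0 fL.
have eh b : ebn (heatn gamma f b).
  apply: (@lipn_ebn _ _ L _ L0) => u v.
  have := Pf_lip (Num.sqrt b) (Num.sqrt b) u v L0 fL.
  by rewrite subrr normr0 mulr0 addr0.
have sb1 : 0 <= Num.sqrt (t0 - t) <= s1.
  rewrite sqrtr_ge0/=; move: s0b; rewrite in_itv/= => /andP[_]; apply: le_trans.
  by rewrite -st0 ler_wsqrtr// lerBlDr lerDl ltW.
have esq := ebn_sqdist x1.
pose m := W (s0, x0).
(* Minimality is compared with the earlier time [t0 - t] at every point [u]. Averaging over [u]
   around [x0] with variance [t], the semigroup law restores time [t0] on the right. *)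
have lb (u : 'rV[R]_n) :
    f u - h * sqdist x1 u + (m - (M / 2 + e) * (t0 - t)) <= heatn gamma f (t0 - t) u.
  have := Wge _ u sb1; rewrite -/m {1}/W /= -expr2 sqr_sqrtr ?(ltW bp)//.
  have -> : Pf f (Num.sqrt (t0 - t)) u = heatn gamma f (t0 - t) u by [].
  by lra.
have e1 := ebn_affine x0 (Num.sqrt t) ef.
have e2 := ebn_affine x0 (Num.sqrt t) (eh (t0 - t)).
have e3 := ebn_affine x0 (Num.sqrt t) esq.
have int : heatn gamma f t x0 - h * (sqdist x1 x0 + n%:R * t) + (m - (M / 2 + e) * (t0 - t)) <=
    heatn gamma f t0 x0.
  have hh := heatn_heatn gg x0 ef tp bp.
  rewrite (_ : t + (t0 - t) = t0) in hh; last by rewrite addrC subrK.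
  rewrite -hh -(En_sqdist x1 x0 (ltW tp)).
  rewrite -EnZ// /heatn -EnB//; last exact: ebnZ.
  rewrite -[X in _ + X](En_cst gamma) -EnD//; last 2 first.
  - by apply: ebnB => //; exact: ebnZ.
  - exact: ebn_cst.
  by apply: (le_En gg) => //; apply: ebnD; [apply: ebnB => //; exact: ebnZ|exact: ebn_cst].
have mE : m = heatn gamma f t0 x0 - f x0 + ((M / 2 + e) * t0 + h * sqdist x1 x0).
  by rewrite /m /W/= -expr2 /heatn st0.
have hl := hM x0.
have := hT t tT.
have p1 : t / 2 * - M <= t / 2 * laplacianRn f x0 by rewrite ler_wpM2l// divr_ge0// ltW.
have p2 : h * n%:R * t <= e / 2 * t by rewrite ler_wpM2r// ltW.
have p3 : 0 < e * t by rewrite mulr_gt0.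
(* Of the surplus [e * t], the estimate [heat_small] uses a quarter and the penalty at most half;
   the rest contradicts minimality. *)
move: int p1 p2 p3; rewrite mE.
move: (heatn _ _ _ _) (heatn _ _ _ _) (sqdist _ _) (laplacianRn _ _) (f x0) => H1 H2 q l F0.
clear; lra.
Qed.

End heat_max.

(** * The bound on the Fisher information *)

Section scaling.
Context {R : realType} {n : nat}.
Variable gamma : probability (borelRn R n) R.
Hypothesis gg : is_std_gaussian gamma.
Local Notation E f := (\int[gamma]_x f x).
Implicit Types (x y z w : 'rV[R]_n).
Variables (f h : 'rV[R]_n -> R) (L : R).
Hypotheses (L0 : 0 <= L) (fL : lipn L f) (hL : lipn L h).
Hypothesis f1 : \int[gamma]_x expR (f x) = 1.
Hypothesis fh : forall a z (r : R), 0 <= r -> f (a + r *: z) <= f a + r * h z.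

Let ef := lipn_ebn L0 fL.
Let eef := lipn_expR_ebn L0 fL.

Let ebnE (F : 'rV[R]_n -> R) : ebn F -> ebn (fun x => F x * expR (f x)).
Proof. by move=> eF; apply: ebnM. Qed.

Lemma lipn_scale (s : R) : 0 <= s <= 1 -> lipn L (fun x => f (s *: x)).
Proof.
move=> /andP[s0 s1] x y; apply: le_trans (fL _ _) _.
by rewrite -scalerBr l1Z ger0_norm// ler_wpM2l// ler_piMl// l1_ge0.
Qed.

(** The normalisation [f1] makes the left side of [log_mean_exp_bound] vanish. The remaining
    logarithm is at most its argument minus one, and the difference [a] of [g] and [f] has order
    [1 - s], so the exponential can be linearised around [f]. *)
Lemma scaling_bound : exists2 C, 0 <= C & forall s : R, 2^-1 <= s < 1 ->
  \int[gamma]_x ((f x - f (s *: x)) * expR (f x)) <=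
  (1 - s ^+ 2) * \int[gamma]_x (f x * expR (f x)) + (1 - s) * E h + (1 - s) ^+ 2 * C.
Proof.
(* Since [s] is at least one half, [(s ^+ 2)^-1] is at most 4. It multiplies [L * l1 x] from the
   scaling and twice the bound of [f x] by its value at 0 and [L * l1 x]. *)
pose K := 12 * L + 8 * `|f 0|.
have K0 : 0 <= K by rewrite addr_ge0// mulr_ge0.
pose G x := (K + K * l1 x) ^+ 2 * expR (K + K * l1 x).
have eKl : ebn (fun x => K + K * l1 x).
  by apply: ebnD; [exact: ebn_cst|apply: ebnZ; exact: ebn_l1].
have eG : ebn G.
  apply: ebnM; first exact: ebnX.
  apply: (@lipn_expR_ebn _ _ K _ K0) => x y.
  rewrite opprD addrACA subrr add0r -mulrBr normrM ger0_norm// ler_wpM2l//.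
  by have := lipn_l1 x y; rewrite mul1r.
have G0 x : 0 <= G x by rewrite mulr_ge0 ?sqr_ge0 ?expR_ge0.
exists (\int[gamma]_x (G x * expR (f x))).
  by rewrite Rintegral_ge0// => x _; rewrite mulr_ge0 ?expR_ge0.
move=> s /andP[sh s1].
have s0 : 0 < s by apply: lt_le_trans sh; rewrite invr_gt0.
have s20 : 0 < s ^+ 2 by rewrite exprn_gt0.
have s24 : (s ^+ 2)^-1 <= 4.
  rewrite -[leRHS]invrK lef_pV2 ?posrE ?invr_gt0//.
  have -> : 4^-1 = (2^-1) ^+ 2 :> R by field.
  by apply: lerXn2r; rewrite ?nnegrE ?invr_ge0// ltW.
have fs := lipn_scale (ltac:(by rewrite !ltW) : 0 <= s <= 1).
have efs := lipn_ebn L0 fs.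
have s2i : 1 <= (s ^+ 2)^-1 by rewrite invf_ge1// exprn_ile1// ltW.
pose g x := (s ^+ 2)^-1 * f (s *: x).
have L'0 : 0 <= (s ^+ 2)^-1 * L by rewrite mulr_ge0// invr_ge0 ltW.
have LL' : L <= (s ^+ 2)^-1 * L by rewrite ler_peMl.
have gL : lipn ((s ^+ 2)^-1 * L) g.
  move=> x y; rewrite /g -mulrBr normrM ger0_norm ?invr_ge0 ?(ltW s20)// -mulrA.
  by rewrite ler_wpM2l ?invr_ge0 ?(ltW s20).
have hL' : lipn ((s ^+ 2)^-1 * L) (fun z => (1 - s) * h z).
  move=> x y; rewrite -mulrBr normrM; apply: le_trans (lipn_le LL' hL x y).
  by rewrite ler_piMl// ger0_norm; lra.
have := log_mean_exp_bound gg L'0 s0 s1 (lipn_le LL' fL) gL hL'.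
move=> /(_ _)/wrap[].
  move=> y z; rewrite /g mulrA divff ?gt_eqF// mul1r; apply: fh; lra.
rewrite f1 ln1.
have eh := lipn_ebn L0 hL.
rewrite (EnZ gg _ eh) => key.
have eg := lipn_expR_ebn L'0 gL.
have Eg0 : 0 < \int[gamma]_x expR (g x) by apply: (En_gt0 gg eg) => x; exact: expR_gt0.
have lnle : ln (\int[gamma]_x expR (g x)) <= \int[gamma]_x expR (g x) - 1.
  have := @le_ln1Dx _ (\int[gamma]_x expR (g x) - 1).
  have -> : 1 + (\int[gamma]_x expR (g x) - 1) = \int[gamma]_x expR (g x) by ring.
  by move=> /(_ _)/wrap[]; first lra.
pose a x := g x - f x.
have aE x : s ^+ 2 * a x = (f (s *: x) - f x) + (1 - s ^+ 2) * f x.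
  by rewrite /a /g; field; rewrite gt_eqF.
have a_le x : `|a x| <= (1 - s) * (K + K * l1 x).
  have l0 := l1_ge0 x.
  have q1 : `|f (s *: x) - f x| <= (1 - s) * (L * l1 x).
    rewrite distrC; apply: le_trans (fL _ _) _.
    rewrite -[X in l1 (X - _)]scale1r -scalerBl l1Z ger0_norm; last lra.
    by rewrite mulrCA.
  have q2 : `|f x| <= `|f 0| + L * l1 x.
    rewrite -[f x](subrK (f 0)) addrC (le_trans (ler_normD _ _))// lerD2l.
    by have := fL x 0; rewrite subr0.
  have q3 : `|(1 - s ^+ 2) * f x| <= (1 - s) * (2 * (`|f 0| + L * l1 x)).
    rewrite normrM ger0_norm; last by rewrite subr_ge0 exprn_ile1// ltW.
    have -> : 1 - s ^+ 2 = (1 - s) * (1 + s) by ring.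
    rewrite -mulrA ler_wpM2l ?subr_ge0 ?(ltW s1)//.
    by rewrite ler_pM//; lra.
  have -> : a x = (s ^+ 2)^-1 * (s ^+ 2 * a x) by rewrite mulKf// gt_eqF.
  rewrite aE normrM ger0_norm ?invr_ge0 ?(ltW s20)//.
  apply: (@le_trans _ _ (4 * ((1 - s) * (L * l1 x) + (1 - s) * (2 * (`|f 0| + L * l1 x))))).
    rewrite ler_pM ?invr_ge0 ?(ltW s20)// (le_trans (ler_normD _ _))// lerD//.
  rewrite -mulrDr mulrCA ler_wpM2l ?subr_ge0 ?(ltW s1)//.
  have := mulr_ge0 (normr_ge0 (f 0)) l0; have := normr_ge0 (f 0).
  have := mulr_ge0 L0 l0; have := L0; rewrite /K; lra.
have ea : ebn a.
  by apply: ebnB => //; exact: ebnZ.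
have eae := ebnE ea; have eGe := ebnE eG.
have Egle : \int[gamma]_x expR (g x) - 1 <=
    \int[gamma]_x (a x * expR (f x)) + (1 - s) ^+ 2 * \int[gamma]_x (G x * expR (f x)).
  rewrite -[X in _ - X]f1 -(EnB gg)// -(EnZ gg)// -(EnD gg)//; last exact: ebnZ.
  apply: (le_En gg); [exact: ebnB|by apply: ebnD => //; exact: ebnZ|].
  move=> x.
  have -> : expR (g x) - expR (f x) = (expR (a x) - 1) * expR (f x).
    by rewrite mulrBl mul1r -expRD /a subrK.
  rewrite [_ ^+ 2 * _]mulrA -mulrDl ler_wpM2r ?expR_ge0//.
  have t1 := expR_taylor1 (a x).
  have t2 := ler_norm (expR (a x) - 1 - a x).
  have kl : 0 <= K + K * l1 x by rewrite addr_ge0// mulr_ge0// l1_ge0.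
  have t3 : a x ^+ 2 * expR `|a x| <= (1 - s) ^+ 2 * G x.
    rewrite /G mulrA ler_pM ?sqr_ge0 ?expR_ge0//.
      rewrite -exprMn -[a x ^+ 2]real_normK ?num_real//.
      by rewrite lerXn2r ?nnegrE// mulr_ge0// subr_ge0 ltW.
    rewrite ler_expR (le_trans (a_le x))// ler_piMl//; lra.
  by move: t1 t2 t3; lra.
have Ea : s ^+ 2 * \int[gamma]_x (a x * expR (f x)) =
   - (\int[gamma]_x ((f x - f (s *: x)) * expR (f x))) +
   (1 - s ^+ 2) * \int[gamma]_x (f x * expR (f x)).
  have e1 : ebn (fun x => (f x - f (s *: x)) * expR (f x)) by apply: ebnE; exact: ebnB.
  have e2 : ebn (fun x => f x * expR (f x)) by exact: ebnE.
  rewrite -(EnZ gg)// -(EnZ gg)// -mulN1r -(EnZ gg)// -(EnD gg); [|exact: ebnZ|exact: ebnZ].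
  apply: eq_Rintegral => x _; rewrite [LHS]mulrA (aE x); ring.
have C0 : 0 <= \int[gamma]_x (G x * expR (f x)).
  by rewrite Rintegral_ge0// => x _; rewrite mulr_ge0 ?expR_ge0.
have r1 := ler_wpM2l (ltW s20) (le_trans lnle Egle).
have r2 : s ^+ 2 * ((1 - s) ^+ 2 * \int[gamma]_x (G x * expR (f x))) <=
   (1 - s) ^+ 2 * \int[gamma]_x (G x * expR (f x)).
  have s2le : s ^+ 2 <= 1 by rewrite exprn_ile1// ltW.
  by rewrite -[leRHS]mul1r ler_wpM2r// mulr_ge0// sqr_ge0.
rewrite mulrDr Ea in r1.
by move: key r1 r2; lra.
Qed.

End scaling.

Section exchange_bound.
Context {R : realType} {n : nat}.
Variable gamma : probability (borelRn R n) R.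
Hypothesis gg : is_std_gaussian gamma.
Local Notation V := (borelRn R n).
Local Notation g2 := (gamma \x gamma)%E.
Implicit Types (x y z w : 'rV[R]_n).
Variables (f : 'rV[R]_n -> R) (L M : R).
Hypotheses (L0 : 0 <= L) (M0 : 0 <= M) (fL : lipn L f).
Hypothesis df : twice_differentiable f.
Hypothesis hM : forall y, - M <= laplacianRn f y.
Hypothesis f1 : \int[gamma]_x expR (f x) = 1.

Let ef := lipn_ebn L0 fL.
Let eef := lipn_expR_ebn L0 fL.

Definition gauss_rot (s c : R) (p : V * V) : 'rV[R]_n := s *: (p.1 : 'rV[R]_n) + c *: (p.2 : 'rV[R]_n).

Lemma exchange_bound (s c : R) : 0 <= s <= 1 -> 0 < c -> s ^+ 2 + c ^+ 2 = 1 ->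
  \int[g2]_p ((f (gauss_rot s c p) - f p.1) * (expR (f (gauss_rot s c p)) - expR (f p.1))) <=
  M * c ^+ 2 + 2 * \int[gamma]_x ((f x - f (s *: x)) * expR (f x)).
Proof.
move=> s01 c0 sc1.
have a1 : eb2 (fun p => f (gauss_rot s c p)) := eb2_lin s c ef.
have a2 : eb2 (fun p : V * V => f p.1) := eb2_fst ef.
have b1 : eb2 (fun p => expR (f (gauss_rot s c p))) := eb2_lin s c eef.
have b2 : eb2 (fun p : V * V => expR (f p.1)) := eb2_fst eef.
pose F (p : V * V) := (f p.2 - f p.1) * expR (f p.1).
have mF : measurable_fun setT F.
  have m1 := measurableT_comp (proj1 ef) (@measurable_fst _ _ V V).
  have m2 := measurableT_comp (proj1 ef) (@measurable_snd _ _ V V).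
  have m3 := measurableT_comp (proj1 eef) (@measurable_fst _ _ V V).
  exact: (measurable_funM (measurable_funB m2 m1) m3).
have e1 : eb2 (fun p => F (p.1, s *: (p.1 : 'rV[R]_n) + c *: (p.2 : 'rV[R]_n))).
  exact: (eb2M (eb2B a1 a2) b2).
have e2 : eb2 (fun p => F (s *: (p.1 : 'rV[R]_n) + c *: (p.2 : 'rV[R]_n), p.1)).
  exact: (eb2M (eb2B a2 a1) b1).
have X := E2_exchange gg c0 sc1 mF e1 e2.
have QE : \int[g2]_p ((f (gauss_rot s c p) - f p.1) * (expR (f (gauss_rot s c p)) - expR (f p.1))) =
   - 2 * \int[g2]_p F (p.1, s *: (p.1 : 'rV[R]_n) + c *: (p.2 : 'rV[R]_n)).
  have -> : - 2 * \int[g2]_p F (p.1, s *: (p.1 : 'rV[R]_n) + c *: (p.2 : 'rV[R]_n)) =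
      -1 * \int[g2]_p F (p.1, s *: (p.1 : 'rV[R]_n) + c *: (p.2 : 'rV[R]_n)) +
      -1 * \int[g2]_p F (s *: (p.1 : 'rV[R]_n) + c *: (p.2 : 'rV[R]_n), p.1) by rewrite -X; ring.
  rewrite -!(E2Z gg)//.
  rewrite -(E2D gg); [|exact: eb2Z|exact: eb2Z].
  apply: eq_Rintegral => p _; rewrite /F/= -/(gauss_rot s c p); ring.
have fs := lipn_scale L0 fL s01.
have efs := lipn_ebn L0 fs.
have lb : \int[gamma]_x ((f (s *: x) - M * c ^+ 2 / 2 - f x) * expR (f x)) <=
    \int[g2]_p F (p.1, s *: (p.1 : 'rV[R]_n) + c *: (p.2 : 'rV[R]_n)).
  rewrite (E2_fubini gg e1)/=.
  have ein x : \int[gamma]_z F (x, s *: x + c *: z) = (heatn gamma f (c ^+ 2) (s *: x) - f x) * expR (f x).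
    rewrite /F/= /heatn sqrtr_sqr gtr0_norm//.
    have eA := ebn_affine (s *: x) c ef.
    rewrite -[X in (_ - X) * _](En_cst gamma) -(EnB gg)//; last exact: ebn_cst.
    rewrite [RHS]mulrC -(EnZ gg); last by apply: ebnB => //; exact: ebn_cst.
    by apply: eq_Rintegral => z _; rewrite mulrC.
  have eq1 : \int[gamma]_x \int[gamma]_z F (x, s *: (x : 'rV[R]_n) + c *: z) =
      \int[gamma]_x ((heatn gamma f (c ^+ 2) (s *: x) - f x) * expR (f x)).
    by apply: eq_Rintegral => x _; exact: ein.
  rewrite eq1.
  have lh : lipn L (fun x => heatn gamma f (c ^+ 2) (s *: x)).
    move=> x y; have := Pf_lip gg (Num.sqrt (c ^+ 2)) (Num.sqrt (c ^+ 2)) (s *: x) (s *: y) L0 fL.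
    rewrite subrr normr0 mulr0 addr0 => /le_trans; apply.
    rewrite -scalerBr l1Z; case/andP: s01 => s0 s1.
    by rewrite [`|s|]ger0_norm// ler_wpM2l// ler_piMl// l1_ge0.
  have elh := lipn_ebn L0 lh.
  apply: (le_En gg).
  - exact: (ebnM (ebnB (ebnB efs (ebn_cst _)) ef) eef).
  - exact: (ebnM (ebnB elh ef) eef).
  move=> x; rewrite ler_wpM2r ?expR_ge0// lerD2r.
  by apply: (heat_max gg _ L0 M0 fL df hM); rewrite exprn_gt0.
have split : \int[gamma]_x ((f (s *: x) - M * c ^+ 2 / 2 - f x) * expR (f x)) =
   - (\int[gamma]_x ((f x - f (s *: x)) * expR (f x))) - M * c ^+ 2 / 2.
  have e3 : ebn (fun x => (f x - f (s *: x)) * expR (f x)).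
    exact: (ebnM (ebnB ef efs) eef).
  transitivity (-1 * (\int[gamma]_x ((f x - f (s *: x)) * expR (f x))) -
      M * c ^+ 2 / 2 * \int[gamma]_x expR (f x)); last by rewrite f1; ring.
  rewrite -!(EnZ gg)// -(EnB gg); [|exact: ebnZ|exact: ebnZ].
  by apply: eq_Rintegral => x _; ring.
by rewrite QE; rewrite split in lb; lra.
Qed.

End exchange_bound.

(** * Difference quotients and their limits *)

Section difference_quotient.
Context {R : realType} {n : nat}.
Implicit Types (x y z w : 'rV[R]_n).

(** The lower bound is still nonnegative, as Fatou's lemma requires, and after division by the
    squared step its limit involves only the difference quotient [b - a]. *)
Lemma mul_expRB_ge (a b : R) : (b - a) ^+ 2 * expR (- `|b - a|) * expR a <= (b - a) * (expR b - expR a).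
Proof.
have -> : expR b - expR a = (expR (b - a) - 1) * expR a by rewrite mulrBl mul1r -expRD subrK.
rewrite mulrA ler_wpM2r ?expR_ge0//; move: (b - a) => d.
have [d0|d0] := leP 0 d.
  have := expR_ge1Dx d; rewrite ger0_norm// => h1.
  have : expR (- d) <= 1 by rewrite -[leRHS]expR0 ler_expR oppr_le0.
  by have := expR_gt0 (- d); nra.
rewrite ltr0_norm// opprK.
have h1 := expR_ge1Dx (- d).
have h2 : expR d * (1 - d) <= 1.
  by rewrite -[leRHS](expR0) -(subrr d) expRD ler_wpM2l ?expR_ge0.
have := expR_gt0 d; nra.
Qed.

(** The direction must vary: [s *: x + c *: z] is [x] moved by [c] in direction
    [z + ((s - 1) / c) *: x], which differs from [z] by at most [c * l1 x]. *)
Lemma difference_quotient_cvg (f : 'rV[R]_n -> R) x (w : nat -> 'rV[R]_n) z (u : nat -> R) :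
  differentiable f x -> (forall m, 0 < u m) -> u @ \oo --> 0 ->
  (forall m, l1 (w m - z) <= u m * l1 x) ->
  (fun m => (f (x + u m *: w m) - f x) / u m) @ \oo --> \sum_i z ord0 i * 'D_(eRn R i) f x.
Proof.
move=> dfx u0 ucv wz.
apply/cvgrPdist_le => e e0.
pose A := l1 z + l1 x + 1.
have A0 : 0 < A by rewrite ltr_wpDl// addr_ge0// l1_ge0.
have e2 : 0 < e / (2 * A) by rewrite divr_gt0// mulr_gt0.
have [d d0 hd] := diff_eps dfx e2.
pose G := \sum_i `|'D_(eRn R i) f x|.
have G0 : 0 <= G by exact: sumr_ge0.
pose B := 2 * (G * l1 x + 1).
have B0 : 0 < B by rewrite mulr_gt0// ltr_wpDl// mulr_ge0// l1_ge0.
near=> m.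
have um := u0 m.
have u1 : u m <= 1.
  near: m; have /cvgrPdist_le/(_ 1 ltr01) := ucv; apply: filterS => m.
  by rewrite sub0r normrN => /(le_trans (ler_norm _)).
have ud : u m < d / A.
  near: m; have /cvgrPdist_lt/(_ (d / A)) := ucv; move=> /(_ (divr_gt0 d0 A0)); apply: filterS => m.
  by rewrite sub0r normrN => /(le_lt_trans (ler_norm _)).
have ue : u m <= e / B.
  near: m; have /cvgrPdist_le/(_ (e / B)) := ucv; move=> /(_ (divr_gt0 e0 B0)); apply: filterS => m.
  by rewrite sub0r normrN => /(le_trans (ler_norm _)).
have wA : l1 (w m) <= A.
  have := l1D (w m - z) z; rewrite subrK => /le_trans; apply.
  rewrite /A addrC -addrA lerD2l (le_trans (wz m))//.
  have := l1_ge0 x; nra.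
have wd : `|u m *: w m| < d.
  rewrite normrZ gtr0_norm//; apply: (@le_lt_trans _ _ (u m * A)).
    by rewrite ler_wpM2l ?(ltW um)// (le_trans (mx_norm_l1 _)).
  by rewrite -ltr_pdivlMr.
have h1 := hd _ wd.
pose g (v : 'rV[R]_n) := \sum_i v ord0 i * 'D_(eRn R i) f x.
have gZ (a : R) v : g (a *: v) = a * g v.
  by rewrite /g mulr_sumr; apply: eq_bigr => i _; rewrite mxE mulrA.
have gB v v' : g v - g v' = g (v - v').
  by rewrite /g -sumrB; apply: eq_bigr => i _; rewrite !mxE mulrBl.
have gle v : `|g v| <= G * l1 v.
  rewrite (le_trans (ler_norm_sum _ _ _))// mulr_suml; apply: ler_sum => i _.
  by rewrite normrM mulrC ler_wpM2l// l1_coord.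
rewrite -/(g (u m *: w m)) gZ in h1; rewrite -/(g z).
have q1 : `|(f (x + u m *: w m) - f x) / u m - g (w m)| <= e / 2.
  have -> : (f (x + u m *: w m) - f x) / u m - g (w m) =
      (f (x + u m *: w m) - f x - u m * g (w m)) / u m by field; rewrite gt_eqF.
  rewrite normrM normfV [`|u m|]gtr0_norm// ler_pdivrMr//; apply: (le_trans h1).
  rewrite normrZ gtr0_norm// mulrCA mulrC ler_wpM2r ?(ltW um)//.
  have -> : e / 2 = e / (2 * A) * A by field; rewrite gt_eqF.
  by rewrite ler_wpM2l ?(ltW e2)// (le_trans (mx_norm_l1 _)).
have q2 : `|g (w m) - g z| <= e / 2.
  rewrite gB; apply: le_trans (gle _) _.
  apply: (@le_trans _ _ (G * (u m * l1 x))); first by rewrite ler_wpM2l.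
  have -> : G * (u m * l1 x) = u m * (G * l1 x) by ring.
  have c1 : 0 <= G * l1 x by rewrite mulr_ge0// l1_ge0.
  apply: (@le_trans _ _ (u m * (B / 2))).
    by rewrite ler_wpM2l ?(ltW um)// /B; lra.
  rewrite mulrA ler_wpM2r ?invr_ge0// -ler_pdivlMr//.
rewrite distrC.
have -> : (f (x + u m *: w m) - f x) / u m - g z =
   ((f (x + u m *: w m) - f x) / u m - g (w m)) + (g (w m) - g z) by ring.
apply: le_trans (ler_normD _ _) _.
by rewrite [e in leRHS]splitr lerD.
Unshelve. all: by end_near. Qed.

End difference_quotient.

Section fatou_cvg.
Context d (T : measurableType d) (R : realType).
Variable mu : {measure set T -> \bar R}.

Lemma fatou_cvg (F : (T -> R)^nat) (G : T -> R) (b : R^nat) (l : R) :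
  (forall m, measurable_fun setT (F m)) -> (forall m x, 0 <= F m x) ->
  (forall x, F ^~ x @ \oo --> G x) ->
  (forall m, (\int[mu]_x (F m x)%:E <= (b m)%:E)%E) -> b @ \oo --> l ->
  (\int[mu]_x (G x)%:E <= l%:E)%E.
Proof.
move=> mF F0 FG Fb bl.
have := @fatou _ _ _ mu setT measurableT (fun m x => (F m x)%:E).
move=> /(_ (fun m => (measurable_EFinP _ _).2 (mF m))).
have F0' m x : setT x -> (0 <= (F m x)%:E)%E by rewrite lee_fin.
move=> /(_ F0'); under eq_integral => x _.
  have h : (fun m => (F m x)%:E) @ \oo --> (G x)%:E.
    by apply: cvg_EFin; [near=> m|exact: FG].
  rewrite (cvg_limn_einf_sup h).1; over.
move=> /le_trans; apply; rewrite limn_einf_lim.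
have bl' : (fun m => (b m)%:E) @ \oo --> l%:E by apply: cvg_EFin; [near=> m|exact: bl].
rewrite -(cvg_lim (@ereal_hausdorff R) bl').
apply: lee_lim; [exact: is_cvg_einfs|by apply/cvg_ex; exists l%:E|].
near=> m; apply: le_trans (Fb m).
by apply: ereal_inf_lbound; exists m => //=.
Unshelve. all: by end_near. Qed.

End fatou_cvg.

Section lip_deriv.
Context {R : realType} {n : nat}.

Lemma lipn_deriv (f : 'rV[R]_n -> R) L x i : lipn L f -> differentiable f x ->
  `|'D_(eRn R i) f x| <= L.
Proof.
move=> fL dfx.
pose u (m : nat) : R := m.+1%:R^-1.
have u0 m : 0 < u m by rewrite invr_gt0.
have uc : u @ \oo --> 0 by exact: cvg_harmonic.
have := @difference_quotient_cvg _ _ f x (fun=> eRn R i) (eRn R i) u dfx u0 uc.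
rewrite (bigD1 i)//= big1 ?addr0; last first.
  by move=> j ji; rewrite mxE (negbTE ji) andbF mul0r.
rewrite !mxE !eqxx mul1r => /(_ _)/wrap[|h].
  by move=> m; rewrite subrr l1_0 mulr_ge0// ?l1_ge0// ltW.
have h2 : (fun m => `|(f (x + u m *: eRn R i) - f x) / u m|) @ \oo --> `|'D_(eRn R i) f x| by exact: cvg_norm.
rewrite -(cvg_lim (@Rhausdorff R) h2); apply: limr_le; first by apply/cvg_ex; exists `|'D_(eRn R i) f x|.
near=> m; rewrite normrM normfV [`|u m|]gtr0_norm// ler_pdivrMr//.
apply: le_trans (fL _ _) _.
by rewrite addrAC subrr add0r l1Z l1_e mulr1 gtr0_norm.
Unshelve. all: by end_near. Qed.

End lip_deriv.

Section fisher_bound.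
Context {R : realType} {n : nat}.
Variable gamma : probability (borelRn R n) R.
Hypothesis gg : is_std_gaussian gamma.
Local Notation E f := (\int[gamma]_x f x).
Local Notation V := (borelRn R n).
Local Notation g2 := (gamma \x gamma)%E.
Implicit Types (x y z w : 'rV[R]_n).
Variables (f h : 'rV[R]_n -> R) (L M : R).
Hypotheses (L0 : 0 <= L) (M0 : 0 <= M) (fL : lipn L f) (hL : lipn L h).
Hypothesis df : twice_differentiable f.
Hypothesis hM : forall y, - M <= laplacianRn f y.
Hypothesis f1 : \int[gamma]_x expR (f x) = 1.
Hypothesis fh : forall a z (r : R), 0 <= r -> f (a + r *: z) <= f a + r * h z.

Let ef := lipn_ebn L0 fL.
Let eef := lipn_expR_ebn L0 fL.
Let D i x := 'D_(eRn R i) f x.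

Lemma ebn_deriv i : ebn (D i).
Proof.
apply: (ebd_le _ (ebn_cst L)).
  by apply: continuous_borelRn => x; apply: differentiable_continuous; exact: df.2.
by move=> x; rewrite [`|L|]ger0_norm//; apply: lipn_deriv => //; exact: df.1.
Qed.

Let G (p : V * V) : R := (\sum_i (p.2 : 'rV[R]_n) ord0 i * D i p.1) ^+ 2 * expR (f p.1).

Lemma eb2_G : eb2 G.
Proof.
apply: eb2M; last exact: (eb2_fst eef).
apply: ebdX; first by move=> p; exact: w2_ge0.
elim: (index_enum _) => [|i r ih].
  under eq_fun do rewrite big_nil; by apply: ebd_cst => p; exact: w2_ge0.
under eq_fun do rewrite big_cons; apply: eb2D => //.
apply: eb2M; last exact: (eb2_fst (ebn_deriv i)).
have := eb2_lin 0 1 (@ebn_coord R n i).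
by congr eb2; apply/funext => p; rewrite scale0r scale1r add0r.
Qed.

(** For fixed [x] the squared directional derivative is a quadratic form in [z], whose Gaussian mean
    is the squared gradient. *)
Lemma E2_G : \int[g2]_p G p = \int[gamma]_x ((\sum_i (D i x) ^+ 2) * expR (f x)).
Proof.
rewrite (E2_fubini gg eb2_G); apply: eq_Rintegral => x _; rewrite /G/=.
have eij i j : ebn (fun z : 'rV[R]_n => (D i x * D j x * expR (f x)) * (z ord0 i * z ord0 j)).
  by apply: ebnZ; apply: ebnM; exact: ebn_coord.
transitivity (\int[gamma]_z (\sum_i \sum_j (D i x * D j x * expR (f x)) * (z ord0 i * z ord0 j))).
  apply: eq_Rintegral => z _; rewrite expr2 mulr_suml mulr_suml; apply: eq_bigr => i _.
  by rewrite mulr_sumr mulr_suml; apply: eq_bigr => j _; ring.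
rewrite (En_sum gg); last by move=> i; exact: ebn_sum.
rewrite mulr_suml; apply: eq_bigr => i _.
rewrite (En_sum gg)// (bigD1 i)//= big1 ?addr0.
  by rewrite (EnZ gg) ?(En_coordM gg) ?eqxx ?mulr1 -?expr2//; apply: ebnM; exact: ebn_coord.
move=> j ji; rewrite (EnZ gg) ?(En_coordM gg) 1?eq_sym ?(negbTE ji) ?mulr0//.
by apply: ebnM; exact: ebn_coord.
Qed.

Lemma fisher_le_width_entropy :
  \int[gamma]_x ((\sum_i (D i x) ^+ 2) * expR (f x)) <=
  M + E h + 2 * \int[gamma]_x (f x * expR (f x)).
Proof.
have [C C0 sb] := scaling_bound gg L0 fL hL f1 fh.
pose K := \int[gamma]_x (f x * expR (f x)).
pose A := M + E h + 2 * K.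
pose A' := `|E h| + 2 * C.
have A'0 : 0 <= A' by rewrite addr_ge0// mulr_ge0.
(* Starting at one half keeps [s m] above one half, as [scaling_bound] requires. *)
pose c (m : nat) : R := m.+2%:R^-1.
pose s (m : nat) : R := Num.sqrt (1 - c m ^+ 2).
have c0 m : 0 < c m by rewrite invr_gt0.
have c12 m : c m <= 2^-1 by rewrite lef_pV2 ?posrE// ler_nat.
have cc0 : c @ \oo --> 0.
  have := @cvg_harmonic R; rewrite -(cvg_shiftS (@harmonic R)); exact.
have c2 m : c m ^+ 2 <= 4^-1.
  by have := c0 m; have := c12 m; move: (c m) => r h1 h2; rewrite expr2; nra.
have s0 m : 0 <= s m by exact: sqrtr_ge0.
have s2 m : s m ^+ 2 = 1 - c m ^+ 2.
  by rewrite sqr_sqrtr//; have := c2 m; lra.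
have s1 m : s m < 1.
  have := s2 m; have := s0 m; have : 0 < c m ^+ 2 by rewrite exprn_gt0.
  by move: (s m) (c m ^+ 2) => r t h1 h2; rewrite expr2 => h3; nra.
have s12 m : 2^-1 <= s m.
  have := s2 m; have := s0 m; have := c2 m.
  by move: (s m) (c m ^+ 2) => r t h1 h2; rewrite expr2 => h3; nra.
have s1c m : 1 - s m <= c m ^+ 2.
  have := s2 m; have := s0 m; have := s1 m.
  by move: (s m) (c m ^+ 2) => r t h1 h2; rewrite expr2 => h3; nra.
have sc1 m : s m ^+ 2 + c m ^+ 2 = 1 by rewrite s2 subrK.
pose d m (p : V * V) := f (gauss_rot (s m) (c m) p) - f p.1.
pose F m (p : V * V) := (d m p / c m) ^+ 2 * expR (- `|d m p|) * expR (f p.1).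
pose Q m (p : V * V) := d m p * (expR (f (gauss_rot (s m) (c m) p)) - expR (f p.1)).
have ed m : eb2 (d m) by apply: eb2B; [exact: (eb2_lin _ _ ef)|exact: (eb2_fst ef)].
have eQ m : eb2 (Q m).
  by apply: eb2M => //; apply: eb2B; [exact: (eb2_lin _ _ eef)|exact: (eb2_fst eef)].
have FQ m p : F m p <= (c m ^+ 2)^-1 * Q m p.
  have -> : F m p = (c m ^+ 2)^-1 * (d m p ^+ 2 * expR (- `|d m p|) * expR (f p.1)).
    by rewrite /F expr_div_n; ring.
  by rewrite ler_wpM2l ?invr_ge0 ?sqr_ge0//; exact: mul_expRB_ge.
have Qb m : (c m ^+ 2)^-1 * \int[g2]_p Q m p <= A + c m * A'.
  have t0 : 0 < c m ^+ 2 by rewrite exprn_gt0.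
  rewrite mulrC ler_pdivrMr//.
  have sm01 : 0 <= s m <= 1 by rewrite s0 ltW.
  apply: le_trans (exchange_bound gg L0 M0 fL df hM f1 sm01 (c0 m) (sc1 m)) _.
  have sm12 : 2^-1 <= s m < 1 by rewrite s12 s1.
  have := sb _ sm12; rewrite s2 subKr -/K.
  move: (\int[gamma]_x ((f x - f (s m *: x)) * expR (f x))) => S; rewrite /A /A'.
  have := ler_norm (E h); have := normr_ge0 (E h).
  have := s1c m; have := s1 m; have := s2 m; have := s12 m; have := c12 m; have := c0 m; have := C0.
  move: (E h) `|E h| (s m) (c m) => e e' r q; clear.
  have [u ->] : exists u, r = 1 - u by exists (1 - r); ring.
  rewrite expr2 => C0 q0 q1 r2 qE r1 uq e0 ee Sb.
  (* With [u] equal to [1 - s], twice [u] exceeds [c ^+ 2] by [u ^+ 2] only, which is at most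
     [c ^+ 3]. So the width enters with coefficient one in the limit, and the other errors vanish
     like [c]. *)
  have qE' : q ^+ 2 = u * (2 - u) by lra.
  have u0 : 0 <= u by lra.
  have uq2 : u ^+ 2 <= q * q ^+ 2.
    have h1 : u * u <= q ^+ 2 * u by rewrite ler_wpM2r; lra.
    have h2 : u * q ^+ 2 <= q * q ^+ 2 by rewrite ler_wpM2r ?sqr_ge0//; nra.
    by rewrite expr2; lra.
  have k1 : 2 * (u * e) - e * q ^+ 2 <= u ^+ 2 * e'.
    have -> : 2 * (u * e) - e * q ^+ 2 = u ^+ 2 * e by rewrite qE'; ring.
    by rewrite ler_wpM2l ?sqr_ge0.
  have k2 : u ^+ 2 * (e' + 2 * C) <= q * q ^+ 2 * (e' + 2 * C) by rewrite ler_wpM2r//; lra.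
  have u2 : 1 - (1 - u) = u by ring.
  rewrite u2 in Sb.
  lra.
have Fcvg p : F ^~ p @ \oo --> G p.
  have dq : (fun m => d m p / c m) @ \oo --> \sum_i (p.2 : 'rV[R]_n) ord0 i * D i p.1.
    pose w m : 'rV[R]_n := (p.2 : 'rV[R]_n) + ((s m - 1) / c m) *: (p.1 : 'rV[R]_n).
    rewrite (_ : (fun m => d m p / c m) =
        (fun m => (f ((p.1 : 'rV[R]_n) + c m *: w m) - f p.1) / c m)); last first.
      apply/funext => m; congr (_ / _); rewrite /d /gauss_rot /w; congr (f _ - _).
      rewrite scalerDr scalerA mulrC divfK ?gt_eqF// scalerBl scale1r.
      by rewrite [RHS]addrCA [X in _ = _ + X]addrC subrK addrC.
    have := @difference_quotient_cvg _ _ f p.1 w p.2 c (df.1 _) c0 cc0.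
    move=> /(_ _)/wrap[m|//].
      rewrite /w addrAC subrr add0r l1Z ler_wpM2r ?l1_ge0// normrM normfV [`|c m|]gtr0_norm//.
      by rewrite distrC ger0_norm ?subr_ge0 ?(ltW (s1 m))// ler_pdivrMr// -expr2.
  have d0 : d^~ p @ \oo --> 0.
    rewrite (_ : d^~ p = (fun m => d m p / c m * c m)); last first.
      by apply/funext => m /=; rewrite divfK ?gt_eqF.
    by rewrite -[X in _ --> X](mulr0 (\sum_i (p.2 : 'rV[R]_n) ord0 i * D i p.1)); apply: cvgM.
  have e1 : (fun m => expR (- `|d m p|)) @ \oo --> expR (- `|0 : R|).
    apply: (@continuous_cvg _ _ _ _ _ _ (fun x : R => expR x)); first exact: continuous_expR.
    by apply: cvgN; exact: cvg_norm.
  rewrite normr0 oppr0 expR0 in e1.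
  rewrite /G -[X in X * _]mulr1.
  apply: cvgM; last exact: cvg_cst.
  by apply: cvgM => //; rewrite expr2; apply: cvgM.
have mF m : measurable_fun setT (F m).
  apply: measurable_funM; last exact: (proj1 (eb2_fst eef)).
  apply: measurable_funM.
    by apply: measurable_funX; apply: measurable_funM => //; exact: (proj1 (ed m)).
  apply: measurableT_comp => //; apply: measurableT_comp => //; apply: measurableT_comp => //.
  exact: (proj1 (ed m)).
have F0 m p : 0 <= F m p by rewrite mulr_ge0 ?expR_ge0// mulr_ge0 ?expR_ge0 ?sqr_ge0.
have := @fatou_cvg _ _ R g2 F G (fun m => A + c m * A') A mF F0 Fcvg.
rewrite -(eb2_fin gg eb2_G) lee_fin E2_G; apply.
  move=> m; apply: (@le_trans _ _ (((c m ^+ 2)^-1 * \int[g2]_p Q m p)%:E)); last by rewrite lee_fin.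
  rewrite -(E2Z gg)// (eb2_fin gg); last exact: eb2Z.
  apply: ge0_le_integral => //.
  - by move=> p _; rewrite lee_fin.
  - exact/measurable_EFinP.
  - by apply/measurable_EFinP; exact: (proj1 (eb2Z _ (eQ m))).
  - by move=> p _; rewrite lee_fin.
have : (fun m => A + c m * A') @ \oo --> A + 0 * A'.
  by apply: cvgD; [exact: cvg_cst|apply: cvgM => //; exact: cvg_cst].
by rewrite mul0r addr0.
Qed.

End fisher_bound.

(** The integral is that of the positive part minus that of the negative part, each monotone, so
    infinite values are allowed. This matters for the width and for [KL] before either is known to
    be finite. *)
Lemma le_integral_measurable d (T : measurableType d) (R : realType) (mu : {measure set T -> \bar R})
    (F G : T -> \bar R) : measurable_fun setT F -> measurable_fun setT G ->
  (forall x, F x <= G x)%E -> (\int[mu]_x F x <= \int[mu]_x G x)%E.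
Proof.
move=> mF mG FG; rewrite [leLHS]integralE [leRHS]integralE; apply: leeB.
  apply: ge0_le_integral => //; [exact: measurable_funepos|exact: measurable_funepos|].
  by move=> x _; apply: funepos_le => [y _|]; [exact: FG|rewrite inE].
apply: ge0_le_integral => //; [exact: measurable_funeneg|exact: measurable_funeneg|].
by move=> x _; apply: funeneg_le => [y _|]; [exact: FG|rewrite inE].
Qed.

(** * Finite Gaussian width *)

Section width.
Context {R : realType} {n : nat}.
Variable gamma : probability (borelRn R n) R.
Hypothesis gg : is_std_gaussian gamma.
Local Notation E f := (\int[gamma]_x f x).
Local Notation V := (borelRn R n).
Implicit Types (x y z w a b : 'rV[R]_n).

Lemma dotRnB a x y : dotRn a x - dotRn a y = dotRn a (x - y).
Proof. by rewrite -sumrB; apply: eq_bigr => i _; rewrite !mxE mulrBr. Qed.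

Lemma dotRn_le_l1 (L : R) a x : (forall i, `|a ord0 i| <= L) -> `|dotRn a x| <= L * l1 x.
Proof.
move=> aL; apply: le_trans (ler_norm_sum _ _ _) _; rewrite /l1 mulr_sumr.
by apply: ler_sum => i _; rewrite normrM ler_wpM2r.
Qed.

Lemma lipn_dotRn a : lipn (l1 a) (dotRn a).
Proof. by move=> x y; rewrite dotRnB; apply: dotRn_le_l1 => i; exact: l1_coord. Qed.

Lemma ebn_dotRn a : ebn (dotRn a).
Proof. exact: lipn_ebn (l1_ge0 a) (@lipn_dotRn a). Qed.

Lemma En_dotRn a : \int[gamma]_z dotRn a z = 0.
Proof.
rewrite (En_sum gg); last by move=> j; apply: ebnZ; exact: ebn_coord.
rewrite big1// => j _; rewrite (EnZ gg); last exact: ebn_coord.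
by rewrite (En_coord gg) mulr0.
Qed.

Variable K : set 'rV[R]_n.
Let H z : \bar R := ereal_sup [set (dotRn x z)%:E | x in K].

Lemma dotRn_le_sup x z : K x -> ((dotRn x z)%:E <= H z)%E.
Proof. by move=> Kx; apply: ereal_sup_ubound; exists x. Qed.

(** A strict superlevel set of the supremum is a union of open half-spaces, hence open even for
    uncountable [K]. *)
Lemma measurable_support_fun : measurable_fun setT (H : V -> \bar R).
Proof.
apply: (measurability _ (ErealGenOInfty.measurableE R)) => _ [_ [a ->] <-].
rewrite setTI.
have -> : H @^-1` `]a%:E, +oo[%classic = \bigcup_(x in K) (dotRn x @^-1` `]a, +oo[%classic).
  apply/seteqP; split => z /=; rewrite in_itv/= andbT.
    move=> /ereal_sup_gt[_ [x Kx <-]]; rewrite lte_fin => ax.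
    by exists x => //=; rewrite in_itv/= ax.
  move=> [x Kx]; rewrite /= in_itv/= andbT => ax.
  by apply: lt_le_trans (dotRn_le_sup z Kx); rewrite lte_fin.
apply: open_borelRn; apply: bigcup_open => x _.
have /continuousP := @lipn_continuous _ _ _ _ (@lipn_dotRn x); apply.
exact: interval_open.
Qed.

(* A bounded odd weight: averaging two elements of [K] with weights [(1 + k) / 2] and
   [(1 - k) / 2] at [k = k (z i)] gives a lower bound for the supremum over [K]. *)
Let k (r : R) := r * expR (- `|r|).

Lemma norm_k_le1 r : `|k r| <= 1.
Proof.
rewrite normrM [`|expR _|]ger0_norm ?expR_ge0// -ler_pdivlMr ?expR_gt0// expRN div1r invrK.
by have := expR_ge1Dx `|r|; lra.
Qed.

Lemma ebn_k i : ebn (fun z => k (z ord0 i)).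
Proof.
apply: ebnM; first exact: ebn_coord.
apply: (@ebd_expR _ V R l1 (@l1_ge0 R n) _ 0) => //; last first.
  by move=> z; rewrite mul0r addr0 oppr_le0.
apply: measurableT_comp => //; apply: measurableT_comp => //; exact: (proj1 (ebn_coord i)).
Qed.

(** The integrand vanishes on a hyperplane, so [ebd_E_gt0] does not apply. Instead [2 * r ^+ 2] is
    split by the arithmetic-geometric inequality between the weights [expR (- |r|)] and [expR |r|];
    the second moment is one, and [d] makes the second part less than one. *)
Lemma En_k_gt0 i : 0 < \int[gamma]_z (z ord0 i * k (z ord0 i)).
Proof.
pose B := \int[gamma]_z (z ord0 i ^+ 2 * expR `|z ord0 i|).
have eB : ebn (fun z => z ord0 i ^+ 2 * expR `|z ord0 i|).
  apply: ebnM; first by apply: ebnX; exact: ebn_coord.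
  apply: (@ebd_expR _ V R l1 (@l1_ge0 R n) _ 1) => //; last first.
    by move=> z; have := l1_coord z i; lra.
  apply: measurableT_comp => //; exact: (proj1 (ebn_coord i)).
have ek : ebn (fun z => z ord0 i * k (z ord0 i)).
  by apply: ebnM; [exact: ebn_coord|exact: ebn_k].
have B0 : 0 <= B by apply: Rintegral_ge0 => z _; rewrite mulr_ge0 ?expR_ge0 ?sqr_ge0.
pose d := (B + 1)^-1.
have d0 : 0 < d by rewrite invr_gt0; lra.
have : 2 * \int[gamma]_z (z ord0 i * z ord0 i) <=
   d^-1 * \int[gamma]_z (z ord0 i * k (z ord0 i)) + d * B.
  rewrite -!(EnZ gg)//; last by apply: ebnM; exact: ebn_coord.
  rewrite -(EnD gg); [|exact: ebnZ|exact: ebnZ].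
  apply: (le_En gg).
  - by apply: ebnZ; apply: ebnM; exact: ebn_coord.
  - by apply: ebnD; exact: ebnZ.
  move=> z; rewrite /k; move: (z ord0 i) => r.
  have [e e0 [-> ->]] : exists2 e : R, 0 < e & expR (- `|r|) = e^-1 ^+ 2 /\ expR `|r| = e ^+ 2.
    exists (expR (`|r| / 2)); first exact: expR_gt0.
    rewrite -expRN -!expRM_natl; split; congr expR; lra.
  rewrite -subr_ge0 (_ : _ - _ = d^-1 * (r * e^-1 - d * r * e) ^+ 2).
    by apply: mulr_ge0; [rewrite invr_ge0 ltW|exact: sqr_ge0].
  by field; rewrite !gt_eqF//; lra.
rewrite (En_coordM gg) eqxx mulr1 => h.
have dB : d * B < 1.
  by rewrite mulrC ltr_pdivrMr; lra.
have di : 0 < d^-1 by rewrite invr_gt0.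
by rewrite -(pmulr_rgt0 _ di); lra.
Qed.

Lemma En_coord_k i j : i != j -> \int[gamma]_z (z ord0 j * k (z ord0 i)) = 0.
Proof.
move=> ij.
rewrite (@En_resample_eq _ _ _ gg _ (fun=> 0) j) ?(En_cst gamma)//.
- by apply: ebnM; [exact: ebn_coord|exact: ebn_k].
- exact: ebn_cst.
move=> x; rewrite -[RHS](mulr0 (k (x ord0 i))) -[X in _ = _ * X](@E1_id R) -E1Z; last exact: eb1_id.
by apply: eq_Rintegral => r _; rewrite !updE eqxx (negbTE ij) mulrC.
Qed.

(** The width controls the extent of [K] in each coordinate. The average [phi] of two elements lies
    below the supremum, and its mean keeps only coordinate [i]: linear terms average out, and the
    weight depends on coordinate [i] alone. *)
Lemma width_ge x y i : K x -> K y ->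
  (((x ord0 i - y ord0 i) / 2 * \int[gamma]_z (z ord0 i * k (z ord0 i)))%:E
   <= gaussian_width gamma K)%E.
Proof.
move=> Kx Ky.
pose phi z := 2^-1 * (dotRn (x + y) z) + 2^-1 * (dotRn (x - y) z * k (z ord0 i)).
have e1 := ebn_dotRn (x + y).
have e2 : ebn (fun z => dotRn (x - y) z * k (z ord0 i)).
  by apply: ebnM; [exact: ebn_dotRn|exact: ebn_k].
have ephi : ebn phi by apply: ebnD; exact: ebnZ.
have <- : E phi = (x ord0 i - y ord0 i) / 2 * \int[gamma]_z (z ord0 i * k (z ord0 i)).
  rewrite (EnD gg); [|exact: ebnZ|exact: ebnZ].
  rewrite !(EnZ gg)// En_dotRn mulr0 add0r.
  have e3 j : ebn (fun z => (x - y) ord0 j * (z ord0 j * k (z ord0 i))).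
    by apply: ebnZ; apply: ebnM; [exact: ebn_coord|exact: ebn_k].
  transitivity (2^-1 * \int[gamma]_z \sum_j (x - y) ord0 j * (z ord0 j * k (z ord0 i))).
    congr (_ * _); apply: eq_Rintegral => z _; rewrite mulr_suml; apply: eq_bigr => j _.
    by rewrite mulrA.
  rewrite (En_sum gg)// (bigD1 i)//= big1 ?addr0; last first.
    move=> j ji; rewrite (EnZ gg); first by rewrite En_coord_k 1?eq_sym// mulr0.
    by apply: ebnM; [exact: ebn_coord|exact: ebn_k].
  rewrite (EnZ gg); last by apply: ebnM; [exact: ebn_coord|exact: ebn_k].
  by rewrite !mxE; ring.
rewrite (ebn_fin gg ephi); apply: le_integral_measurable.
- by apply/measurable_EFinP; case: ephi.
- exact: measurable_support_fun.
move=> z; have := norm_k_le1 (z ord0 i); rewrite ler_norml => /andP[k1 k2].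
have dA : dotRn (x + y) z = dotRn x z + dotRn y z.
  by rewrite -big_split; apply: eq_bigr => j _; rewrite !mxE mulrDl.
have dB : dotRn (x - y) z = dotRn x z - dotRn y z.
  by rewrite -sumrB; apply: eq_bigr => j _; rewrite !mxE mulrBl.
apply: (@le_trans _ _ (Num.max (dotRn x z) (dotRn y z))%:E); last first.
  by rewrite EFin_max ge_max !dotRn_le_sup.
rewrite lee_fin /phi dA dB.
have : dotRn x z <= Num.max (dotRn x z) (dotRn y z) by rewrite le_max lexx.
have : dotRn y z <= Num.max (dotRn x z) (dotRn y z) by rewrite le_max lexx orbT.
move: k1 k2; move: (k _) => r; move: (Num.max _ _) => m; move: (dotRn x z) (dotRn y z) => p q; clear => k1 k2 qm pm.
nra.
Qed.

Lemma width_ge0 x : K x -> (0 <= gaussian_width gamma K)%E.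
Proof.
move=> Kx; have ex := ebn_dotRn x.
have <- : (\int[gamma]_z dotRn x z)%:E = 0%E by rewrite En_dotRn.
rewrite (ebn_fin gg ex); apply: le_integral_measurable.
- by apply/measurable_EFinP; case: ex.
- exact: measurable_support_fun.
- by move=> z; exact: dotRn_le_sup.
Qed.

End width.

Section finite_width.
Context {R : realType} {n : nat}.
Variable gamma : probability (borelRn R n) R.
Hypothesis gg : is_std_gaussian gamma.
Implicit Types (x y z w a b : 'rV[R]_n).
Variable f : 'rV[R]_n -> R.
Hypothesis df : forall x, differentiable f x.

Lemma finite_width : (gradient_width gamma f < +oo)%E ->
  exists L (h : 'rV[R]_n -> R), [/\ 0 <= L, lipn L f, lipn L h,
    gradient_width gamma f = (\int[gamma]_x h x)%:E /\ 0 <= \int[gamma]_x h x &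
    forall a z (r : R), 0 <= r -> f (a + r *: z) <= f a + r * h z].
Proof.
pose K := range (gradRn f); rewrite /gradient_width -/K => Wlt.
have KP x : K (gradRn f x) by exists x.
have Kr v : K v -> exists x, v = gradRn f x by move=> [x _ <-]; exists x.
pose W := gaussian_width gamma K.
have W0 : (0 <= W)%E := width_ge0 gg (KP 0).
pose w := fine W.
pose c i := \int[gamma]_z (z ord0 i * (z ord0 i * expR (- `|z ord0 i|))).
have c0 i : 0 < c i := En_k_gt0 gg i.
have wE : W = w%:E by rewrite /w fineK// ge0_fin_numE.
have w0 : 0 <= w by rewrite -lee_fin -wE.
(* Only the oscillation of each partial derivative is bounded by the width; its value at 0 then
   anchors the bound [Li]. *)
have d1 i x y : 'D_(eRn R i) f x - 'D_(eRn R i) f y <= 2 * w / c i.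
  have := width_ge gg i (KP x) (KP y); rewrite -/W wE lee_fin -/(c i) !mxE.
  by rewrite -ler_pdivlMr// ler_pdivrMr// mulrC mulrA.
pose Li i := `|'D_(eRn R i) f 0| + 2 * w / c i.
have Li0 i : 0 <= Li i.
  by rewrite addr_ge0// divr_ge0 ?(ltW (c0 i))// mulr_ge0.
pose L := \sum_i Li i.
have L0 : 0 <= L by exact: sumr_ge0.
have dL i x : `|'D_(eRn R i) f x| <= L.
  apply: (@le_trans _ _ (Li i)); last first.
    by rewrite /L (bigD1 i)//= lerDl sumr_ge0.
  have := d1 i x 0; have := d1 i 0 x; rewrite /Li.
  have := ler_norm ('D_(eRn R i) f 0); have := ler_norm (- 'D_(eRn R i) f 0); rewrite normrN.
  by move=> *; rewrite ler_norml; apply/andP; split; lra.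
have fL : lipn L f := lipn_grad df dL.
pose H z := ereal_sup [set (dotRn v z)%:E | v in K].
have Kb v z : K v -> `|dotRn v z| <= L * l1 z.
  by move=> /Kr[x ->]; apply: dotRn_le_l1 => i; rewrite mxE.
have Hub z : (H z <= (L * l1 z)%:E)%E.
  apply: ge_ereal_sup => _ [v Kv <-]; rewrite lee_fin.
  exact: le_trans (ler_norm _) (Kb v z Kv).
have Hlb z : ((dotRn (gradRn f 0) z)%:E <= H z)%E by exact: dotRn_le_sup.
pose h z := fine (H z).
have hE z : H z = (h z)%:E.
  rewrite /h fineK// fin_numE; apply/andP; split; apply/eqP => Hz.
    by have := Hlb z; rewrite Hz leeNy_eq.
  by have := Hub z; rewrite Hz leye_eq.
have vh v z : K v -> dotRn v z <= h z.
  by move=> Kv; rewrite -lee_fin -hE; exact: dotRn_le_sup.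
have hD z z' : h z <= h z' + L * l1 (z - z').
  rewrite -lee_fin -hE; apply: ge_ereal_sup => _ [v Kv <-]; rewrite lee_fin.
  have -> : dotRn v z = dotRn v z' + dotRn v (z - z') by rewrite -dotRnB; ring.
  by rewrite lerD ?vh// (le_trans (ler_norm _))// Kb.
have hL : lipn L h.
  move=> z z'; rewrite ler_norml; apply/andP; split.
    by have := hD z' z; rewrite -l1N opprB; lra.
  by have := hD z z'; lra.
have WE : gaussian_width gamma K = (\int[gamma]_x h x)%:E.
  rewrite (ebn_fin gg (lipn_ebn L0 hL)); apply: eq_integral => z _; exact: hE.
exists L, h; split => //.
  by split => //; rewrite -lee_fin -WE.
move=> a z r r0; have [c' _] := mvt_line a (r *: z) df.
have -> : \sum_i (r *: z) ord0 i * 'D_(eRn R i) f (a + c' *: (r *: z)) =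
   r * dotRn (gradRn f (a + c' *: (r *: z))) z.
  by rewrite mulr_sumr; apply: eq_bigr => i _; rewrite !mxE; ring.
have : r * dotRn (gradRn f (a + c' *: (r *: z))) z <= r * h z by rewrite ler_wpM2l// vh.
by move=> *; lra.
Qed.

End finite_width.

(** * Integrals against the measure with density *)

Section gaussian_density.
Context {R : realType} {n : nat}.
Variables gamma nu : probability (borelRn R n) R.
Hypothesis gg : is_std_gaussian gamma.
Variable f : 'rV[R]_n -> R.
Hypothesis cf : continuous f.
Hypothesis nuE : forall A : set (borelRn R n), measurable A ->
  nu A = (\int[gamma]_(x in A) (expR (f x))%:E)%E.

Let mf : measurable_fun setT (f : borelRn R n -> R) := continuous_borelRn cf.
Let mef : measurable_fun setT (fun x : borelRn R n => expR (f x)).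
Proof. exact: measurableT_comp. Qed.
Let nuI (F : borelRn R n -> \bar R) : measurable_fun setT F -> (forall x, 0 <= F x)%E ->
  (\int[nu]_x F x = \int[gamma]_x (F x * (expR (f x))%:E))%E.
Proof. by apply: ge0_integral_density => // x; exact: expR_ge0. Qed.

(** Integrate [1 - expR (- f x) <= f x] against [nu]; the exponential cancels the density and has
    integral one. *)
Lemma KL_ge0 : (0 <= KL nu f)%E.
Proof.
have mE : measurable_fun setT (fun x : borelRn R n => expR (- f x)).
  by apply: measurableT_comp => //; exact: measurableT_comp.
have I1 : (\int[nu]_x (expR (- f x))%:E = 1)%E.
  rewrite nuI; [|exact/measurable_EFinP|by move=> x; rewrite lee_fin expR_ge0].
  under eq_integral => x _ do rewrite -EFinM -expRD addNr expR0.
  rewrite integral_cst// mul1e; exact: probability_setT.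
have iE : nu.-integrable setT (fun x => (expR (- f x))%:E).
  apply/integrableP; split; first exact/measurable_EFinP.
  under eq_integral => x _ do rewrite abse_EFin ger0_norm ?expR_ge0//.
  by rewrite I1 ltry.
have i1 : nu.-integrable setT (fun x => 1%:E).
  by apply: finite_measure_integrable_cst.
have <- : (\int[nu]_x (1%:E - (expR (- f x))%:E) = 0)%E.
  by rewrite integralB// I1 integral_cst// [X in (_ * X)%E](@probability_setT _ _ _ nu) mule1 subee.
apply: le_integral_measurable.
- apply: emeasurable_funB => //; exact/measurable_EFinP.
- exact/measurable_EFinP.
by move=> x; rewrite -EFinB lee_fin; have := expR_ge1Dx (- f x); lra.
Qed.

Lemma integral_density_ebn (F : 'rV[R]_n -> R) : ebn (fun x => F x * expR (f x)) ->
  measurable_fun setT (F : borelRn R n -> R) ->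
  (\int[nu]_x (F x)%:E = (\int[gamma]_x (F x * expR (f x)))%:E)%E.
Proof.
move=> eF mF; rewrite (ebn_fin gg eF) [LHS]integralE [RHS]integralE.
have mF' : measurable_fun setT (fun x : borelRn R n => (F x)%:E) by exact/measurable_EFinP.
rewrite !nuI//; [|exact: measurable_funeneg|exact: measurable_funepos].
have e0 x : (0 <= (expR (f x))%:E)%E by rewrite lee_fin expR_ge0.
congr (_ - _)%E; apply: eq_integral => x _; rewrite ?funeposE ?funenegE EFinM.
  by rewrite maxe_pMl// mul0e.
by rewrite maxe_pMl// mul0e mulNe.
Qed.

Lemma En_expR1 : \int[gamma]_x expR (f x) = 1.
Proof.
have := nuE measurableT; rewrite (@probability_setT _ _ _ nu) => h.
by rewrite /Rintegral -h.
Qed.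

End gaussian_density.

(** The exponents add up to one, so the minimum factors as the product of its own powers, each of
    which is monotone. *)
Lemma min_le_powRM (R : realType) (w v : R) : 0 <= w -> 0 <= v ->
  Num.min w v <= w `^ (2 / 3) * v `^ (1 / 3).
Proof.
move=> w0 v0; set m := Num.min w v.
have m0 : 0 <= m by rewrite le_min w0 v0.
have mE : m = m `^ (2 / 3) * m `^ (1 / 3).
  have [->|mn0] := eqVneq m 0; first by rewrite powR0 ?mul0r//; lra.
  rewrite -powRD ?mn0 ?implybT// -[LHS]powRr1//; congr (_ `^ _); lra.
by rewrite mE; apply: ler_pM; rewrite ?powR_ge0// ge0_ler_powR ?nnegrE//
  ?(ge_min, lexx, orbT)//; lra.
Qed.

Unset Implicit Arguments. Set Strict Implicit.
Local Open Scope ereal_scope.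

Theorem theorem1p7 (R : realType) (n : nat)
  (gamma nu : probability (borelRn R n) R) (f : 'rV[R]_n -> R) :
  is_std_gaussian gamma ->
  twice_differentiable f ->
  (forall A : set (borelRn R n), measurable A ->
     nu A = \int[gamma]_(x in A) (expR (f x))%:E) ->
  fisher nu f - 2%:E * KL nu f <=
    2%:E * (gradient_width gamma f) `^ (2 / 3)%R * (fisher nu f) `^ (1 / 3)%R
    + maxe (- ereal_inf [set (laplacianRn f x)%:E | x in setT]) 0.
Proof.
move=> gg [df d2f] nuE.
have cf : continuous f by move=> x; exact: differentiable_continuous.
have K0 := KL_ge0 cf nuE.
have F0 : 0 <= fisher nu f.
  by apply: integral_ge0 => x _; rewrite lee_fin sumr_ge0// => i _; rewrite -expr2 sqr_ge0.
set lap := ereal_inf _.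
have m0 : 0 <= maxe (- lap) 0 by rewrite le_max lexx orbT.
(* The conventions [+oo - +oo = -oo] and [+oo * 0 = 0] settle the degenerate cases. *)
have [KLy|KLn] := eqVneq (KL nu f) +oo.
  by rewrite KLy gt0_muley ?lte_fin// addeNy leNye.
have [Wlt|] := ltP (gradient_width gamma f) +oo; last first.
  rewrite leye_eq => /eqP ->; rewrite poweRyr; last by rewrite gt_eqF.
  rewrite gt0_muley ?lte_fin//.
  have [->|Fn0] := eqVneq (fisher nu f) 0.
    rewrite poweR0r ?gt_eqF// mule0 !add0e (le_trans _ m0)// oppe_le0.
    by rewrite mule_ge0.
  rewrite gt0_mulye; last by rewrite poweR_gt0// lt_neqAle eq_sym Fn0.
  by rewrite addye ?leey// gt_eqF// (lt_le_trans _ m0).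
have [L [h [L0 fL hL [WE w0] fh]]] := finite_width gg df Wlt.
have ef := lipn_ebn L0 fL; have eef := lipn_expR_ebn L0 fL.
have f1 := En_expR1 nuE.
have KE : KL nu f = (\int[gamma]_x (f x * expR (f x)))%:E.
  by apply: integral_density_ebn => //; [exact: ebnM|exact: continuous_borelRn].
have ed i : ebn (fun x => 'D_(eRn R i) f x) by apply: (ebn_deriv L0 fL).
have eg : ebn (fun x => sqnormRn (gradRn f x)).
  rewrite (_ : (fun x => _) = (fun x => \sum_i 'D_(eRn R i) f x ^+ 2)%R).
    by apply: ebn_sum => i; exact: ebnX.
  by apply/funext => x; apply: eq_bigr => i _; rewrite mxE.
have FE : fisher nu f = (\int[gamma]_x (sqnormRn (gradRn f x) * expR (f x)))%:E.
  by apply: integral_density_ebn => //; [exact: ebnM|case: eg].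
have [lapNy|lapn] := eqVneq lap -oo.
  by rewrite lapNy maxye addey ?leey// WE FE !poweR_EFin.
have lapE : lap = (fine lap)%:E.
  rewrite fineK// fin_numE lapn/=; apply/negP => /eqP lapy.
  have : lap <= (laplacianRn f 0)%:E by apply: ereal_inf_lbound; exists 0%R.
  by rewrite lapy leye_eq.
set M := Num.max (- fine lap)%R 0%R.
have M0 : (0 <= M)%R by rewrite le_max lexx orbT.
have ME : maxe (- lap) 0 = M%:E by rewrite lapE -EFinN -EFin_max.
have hM y : (- M <= laplacianRn f y)%R.
  rewrite lerNl; apply: (@le_trans _ _ (- fine lap)%R).
    by rewrite lerN2 -lee_fin -lapE; apply: ereal_inf_lbound; exists y.
  by rewrite le_max lexx.
have := fisher_le_width_entropy gg L0 M0 fL hL (conj df d2f) hM f1 fh.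
have -> : (\int[gamma]_x ((\sum_i 'D_(eRn R i) f x ^+ 2) * expR (f x)))%R =
    (\int[gamma]_x (sqnormRn (gradRn f x) * expR (f x)))%R.
  apply: eq_Rintegral => x _; congr (_ * _)%R.
  by apply: eq_bigr => i _; rewrite mxE.
move: F0 K0; rewrite ME WE FE KE !poweR_EFin -!EFinM -EFinB -EFinD !lee_fin.
move: (\int[gamma]_x (_ * expR (f x)))%R (\int[gamma]_x (f x * expR (f x)))%R => I K I0 K0 IM.
(* Either the width is at most the product of powers and [IM] concludes, or the Fisher information
   is, and nonnegativity of the entropy concludes. Both cases leave a factor of two to spare. *)
have := min_le_powRM w0 I0; rewrite ge_min -mulrA.
by move=> /orP[]; lra.
Qed.
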